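(* Let $d\ge2$ and let $\mu_t^\varepsilon$, $D_1$, $c_1$, $\epsilon_1$ be as in the context. There exists $c_6=c_6(d)>0$ such that $$\frac{\mu_t^\varepsilon(B_R(x))}{R^{d-1}}\le c_6D_1(1+t)e^{c_1(1+t)}$$ for all $(x,t)\in\Omega\times[0,\infty)$, all $\varepsilon\in(0,\epsilon_1)$ and all $0<R<\frac14$.
   Context: Basic notation. $\Omega=\mathbb{T}^d=(\mathbb{R}/\mathbb{Z})^d$, also identified with $[0,1)^d\subset\mathbb{R}^d$; functions, sets and measures on $\Omega$ are extended $\Omega$-periodically to $\mathbb{R}^d$. $W(s)=\frac{(1-s^2)^2}{2}$, $k(s)=\int_0^s\sqrt{2W(\tau)}\,d\tau$ (equal to $s-\frac13s^3$ for $|s|\le1$), $\sigma=\int_{-1}^1\sqrt{2W(s)}\,ds$, $q^\varepsilon(r)=\tanh(r/\varepsilon)$. $B_R(x)$ is the open ball, $\omega_{d-1}$ the volume of the unit ball of $\mathbb{R}^{d-1}$; $\|\nabla\chi_A\|$ is the total variation measure of the distributional gradient of $\chi_A$. Initial set. $U_0\subset\subset(0,1)^d$ is a bounded open set, $M_0=\partial U_0$, such that: (1) there is $D_0>0$ with $\sup_{x\in\mathbb{R}^d,R>0}\frac{\mathcal{H}^{d-1}(M_0\cap B_R(x))}{\omega_{d-1}R^{d-1}}\le D_0$; (2) there are open sets $U_0^i\subset(0,1)^d$, $i\ge1$, with $C^3$ boundaries $M_0^i$, such that $\mathcal{L}^d(U_0\triangle U_0^i)\to0$ and $\|\nabla\chi_{U_0^i}\|\to\|\nabla\chi_{U_0}\|$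 as measures. $U_0^i$, $M_0^i$ are extended periodically to $\mathbb{R}^d$. Initial data. Let $\varepsilon_i\in(0,1)$, $\varepsilon_i\downarrow0$. Let $r_{\varepsilon_i}(x)=\mathrm{dist}(x,M_0^i)$ for $x\in U_0^i$ and $-\mathrm{dist}(x,M_0^i)$ for $x\notin U_0^i$; let $\overline{r_{\varepsilon_i}}$ be a periodic smoothing of $r_{\varepsilon_i}$ with $|\nabla\overline{r_{\varepsilon_i}}|\le1$, $|\nabla^2\overline{r_{\varepsilon_i}}|\le\varepsilon_i^{-1}$ on $\mathbb{R}^d$ and $\overline{r_{\varepsilon_i}}=r_{\varepsilon_i}$ near $M_0^i$. Put $\varphi_0^{\varepsilon_i}=q^{\varepsilon_i}(\overline{r_{\varepsilon_i}})$. Throughout, $\varepsilon$ stands for elements $\varepsilon_i$ of this sequence (so $\varepsilon\in(0,\epsilon_1)$ means those $\varepsilon_i<\epsilon_1$). Equation. $\varphi^\varepsilon$ is the (periodic, global in time) solution of $$\varepsilon\varphi_t^\varepsilon=\varepsilon\Delta\varphi^\varepsilon-\frac{W'(\varphi^\varepsilon)}{\varepsilon}+\lambda^\varepsilon\sqrt{2W(\varphi^\varepsilon)}\ \text{ in }\Omega\times(0,\infty),\qquad\varphi^\varepsilon(\cdot,0)=\varphi_0^\varepsilon,$$ $$\lambda^\varepsilon(t)=\frac{-\int_\Omega\sqrt{2W(\varphi^\varepsilon)}\,\big(\varepsilon\Delta\varphi^\varepsilon-W'(\varphi^\varepsilon)/\varepsilon\big)\,dx}{2\int_\Omega W(\varphi^\varepsilon)\,dx}.$$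 Measures and constants. $\mu_t^\varepsilon(\phi)=\frac1\sigma\int_{\mathbb{R}^d}\phi\big(\frac{\varepsilon|\nabla\varphi^\varepsilon|^2}{2}+\frac{W(\varphi^\varepsilon)}{\varepsilon}\big)dx$ for $\phi\in C_c(\mathbb{R}^d)$. Standing properties of the initial data: $\omega=\omega(U_0)>0$ and $D_1=D_1(D_0)>0$ are constants such that, for all $\varepsilon=\varepsilon_i$, $|\int_\Omega k(\varphi_0^\varepsilon)\,dx|\le\frac23-\omega$, $\mu_0^\varepsilon(\Omega)\le D_1$, and $\mu_0^\varepsilon(B_R(x))\le D_1\omega_{d-1}R^{d-1}$ for all $x\in\mathbb{R}^d$, $0<R\le1$. The constants $c_1=c_1(\omega,D_1)>0$ and $\epsilon_1=\epsilon_1(\omega)>0$ are such that $\sup_{\varepsilon\in(0,\epsilon_1)}\int_0^T|\lambda^\varepsilon(t)|^2\,dt\le c_1(1+T)$ for every $T>0$. *)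

(* Defs.v *)
From HB Require Import structures.
From mathcomp Require Import all_boot all_order all_algebra.
From mathcomp Require Import all_classical all_reals all_analysis measurable_realfun.
Set Implicit Arguments.
Unset Strict Implicit.
Unset Printing Implicit Defensive.
Import Order.TTheory GRing.Theory Num.Theory.
Import numFieldNormedType.Exports.
Local Open Scope classical_set_scope.
Local Open Scope ring_scope.

Definition rV_display : measure_display.
Proof. exact: default_measure_display. Qed.

(* Row vectors carry the Borel sigma-algebra. *)
Section borel_rV.
Variables (R : realType) (n : nat).

Definition borel_rV : set (set 'rV[R]_n) := <<s @open 'rV[R]_n >>.

Let borel0 : borel_rV set0. Proof. exact: sigma_algebra0. Qed.
Let borelC A : borel_rV A -> borel_rV (~` A).
Proof. exact: sigma_algebraC. Qed.
Let borelU (F : (set 'rV[R]_n)^nat) :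
  (forall i, borel_rV (F i)) -> borel_rV (\bigcup_i F i).
Proof. exact: sigma_algebra_bigcup. Qed.

HB.instance Definition _ :=
  @isMeasurable.Build rV_display 'rV[R]_n borel_rV borel0 borelC borelU.

End borel_rV.

Section measurable_rV.
Variable R : realType.

Lemma open_measurable_rV n (O : set 'rV[R]_n) : open O -> measurable O.
Proof. by move=> oO; exact: sub_sigma_algebra. Qed.

Lemma continuous_measurable_rV n (f : 'rV[R]_n -> R) :
  continuous f -> measurable_fun setT f.
Proof.
move=> /continuousP cf; apply: (measurability _ (RGenOpens.measurableE R)).
move=> _ [_ [a [b ->] <-]]; rewrite setTI; apply: open_measurable_rV.
exact/cf/interval_open.
Qed.

Lemma open_rV_bigcup n (O : set 'rV[R]_n) : open O ->
  let B (p : 'rV[rat]_n * nat) :=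
    [set v : 'rV[R]_n | forall i, ball (ratr (p.1 0 i) : R) p.2.+1%:R^-1 (v 0 i)] in
  O = \bigcup_p (if `[< B p `<=` O >] then B p else set0).
Proof.
move=> oO B; apply/seteqP; split=> [v Ov|v [p _]]; last first.
  by case: ifPn => // /asboolP; exact.
have /nbhs_ballP[e /= e0 veO] : nbhs v O by exact: open_nbhs_nbhs.
have [k _ /(_ _ (leqnn k)) /= ke] :
    \forall k \near \oo, (k.+1%:R^-1 < e / 2 :> R).
  have e2 : 0 < e / 2 by rewrite divr_gt0.
  exact: (near_infty_natSinv_lt (PosNum e2)).
have k0 : 0 < k.+1%:R^-1 :> R by rewrite invr_gt0.
have /choice[q vq] : forall i, exists q : rat, `|ratr q - v 0 i| < k.+1%:R^-1.
  move=> i; have : v 0 i - k.+1%:R^-1 < v 0 i + k.+1%:R^-1.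
    by rewrite ltrBlDr -addrA ltrDl addr_gt0.
  move=> /rat_in_itvoo[q]; rewrite in_itv /= => /andP[q1 q2]; exists q.
  by rewrite ltr_distl q1.
have Bv : B (\row_i q i, k) v by move=> i /=; rewrite mxE; exact: vq.
exists (\row_i q i, k) => //; case: ifPn => // /asboolPn[].
move=> w Bw; apply: veO; split => // i j; rewrite (ord1 i).
have := Bw j; have := Bv j; rewrite /= !mxE /ball /= => h1 h2.
rewrite (splitr e); apply: (@le_lt_trans _ _
  (`|v 0 j - ratr (q j)| + `|ratr (q j) - w 0 j|)); first exact: ler_distD.
by rewrite ltrD ?(lt_trans _ ke) // distrC.
Qed.

Lemma measurable_fun_rV d (T : measurableType d) n (f : T -> 'rV[R]_n) :
  (forall i, measurable_fun setT (fun x => f x 0 i)) -> measurable_fun setT f.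
Proof.
move=> mf; apply: (measurability (@open 'rV[R]_n)) => //.
move=> _ [U oU <-]; rewrite (open_rV_bigcup oU) setTI preimage_bigcup.
apply: countable_bigcupT_measurable => [|p]; first exact: countableP.
case: ifPn => _; last by rewrite preimage_set0.
rewrite (_ : _ @^-1` _ = \bigcap_(i in [set: 'I_n])
  ((fun x => f x 0 i) @^-1` (ball (ratr (p.1 0 i) : R) p.2.+1%:R^-1))).
  apply: fin_bigcap_measurable => // i _; rewrite -[X in measurable X]setTI.
  by apply: mf => //; exact: measurable_ball.
apply/seteqP; split=> x h i; first by move=> _; exact: h.
exact: (h i I).
Qed.

End measurable_rV.

Section lebesgue_rV.
Variable R : realType.

Definition cons_rV n (p : R * 'rV[R]_n) : 'rV[R]_n.+1 :=
  \row_i oapp (fun j => p.2 0 j) p.1 (unlift ord0 i).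

Definition uncons_rV n (v : 'rV[R]_n.+1) : R * 'rV[R]_n :=
  (v 0 ord0, \row_j v 0 (lift ord0 j)).

Lemma cons_rVK n : cancel (@cons_rV n) (@uncons_rV n).
Proof.
move=> [x v]; rewrite /uncons_rV mxE unlift_none /=; congr pair.
by apply/rowP => j; rewrite !mxE liftK.
Qed.

Lemma measurable_cons_rV n : measurable_fun setT (@cons_rV n).
Proof.
apply: measurable_fun_rV => i; under eq_fun do rewrite mxE.
case: unliftP => [j|] _ /=; last exact: measurable_fst.
apply: (measurableT_comp (f := fun v : 'rV[R]_n => v 0 j)) => //.
by apply: continuous_measurable_rV => v; exact: coord_continuous.
Qed.

Lemma measurable_uncons_rV n : measurable_fun setT (@uncons_rV n).
Proof.
apply: measurable_fun_pair.
  by apply: continuous_measurable_rV => v; exact: coord_continuous.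
apply: measurable_fun_rV => i; under eq_fun do rewrite mxE.
by apply: continuous_measurable_rV => v; exact: coord_continuous.
Qed.

Definition lebesgue_cons n (m : {sigma_finite_measure set 'rV[R]_n -> \bar R}) :
    set 'rV[R]_n.+1 -> \bar R :=
  pushforward (lebesgue_measure \x m)%E (@cons_rV n).

Section instances.
Variables (n : nat) (m : {sigma_finite_measure set 'rV[R]_n -> \bar R}).

HB.instance Definition _ := Measure.copy (lebesgue_cons m)
  (measure_function_pushforward__canonical__measure_function_Measure
     (lebesgue_measure \x m)%E (@measurable_cons_rV n)).

Let lebesgue_cons_sigma_finite : sigma_finite setT (lebesgue_cons m).
Proof.
have /sigma_finiteP[F [TF ndF Foo]] := sigma_finiteT (@lebesgue_measure R).
have /sigma_finiteP[G [TG ndG Goo]] := sigma_finiteT m.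
exists (fun k => @uncons_rV n @^-1` (F k `*` G k)).
  rewrite -preimage_bigcup (_ : \bigcup_k _ = setT) ?preimage_setT //.
  rewrite -setXTT TF TG; apply/seteqP; split=> [[x y] [k _ [Fk Gk]]|].
    by split; exists k.
  move=> [x y] [[k _ Fk] [l _ Gl]]; exists (maxn k l) => //; split => /=.
  - by move: Fk; exact/subsetPset/ndF/leq_maxl.
  - by move: Gl; exact/subsetPset/ndG/leq_maxr.
move=> k; have [mF Fk] := Foo k; have [mG Gk] := Goo k; split.
  rewrite -[X in measurable X]setTI; apply: measurable_uncons_rV => //.
  exact: measurableX.
rewrite /lebesgue_cons /pushforward -comp_preimage (_ : _ \o _ = id).
  by rewrite /= product_measure1E// lte_mul_pinfty// ge0_fin_numE.
by apply/funext; exact: cons_rVK.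
Qed.

HB.instance Definition _ := @Measure_isSigmaFinite.Build _ _ _
  (lebesgue_cons m) lebesgue_cons_sigma_finite.

End instances.

(* Lebesgue measure on R^n, as the iterated product of the one-dimensional one. *)
Fixpoint lebesgue_rV n : {sigma_finite_measure set 'rV[R]_n -> \bar R} :=
  if n is n'.+1 then lebesgue_cons (lebesgue_rV n') else \d_(0 : 'rV[R]_0).

End lebesgue_rV.

(* The library's norm, distance and balls on 'rV[R]_d are those of the sup
   norm; its topology is the usual one.  Everything metric below goes through
   the Euclidean norm [enorm]. *)
Section euclidean.
Variables (R : realType) (d : nat).
Implicit Types (x y v : 'rV[R]_d) (A B : set 'rV[R]_d) (f g : 'rV[R]_d -> R).

Definition enorm v : R := Num.sqrt (\sum_i v 0 i ^+ 2).

Definition eball x (r : R) : set 'rV[R]_d := [set y | enorm (y - x) < r].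

Definition euclid_dist x A : R := inf [set enorm (x - y) | y in A].

Definition boundary A : set 'rV[R]_d := closure A `\` interior A.

Definition partial (i : 'I_d) f : 'rV[R]_d -> R := fun x => 'D_(delta_mx 0 i) f x.

Definition grad f x : 'rV[R]_d := \row_i partial i f x.

Definition hess f x : 'M[R]_d := \matrix_(i, j) partial i (partial j f) x.

Definition lap f x : R := \sum_i partial i (partial i f) x.

Fixpoint Ck (k : nat) f : Prop :=
  if k is k'.+1 then
    continuous f /\
    forall i, (forall x, derivable f x (delta_mx 0 i)) /\ Ck k' (partial i f)
  else continuous f.

Definition compactly_contained A B := compact (closure A) /\ closure A `<=` B.

Definition periodic f := forall (i : 'I_d) x, f (x + delta_mx 0 i) = f x.

Definition periodize A : set 'rV[R]_d :=
  [set x | exists z : 'rV[int]_d, A (x - map_mx intr z)].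

(* The torus, identified with [0, 1)^d. *)
Definition Omega : set 'rV[R]_d := [set x | forall i, 0 <= x 0 i < 1].

Definition open_cube : set 'rV[R]_d := [set x | forall i, 0 < x 0 i < 1].

End euclidean.
Arguments Omega {R d}.
Arguments open_cube {R d}.

(* The boundary is locally the graph of a C^3 function of the other d - 1
   coordinates over the k-th one, with the set on one side of it; [s] chooses
   the side. *)
Definition C3_boundary (R : realType) (d : nat) (U : set 'rV[R]_d) : Prop :=
  forall p, boundary U p ->
    exists (r : R) (k : 'I_d) (s : bool) (gamma : 'rV[R]_d.-1 -> R),
      [/\ 0 < r, Ck 3 gamma &
          forall x, eball p r x ->
            (U x <-> gamma (col' k x) < (-1) ^+ s * x 0 k)].

Section geometric_measure_theory.
Variables (R : realType) (d : nat).
Implicit Types (A O : set 'rV[R]_d).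
Local Open Scope ereal_scope.

Definition unit_ball_volume (m : nat) : \bar R :=
  lebesgue_rV R m (eball (0%R : 'rV[R]_m) 1%R).

(* 0 is inserted so that the diameter of the empty set is 0. *)
Definition diam A : \bar R :=
  ereal_sup (0 |` [set z | exists2 x, A x & exists2 y, A y &
                             z = (enorm (x - y)%R)%:E]).

(* Hausdorff (outer) measure of integer dimension s >= 1. *)
Definition hausdorff_pre (s : nat) (delta : R) A : \bar R :=
  ereal_inf [set \sum_(0 <= k <oo)
                   unit_ball_volume s * (2^-1%:E * diam (C k)) ^+ s
            | C in [set C : (set 'rV[R]_d)^nat |
                     A `<=` \bigcup_k C k /\
                     forall k, diam (C k) <= delta%:E]].

Definition hausdorff (s : nat) A : \bar R :=
  ereal_sup [set hausdorff_pre s delta A | delta in [set delta : R | (0 < delta)%R]].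

Definition divergence (g : 'rV[R]_d -> 'rV[R]_d) (x : 'rV[R]_d) : R :=
  (\sum_i partial i (fun y => g y 0 i) x)%R.

Definition variation_on A O : \bar R :=
  ereal_sup [set (\int[lebesgue_rV R d]_(x in A) divergence g x)%R%:E
            | g in [set g : 'rV[R]_d -> 'rV[R]_d |
                     [/\ forall i, Ck 1 (fun y => g y 0%R i),
                         compactly_contained [set x | g x != 0%R] O &
                         forall x, (enorm (g x) <= 1)%R]]].

(* nu is the total variation measure of the distributional gradient of the
   indicator of A; it is determined by its values on open sets. *)
Definition is_total_variation A
    (nu : {measure set 'rV[R]_d -> \bar R}) : Prop :=
  (forall O, open O -> nu O = variation_on A O) /\
  (forall K, compact K -> nu K < +oo).

Definition cvg_total_variation (A : (set 'rV[R]_d)^nat) (A0 : set 'rV[R]_d) :=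
  exists (nu : nat -> {measure set 'rV[R]_d -> \bar R})
         (nu0 : {measure set 'rV[R]_d -> \bar R}),
    [/\ forall i, is_total_variation (A i) (nu i),
        is_total_variation A0 nu0 &
        forall phi : 'rV[R]_d -> R, continuous phi ->
          compact (closure [set x | phi x != 0%R]) ->
          (\int[nu i]_x phi x)%R @[i --> \oo] --> (\int[nu0]_x phi x)%R].

End geometric_measure_theory.

Section double_well.
Variable R : realType.

Definition W (s : R) : R := (1 - s ^+ 2) ^+ 2 / 2.

Definition kfun (s : R) : R :=
  if 0 <= s then \int[lebesgue_measure]_(tau in `[0, s]) Num.sqrt (2 * W tau)
  else - \int[lebesgue_measure]_(tau in `[s, 0]) Num.sqrt (2 * W tau).

Definition sigma : R :=
  \int[lebesgue_measure]_(s in `[-1, 1]) Num.sqrt (2 * W s).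

Definition tanh (s : R) : R := (expR s - expR (- s)) / (expR s + expR (- s)).

Definition profile (eps r : R) : R := tanh (r / eps).

End double_well.

Section initial_configuration.
Variables (R : realType) (d : nat).

(* In the density bound M_0 is the boundary of U_0 in R^d, not its periodic
   extension, whose measure in balls of radius r grows like r^d. *)
Record initial_set (D0 : R) (U0 : set 'rV[R]_d) (U : (set 'rV[R]_d)^nat) : Prop :=
  InitialSet {
    U0_open : open U0 ;
    U0_subset : compactly_contained U0 open_cube ;
    M0_density : forall (x : 'rV[R]_d) (r : R), 0 < r ->
      (hausdorff d.-1 (boundary U0 `&` eball x r) <=
         D0%:E * (unit_ball_volume R d.-1 * (r ^+ d.-1)%:E))%E ;
    U_open : forall i, open (U i) ;
    U_subset : forall i, U i `<=` open_cube ;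
    U_C3 : forall i, C3_boundary (U i) ;
    U_cvg :
      lebesgue_rV R d ((U0 `\` U i) `|` (U i `\` U0)) @[i --> \oo] --> 0%E ;
    U_cvg_variation :
      cvg_total_variation (fun i => periodize (U i)) (periodize U0)
  }.

Definition signed_dist (U : set 'rV[R]_d) (x : 'rV[R]_d) : R :=
  let dM := euclid_dist x (periodize (boundary U)) in
  if `[< periodize U x >] then dM else - dM.

(* The Hessian bound is in operator norm. *)
Definition initial_datum (eps : R) (U : set 'rV[R]_d)
    (phi0 : 'rV[R]_d -> R) : Prop :=
  exists rbar : 'rV[R]_d -> R,
    [/\ Ck 3 rbar, periodic rbar,
        (forall x, enorm (grad rbar x) <= 1) /\
        (forall x v, enorm (v *m hess rbar x) <= eps^-1 * enorm v),
        forall y, periodize (boundary U) y ->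
          \forall x \near y, rbar x = signed_dist U x &
        forall x, phi0 x = profile eps (rbar x)].

End initial_configuration.

Section equation.
Variables (R : realType) (d : nat).
Implicit Types (eps t : R) (u : 'rV[R]_d -> R) (phi : R -> 'rV[R]_d -> R).

Definition lambda_of eps u : R :=
  - (\int[lebesgue_rV R d]_(x in Omega)
       (Num.sqrt (2 * W (u x)) *
          (eps * lap u x - derive1 (@W R) (u x) / eps)))
  / (2 * \int[lebesgue_rV R d]_(x in Omega) W (u x)).

(* Classical solutions, with the derivatives occurring in the formula for
   lambda continuous up to t = 0.  Values of phi for t < 0 are irrelevant. *)
Record solution eps (phi0 : 'rV[R]_d -> R) phi : Prop := Solution {
  sol_periodic : forall t, 0 <= t -> periodic (phi t) ;
  sol_C2 : forall t, 0 <= t -> Ck 2 (phi t) ;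
  sol_continuous :
    {within [set p : R * 'rV[R]_d | 0 <= p.1],
      continuous (fun p => phi p.1 p.2)} ;
  sol_grad_continuous : forall i,
    {within [set p : R * 'rV[R]_d | 0 <= p.1],
      continuous (fun p => partial i (phi p.1) p.2)} ;
  sol_hess_continuous : forall i j,
    {within [set p : R * 'rV[R]_d | 0 <= p.1],
      continuous (fun p => partial i (partial j (phi p.1)) p.2)} ;
  sol_derivable : forall t x, 0 < t -> derivable (phi ^~ x) t 1 ;
  sol_dt_continuous :
    {within [set p : R * 'rV[R]_d | 0 < p.1],
      continuous (fun p => derive1 (phi ^~ p.2) p.1)} ;
  sol_equation : forall t x, 0 < t ->
    eps * derive1 (phi ^~ x) t =
      eps * lap (phi t) x - derive1 (@W R) (phi t x) / eps
      + lambda_of eps (phi t) * Num.sqrt (2 * W (phi t x)) ;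
  sol_initial : forall x, phi 0 x = phi0 x
}.

(* The value on A of the measure sigma^-1 (eps |grad u|^2 / 2 + W(u) / eps) dx
   on R^d. *)
Definition energy_measure eps u (A : set 'rV[R]_d) : \bar R :=
  ((sigma R)^-1%:E *
    \int[lebesgue_rV R d]_(x in A)
      (eps * enorm (grad u x) ^+ 2 / 2 + W (u x) / eps)%:E)%E.

End equation.

(* Main.v *)
Require Import Defs.
From mathcomp Require Import all_boot all_order all_algebra ring lra.
From mathcomp Require Import all_classical all_reals all_analysis measurable_realfun.
Set Implicit Arguments.
Unset Strict Implicit.
Unset Printing Implicit Defensive.
Import Order.TTheory GRing.Theory Num.Theory.
Import numFieldNormedType.Exports.
Local Open Scope classical_set_scope.
Local Open Scope ring_scope.

(* Write [phi = tanh (r / eps)].  A one-point maximum principle, driven by the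
   bound on the integral of [lambda ^ 2], keeps [|phi| < 1]; a two-point maximum
   principle for [r x - r y - |x - y|] keeps [r] 1-Lipschitz, because [lambda]
   enters the equation of [r] as a term depending on [t] only.  Hence
   [eps |grad phi| ^ 2 / 2 <= W phi / eps] at all times.  With this sign of the
   discrepancy, the energy [E] weighted by a backward heat kernel satisfies
   [E' <= lambda ^ 2 / 2 * E] (Huisken's monotonicity formula; Young's inequality
   absorbs the forcing).  The kernel is made periodic by using
   [sin (pi z) ^ 2 / (4 pi ^ 2)] for [z ^ 2 / 4], which costs a factor bounded on
   bounded times.  The formula is integrated over the last half unit of time, the
   kernel being compared at the initial time with a dyadic sum of balls; the
   earlier times are covered by the unweighted energy inequality. *)

(** * Differential calculus on row vectors *)

(** While [|phi| < 1], the function [r] solves [r_t = lap r + (2 phi / eps) (1 - |grad r|^2) +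
    lambda]. Its maxima in space grow at most at the rate [2 / eps + lambda]; where the two-point
    function is maximal both gradients are the same unit vector, so the reaction term vanishes. As
    [grad phi = (1 - phi^2) / eps * grad r], the Lipschitz bound is exactly the sign of the
    discrepancy. Two gaps in regularity shape the proof. No mixed derivative of [phi] in [t] and [x]
    is at hand, so the energy is differentiated through finite increments in time, integrated by
    parts in space beforehand. Time derivatives exist for [t > 0] only, so estimates start at
    positive times and pass to the limit. For the phase [z^2 / 4] the condition on the kernel is an
    equality. The sine phase keeps the two features used, a second derivative at most 1/2 and
    periodicity, with a defect of at most [pi^2] per coordinate. Half a unit of time keeps the
    initial scale of the kernel below 1, the range of the growth hypothesis on balls. *)

Section line_derivatives.
Context {R : realType} {V : normedModType R}.
Implicit Types (f : V -> R) (x v : V).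

Lemma is_derive_line f x v (s df : R) :
  is_derive (s *: v + x) v f df ->
  is_derive s 1 (fun s => f (s *: v + x)) df.
Proof.
move=> [fd fE].
have E : (fun h : R => h^-1 *: (f (h *: v + (s *: v + x)) - f (s *: v + x))) =
  (fun h : R => h^-1 *: (f ((h *: (1 : R) + s) *: v + x) - f (s *: v + x))).
  by apply/funext => h; rewrite scaler1 scalerDl addrA.
split.
  by move: fd; rewrite /derivable /= E.
by move: fE; rewrite /derive /= E.
Qed.

Lemma is_derive_line0 f x v (df : R) :
  is_derive (0 : R) 1 (fun s => f (s *: v + x)) df -> is_derive x v f df.
Proof.
have E : (fun h : R => h^-1 *: (f (h *: v + x) - f x)) =
  (fun h : R => h^-1 *: (f ((h *: (1 : R) + 0) *: v + x) - f (0 *: v + x))).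
  by apply/funext => h; rewrite scaler1 addr0 scale0r add0r.
by move=> [fd fE]; split; [move: fd|move: fE]; rewrite /derivable /derive /= E.
Qed.

Lemma is_derive_compR (g : R -> R) f x v (dg df : R) :
  is_derive (f x) 1 g dg -> is_derive x v f df ->
  is_derive x v (g \o f) (dg * df).
Proof.
move=> hg hf; apply: is_derive_line0.
apply: (@is_derive1_comp _ g (fun s => f (s *: v + x))).
  by rewrite scale0r add0r.
by apply: is_derive_line; rewrite scale0r add0r.
Qed.

Lemma is_derive_dirZ f x v (c df : R) :
  is_derive x v f df -> is_derive x (c *: v) f (c * df).
Proof.
move=> hf; apply: is_derive_line0.
under eq_fun do rewrite scalerA.
rewrite mulrC.
apply: (@is_derive1_comp _ (fun s => f (s *: v + x)) (fun s => s * c)).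
  by apply: is_derive_line; rewrite mul0r scale0r add0r.
apply: (is_derive_eq (@is_deriveM R R id (cst c) 0 1 1 0
  (is_derive_id _ _) (is_derive_cst _ _ _))).
by rewrite scale0r add0r scaler1.
Qed.

Lemma MVT_line f x v (h : R) : (forall y, derivable f y v) ->
  exists2 s, 0 <= s <= 1 &
    f (h *: v + x) - f x = h * 'D_v f ((s * h) *: v + x).
Proof.
move=> fd.
have D (s : R) : is_derive s 1 (fun s : R => f (s *: (h *: v) + x))
    (h * 'D_v f ((s * h) *: v + x)).
  apply: is_derive_line; apply: is_derive_dirZ.
  by rewrite scalerA; exact: derivableP.
have [|s] := @MVT_segment R _ _ 0 1 ler01 (fun s _ => D s).
  apply: continuous_subspaceT => s; apply: differentiable_continuous.
  by apply/derivable1_diffP; case: (D s).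
rewrite in_itv /= => s01; rewrite scale1r scale0r add0r subr0 mulr1 => E.
by exists s.
Qed.

(** The increment splits at [h *: v + x], and the mean value theorem along [u] handles the piece in
    that direction. This lets directions be added one at a time without passing through Frechet
    differentiability. *)
Lemma is_derive_dirD f x u v (df : R) : (forall y, derivable f y u) ->
  {for x, continuous ('D_u f)} -> is_derive x v f df ->
  is_derive x (v + u) f (df + 'D_u f x).
Proof.
move=> fu cu fv.
suff : h^-1 *: (f (h *: (v + u) + x) - f x) @[h --> 0^'] --> df + 'D_u f x.
  move=> c; split; first by apply/cvg_ex; exists (df + 'D_u f x).
  exact/cvg_lim.
(* Nothing is known of [s] as a function of [h]; only [s h * h --> 0] matters, and it follows by
   squeezing. *)
have /choice[s sP] : forall h, exists s, 0 <= s <= 1 /\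
    f (h *: u + (h *: v + x)) - f (h *: v + x) =
      h * 'D_u f ((s * h) *: u + (h *: v + x)).
  by move=> h; have [s ? ?] := MVT_line (h *: v + x) h fu; exists s.
have hv : h^-1 *: (f (h *: v + x) - f x) @[h --> 0^'] --> df.
  by case: fv => + <-.
have hs : (s h * h) @[h --> 0^'] --> (0 : R).
  have h0 : `|h| @[h --> (0 : R)^'] --> (0 : R).
    by apply/norm_cvg0P; exact: cvg_within.
  apply/norm_cvg0P.
  apply: (@squeeze_cvgr _ _ _ _ (cst 0) (fun h : R => `|h|)) h0; last exact: cvg_cst.
  near=> h; rewrite normr_ge0 /= normrM ler_piMl //.
  by have [/andP[? ?] _] := sP h; rewrite ger0_norm.
have harg : (s h * h) *: u + (h *: v + x) @[h --> (0 : R)^'] --> x.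
  rewrite -[X in _ --> X]add0r -[in X in _ --> X + _](scale0r u).
  apply: cvgD; first exact: cvgZr_tmp.
  rewrite -[X in _ --> X]add0r -[in X in _ --> X + _](scale0r v).
  apply: cvgD; last exact: cvg_cst.
  by apply: cvgZr_tmp; exact: cvg_within.
have hu : 'D_u f ((s h * h) *: u + (h *: v + x)) @[h --> 0^'] --> 'D_u f x.
  exact: (cvg_comp _ _ harg cu).
apply: cvg_trans (cvgD hv hu); apply: near_eq_cvg.
near=> h.
have h0 : h != 0 by near: h; exact: nbhs_dnbhs_neq.
have [_ E] := sP h.
rewrite addrfctE; have -> : 'D_u f ((s h * h) *: u + (h *: v + x)) =
    h^-1 *: (f (h *: u + (h *: v + x)) - f (h *: v + x)).
  by rewrite E [RHS]mulKf.
rewrite -scalerDr addrC; congr (_ *: _).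
by rewrite addrA subrK scalerDr addrA [h *: v + _]addrC.
Unshelve. all: by end_near. Qed.


(** The second difference is an increment along [u] of [p y = f (h *: v + y) - f y], whose
    derivative along [u] is in turn an increment along [v] of ['D_u f]. *)
Lemma MVT_line2 f x u v (h : R) : (forall y, derivable f y u) ->
  (forall y, derivable ('D_u f) y v) ->
  exists s t : R, [/\ 0 <= s <= 1, 0 <= t <= 1 &
   f (h *: u + (h *: v + x)) - f (h *: u + x) - (f (h *: v + x) - f x) =
   h ^+ 2 * 'D_v ('D_u f) ((s * h) *: u + ((t * h) *: v + x))].
Proof.
move=> fu fuv.
pose p y := f (h *: v + y) - f y.
have fs y : is_derive y u (fun y => f (h *: v + y)) ('D_u f (h *: v + y)).
  apply: is_derive_line0.
  under eq_fun do rewrite addrCA.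
  by apply: is_derive_line; rewrite scale0r add0r; exact: derivableP.
have pd y : is_derive y u p ('D_u f (h *: v + y) - 'D_u f y).
  by apply: is_deriveB; exact: derivableP.
have [s s01 sE] := MVT_line x h (fun y => @ex_derive _ _ _ _ _ _ _ (pd y)).
have [t t01 tE] := MVT_line ((s * h) *: u + x) h fuv.
exists s, t; split=> [//|//|]; move: sE.
rewrite (@derive_val _ _ _ _ _ _ _ (pd _)) tE /p mulrA -expr2.
rewrite [h *: v + (h *: u + x)]addrCA [(t * h) *: v + _]addrCA => <-.
by rewrite !opprB; ring.
Qed.

(* Both iterated derivatives are limits of the same second difference. *)
Lemma deriveC f x u v :
  (forall y, derivable f y u) -> (forall y, derivable f y v) ->
  (forall y, derivable ('D_u f) y v) -> (forall y, derivable ('D_v f) y u) ->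
  {for x, continuous ('D_v ('D_u f))} -> {for x, continuous ('D_u ('D_v f))} ->
  'D_v ('D_u f) x = 'D_u ('D_v f) x.
Proof.
move=> fu fv fuv fvu cuv cvu.
suff H (e : R) : 0 < e -> `|'D_v ('D_u f) x - 'D_u ('D_v f) x| <= e.
  apply/eqP; rewrite -subr_eq0 -normr_le0; apply/ler_addgt0Pl => e e0.
  by rewrite addr0; exact: H.
move=> e0.
(* The intermediate points given by [MVT_line2] are unknown, hence closeness uniform in [s] and
   [t]. *)
have near2 (g : V -> R) (a b : V) : {for x, continuous g} ->
    \forall h \near (0 : R)^'+, forall s t : R, 0 <= s <= 1 -> 0 <= t <= 1 ->
    `|g x - g ((s * h) *: a + ((t * h) *: b + x))| < e / 2.
  move=> /cvgrPdist_lt/(_ (e / 2)).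
  rewrite divr_gt0 // => /(_ isT)/nbhs_ballP[r /= r0 rP].
  have N0 : 0 < `|a| + `|b| + 1 by rewrite ltr_wpDl // addr_ge0.
  near=> h => s t /andP[s0 s1] /andP[t0 t1]; apply: rP.
  have h0 : 0 < h by [].
  rewrite -ball_normE /= addrA opprD addrCA subrr addr0 normrN.
  apply: (le_lt_trans (ler_normD _ _)); rewrite !normrZ.
  apply: (@le_lt_trans _ _ (h * `|a| + h * `|b|)).
    rewrite (ger0_norm s0) (ger0_norm t0) (ger0_norm (ltW h0)).
    by rewrite lerD // ler_wpM2r // ler_piMl // ltW.
  apply: (@lt_trans _ _ (h * (`|a| + `|b| + 1))).
    by rewrite -mulrDr ltr_pM2l // ltrDl.
  rewrite -ltr_pdivlMr //; near: h; apply: nbhs_right_lt.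
  by rewrite divr_gt0.
have n1 := near2 _ u v cuv; have n2 := near2 _ v u cvu.
near (0 : R)^'+ => h.
have h0 : 0 < h by [].
have [s [t [s01 t01 E1]]] := MVT_line2 x h fu fuv.
have [s' [t' [s01' t01' E2]]] := MVT_line2 x h fv fvu.
have H1 : `|'D_v ('D_u f) x - 'D_v ('D_u f) ((s * h) *: u + ((t * h) *: v + x))| < e / 2.
  exact: (near n1 h).
have H2 : `|'D_u ('D_v f) x - 'D_u ('D_v f) ((s' * h) *: v + ((t' * h) *: u + x))| < e / 2.
  exact: (near n2 h).
have E : 'D_v ('D_u f) ((s * h) *: u + ((t * h) *: v + x)) =
    'D_u ('D_v f) ((s' * h) *: v + ((t' * h) *: u + x)).
  have h2 : h ^+ 2 != 0 by rewrite expf_neq0 // gt_eqF.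
  have E0 : f (h *: u + (h *: v + x)) - f (h *: u + x) - (f (h *: v + x) - f x) =
    f (h *: v + (h *: u + x)) - f (h *: v + x) - (f (h *: u + x) - f x).
    rewrite [h *: v + (h *: u + x)]addrCA.
    move: (f (h *: u + (h *: v + x))) (f (h *: u + x)) (f (h *: v + x)) (f x).
    by move=> A B C D; ring.
  exact: (mulfI h2 (etrans (esym E1) (etrans E0 E2))).
rewrite -E in H2; apply: ltW.
rewrite (splitr e); apply: le_lt_trans (ltrD H1 H2).
by rewrite [X in _ <= _ + X]distrC; exact: ler_distD.
Unshelve. all: by end_near. Qed.

End line_derivatives.

Section rV_derivatives.
Context {R : realType} {n : nat}.
Implicit Types (f : 'rV[R]_n -> R) (x v : 'rV[R]_n).

Lemma Ck1_is_derive f x v : Ck 1 f ->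
  is_derive x v f (\sum_i v 0 i * partial i f x).
Proof.
move=> [_ fP].
have H (s : seq 'I_n) : is_derive x (\sum_(i <- s) v 0 i *: delta_mx 0 i) f
    (\sum_(i <- s) v 0 i * partial i f x).
  elim: s => [|i s IH]; first by rewrite !big_nil; exact: is_derive0.
  have [fd fc] := fP i.
  have D y : is_derive y (v 0 i *: delta_mx 0 i) f (v 0 i * partial i f y).
    by apply: is_derive_dirZ; exact: derivableP.
  have DE : 'D_(v 0 i *: delta_mx 0 i) f = (fun y => v 0 i * partial i f y).
    by apply/funext => y; rewrite (@derive_val _ _ _ _ _ _ _ (D y)).
  rewrite !big_cons addrC [X in is_derive _ _ _ X]addrC.
  have -> : v 0 i * partial i f x = 'D_(v 0 i *: delta_mx 0 i) f x.
    by rewrite (@derive_val _ _ _ _ _ _ _ (D x)).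
  apply: is_derive_dirD => [y|]; first by case: (D y).
  by rewrite DE; exact: cvgMl_tmp (fc x).
by have := H (index_enum 'I_n); rewrite -row_sum_delta.
Qed.

Lemma Ck2_partial f i : Ck 2 f -> Ck 1 (partial i f).
Proof. by move=> [_ /(_ i)[]]. Qed.

Lemma Ck2_Ck1 f : Ck 2 f -> Ck 1 f.
Proof.
move=> [cf fP]; split=> // i; have [fd [cpf _]] := fP i; split=> //.
Qed.

Lemma partialC f i j x : Ck 2 f ->
  partial i (partial j f) x = partial j (partial i f) x.
Proof.
move=> [_ fP]; have [fi [_ fi2]] := fP i; have [fj [_ fj2]] := fP j.
apply: deriveC.
- exact: fj.
- exact: fi.
- by have [] := fj2 i.
- by have [] := fi2 j.
- by have [_] := fj2 i; exact.
- by have [_] := fi2 j; exact.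
Qed.

End rV_derivatives.

Section pointwise_derivatives.
Context {R : realType} {V : normedModType R}.
Implicit Types (f g : V -> R) (x v : V) (df dg c : R).

Lemma is_deriveDp f g x v df dg : is_derive x v f df -> is_derive x v g dg ->
  is_derive x v (fun y => f y + g y) (df + dg).
Proof. exact: is_deriveD. Qed.

Lemma is_deriveBp f g x v df dg : is_derive x v f df -> is_derive x v g dg ->
  is_derive x v (fun y => f y - g y) (df - dg).
Proof. exact: is_deriveB. Qed.

Lemma is_deriveNp f x v df : is_derive x v f df ->
  is_derive x v (fun y => - f y) (- df).
Proof. exact: is_deriveN. Qed.

Lemma is_deriveMp f g x v df dg : is_derive x v f df -> is_derive x v g dg ->
  is_derive x v (fun y => f y * g y) (df * g x + f x * dg).
Proof.
move=> hf hg; apply: (is_derive_eq (is_deriveM hf hg)).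
by rewrite addrC /GRing.scale /= [g x * df]mulrC.
Qed.

Lemma is_deriveZp f c x v df : is_derive x v f df ->
  is_derive x v (fun y => c * f y) (c * df).
Proof.
move=> hf; apply: (is_derive_eq (is_deriveMp (is_derive_cst c x v) hf)).
by rewrite mul0r add0r.
Qed.

Lemma is_deriveMcp f c x v df : is_derive x v f df ->
  is_derive x v (fun y => f y * c) (df * c).
Proof.
move=> hf; apply: (is_derive_eq (is_deriveMp hf (is_derive_cst c x v))).
by rewrite mulr0 addr0.
Qed.

Lemma is_derive_sqrp f x v df : is_derive x v f df ->
  is_derive x v (fun y => f y ^+ 2) (2 * f x * df).
Proof.
move=> hf; apply: (is_derive_eq (is_deriveMp hf hf)); ring.
Qed.

Lemma is_derive_sump (I : Type) (s : seq I) (F : I -> V -> R) x v (dF : I -> R) :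
  (forall i, is_derive x v (F i) (dF i)) ->
  is_derive x v (fun y => \sum_(i <- s) F i y) (\sum_(i <- s) dF i).
Proof.
move=> dFi; elim: s => [|i s IH].
  rewrite big_nil; under eq_fun do rewrite big_nil.
  exact: is_derive_cst.
rewrite big_cons; under eq_fun do rewrite big_cons.
exact: is_deriveDp.
Qed.

End pointwise_derivatives.

(** * Integration over unit cubes *)

Lemma compact_continuous_bound (T : topologicalType) (R : realType)
    (f : T -> R) (A : set T) : compact A -> {within A, continuous f} ->
  exists2 M : R, 0 <= M & forall x, A x -> `|f x| <= M.
Proof.
move=> cA cf; have [A0|/nonemptyPn ->] := pselect (A !=set0); last first.
  by exists 0.
have [|c _ cP] := @compact_EVT_max T R (fun x => `|f x|) A A0 cA.
  by move=> x; apply: cvg_norm; exact: cf.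
exists `|f c| => // x Ax; apply: cP; exact: mem_set.
Qed.

Section cube.
Context {R : realType}.

Definition cube {n} (y : 'rV[R]_n) : set 'rV[R]_n :=
  [set v | forall i, y 0 i <= v 0 i < y 0 i + 1].

(** Compact companion of [cube]: bounds on continuous functions are found here and used on the
    half-open cube, which is the domain of integration. *)
Definition ccube {n} (y : 'rV[R]_n) : set 'rV[R]_n :=
  [set v | forall i, `[y 0 i, y 0 i + 1]%classic (v 0 i)].

Lemma compact_ccube {n} (y : 'rV[R]_n) : compact (ccube y).
Proof. by apply: (@rV_compact R n (fun i => `[y 0 i, y 0 i + 1]%classic)) => i; exact: segment_compact. Qed.

Lemma cube_ccube {n} (y : 'rV[R]_n) : cube y `<=` ccube y.
Proof.
by move=> v yv i; have /andP[a b] := yv i; rewrite /= in_itv /= a ltW.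
Qed.

Lemma measurable_cube {n} (y : 'rV[R]_n) : measurable (cube y).
Proof.
rewrite (_ : cube y = \bigcap_(i in [set: 'I_n])
  ((fun v : 'rV[R]_n => v 0 i) @^-1` `[y 0 i, y 0 i + 1[)); last first.
  apply/seteqP; split=> v /= h i; first by move=> _; rewrite /= in_itv /=; exact: h.
  by have := h i I; rewrite /= in_itv.
apply: fin_bigcap_measurable => // i _; rewrite -[X in measurable X]setTI.
by apply: continuous_measurable_rV => // v; exact: coord_continuous.
Qed.

Lemma cons_rV_cube {n} (y : 'rV[R]_n.+1) :
  @cons_rV R n @^-1` cube y =
  `[y 0 ord0, y 0 ord0 + 1[ `*` cube (uncons_rV y).2.
Proof.
apply/seteqP; split=> [[a v]|[a v]] /= h.
  split=> [|i]; first by have := h ord0; rewrite mxE unlift_none /= in_itv.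
  by have := h (lift ord0 i); rewrite !mxE liftK.
case: h; rewrite in_itv /= => h0 h1 i; rewrite mxE.
case: unliftP => [j|] -> //=.
by have := h1 j; rewrite mxE.
Qed.

Lemma lebesgue_cube_fin {n} (y : 'rV[R]_n) : (lebesgue_rV R n (cube y) < +oo)%E.
Proof.
elim: n y => [|n IH] y.
  rewrite [X in (X < _)%E](_ : _ = (\d_(0 : 'rV[R]_0) (cube y) : \bar R)) //.
  by rewrite diracE ltry.
rewrite [X in (X < _)%E](_ : _ =
  (lebesgue_measure \x lebesgue_rV R n)%E (@cons_rV R n @^-1` cube y)) //.
rewrite cons_rV_cube product_measure1E //; last exact: measurable_cube.
have L1 : (lebesgue_measure `[y 0%R ord0, (y 0%R ord0 + 1)%R[%classic < +oo)%E.
  rewrite lebesgue_measure_itv /=; case: ifPn => _; last exact: ltry.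
  by rewrite -EFinB ltry.
rewrite lte_mul_pinfty ?ge0_fin_numE //; exact: IH.
Qed.

Lemma cube_integrable {n} (y : 'rV[R]_n) (f : 'rV[R]_n -> R) (M : R) :
  measurable_fun setT f -> (forall x, cube y x -> `|f x| <= M) ->
  (lebesgue_rV R n).-integrable (cube y) (EFin \o f).
Proof.
move=> mf fM; apply: measurable_bounded_integrable.
- exact: measurable_cube.
- exact: lebesgue_cube_fin.
- exact: measurable_funTS.
- exists M; split; first exact: num_real.
  by move=> N MN x Ax; apply: le_trans (ltW MN); exact: fM.
Qed.

Lemma continuous_cube_bound {n} (y : 'rV[R]_n) (f : 'rV[R]_n -> R) :
  continuous f -> exists2 M : R, 0 <= M & forall x, ccube y x -> `|f x| <= M.
Proof.
move=> cf; apply: compact_continuous_bound; first exact: compact_ccube.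
exact: continuous_subspaceT.
Qed.

Lemma continuous_cube_integrable {n} (y : 'rV[R]_n) (f : 'rV[R]_n -> R) :
  continuous f -> (lebesgue_rV R n).-integrable (cube y) (EFin \o f).
Proof.
move=> cf; have [M _ fM] := continuous_cube_bound y cf.
apply: (@cube_integrable _ _ _ M) => [|x /cube_ccube]; last exact: fM.
exact: continuous_measurable_rV.
Qed.



Local Notation mu := lebesgue_measure.

(** Both orders serve: a derivative in the first coordinate wants that variable innermost, any other
    one wants it outermost, to recurse on the dimension. *)
Lemma cube_fubini {n} (y : 'rV[R]_n.+1) (f : 'rV[R]_n.+1 -> R) :
  continuous f ->
  let I := `[y 0 ord0, y 0 ord0 + 1[%classic in
  let C := cube (uncons_rV y).2 in
  (\int[lebesgue_rV R n.+1]_(x in cube y) (f x)%:E =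
   \int[mu]_(a in I) \int[lebesgue_rV R n]_(v in C) (f (cons_rV (a, v)))%:E)%E /\
  (\int[lebesgue_rV R n.+1]_(x in cube y) (f x)%:E =
   \int[lebesgue_rV R n]_(v in C) \int[mu]_(a in I) (f (cons_rV (a, v)))%:E)%E.
Proof.
move=> cf I C.
have [M M0 fM] := continuous_cube_bound y cf.
set D := @cons_rV R n @^-1` cube y.
have mD : measurable D.
  by rewrite -[D]setTI; apply: measurable_cons_rV => //; exact: measurable_cube.
pose g : R * 'rV[R]_n -> \bar R := (fun p => (f (cons_rV p))%:E) \_ D.
have mf : measurable_fun setT f by exact: continuous_measurable_rV.
have mfc : measurable_fun setT (f \o @cons_rV R n).
  by apply: measurableT_comp => //; exact: measurable_cons_rV.
have iD : (mu \x lebesgue_rV R n)%E.-integrable D (EFin \o (f \o @cons_rV R n)).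
  apply: measurable_bounded_integrable.
  - exact: mD.
  - exact: (lebesgue_cube_fin y).
  - exact: measurable_funTS.
  - exists M; split; first exact: num_real.
    by move=> N MN x Ax; apply: le_trans (ltW MN); apply: fM; exact: cube_ccube.
have ig : (mu \x lebesgue_rV R n)%E.-integrable setT g.
  by rewrite /g -integrable_mkcond.
(* The measure is a pushforward under [cons_rV], so this is a change of variables. *)
have E : (\int[lebesgue_rV R n.+1]_(x in cube y) (f x)%:E = \int[mu \x lebesgue_rV R n]_z g z)%E.
  rewrite -integral_mkcond.
  have /measurable_EFinP mE := mf.
  have m' : measurable_fun [set: (measurableTypeR R * 'rV[R]_n)%type] (@cons_rV R n).
    exact: measurable_cons_rV.
  have H := @integral_pushforward _ _ _ _ _ _ m'
    (mu \x lebesgue_rV R n)%E (cube y) (EFin \o f) mE iD (measurable_cube y).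
  exact: H.
have gE a v : g (a, v) = if (a \in I) && (v \in C) then (f (cons_rV (a, v)))%:E else 0%E.
  rewrite /g patchE /D cons_rV_cube in_setX /=; by [].
split; rewrite E.
  rewrite -(integral12_prod_meas1 ig) [RHS]integral_mkcond; apply: eq_integral => a _.
  rewrite /fubini_F patchE; case: ifPn => aA.
    rewrite [RHS]integral_mkcond; apply: eq_integral => v _.
    by rewrite gE patchE aA.
  by apply: integral0_eq => v _; rewrite gE (negbTE aA).
rewrite -(integral21_prod_meas1 ig) [RHS]integral_mkcond; apply: eq_integral => v _.
rewrite /fubini_G patchE; case: ifPn => aA.
  rewrite [RHS]integral_mkcond; apply: eq_integral => a _.
  by rewrite gE patchE aA andbT.
by apply: integral0_eq => a _; rewrite gE (negbTE aA) andbF.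
Qed.


Lemma rV_continuous {T : topologicalType} {n} (g : T -> 'rV[R]_n) :
  (forall i, continuous (fun t => g t 0 i)) -> continuous g.
Proof.
move=> cg t; apply/cvg_ballP => e e0.
have H (i : 'I_n) : \forall s \near t, ball (g t 0 i) e (g s 0 i).
  by move: e e0; exact/cvg_ballP/cg.
near=> s; split=> // i j; rewrite (ord1 i).
by move: j; near: s; exact: filter_forall.
Unshelve. all: by end_near. Qed.

Lemma continuous_consr {n} (a : R) :
  continuous (fun v : 'rV[R]_n => cons_rV (a, v)).
Proof.
apply: rV_continuous => i; under eq_fun do rewrite mxE.
case: unliftP => [j|] _ /=; last exact: cst_continuous.
by move=> v; exact: coord_continuous.
Qed.

Lemma cons_rVD {n} (a : R) (v w : 'rV[R]_n) (h : R) :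
  cons_rV (a, h *: w + v) = h *: cons_rV (0, w) + cons_rV (a, v).
Proof.
apply/rowP => i; rewrite !mxE; case: unliftP => [j|] _ /=; first by rewrite !mxE.
by rewrite mulr0 add0r.
Qed.

Lemma cons_rV_delta {n} (j : 'I_n) :
  cons_rV (0, delta_mx 0 j) = delta_mx 0 (lift ord0 j) :> 'rV[R]_n.+1.
Proof.
apply/rowP => i; rewrite !mxE; case: unliftP => [k|] -> //=.
by rewrite !mxE (inj_eq lift_inj).
Qed.

Lemma cons_rV_delta0 {n} (a : R) (v : 'rV[R]_n) :
  cons_rV (a, v) = a *: delta_mx 0 ord0 + cons_rV (0, v).
Proof.
apply/rowP => i; rewrite !mxE; case: unliftP => [k|] -> /=.
  by rewrite mulr0 add0r.
by rewrite mulr1 addr0.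
Qed.

(** The fundamental theorem of calculus in the [i]-th variable leaves the difference of the values
    on opposite faces, which periodicity cancels. *)
Lemma cube_integral_partial {n} (i : 'I_n) (y : 'rV[R]_n) (f : 'rV[R]_n -> R) :
  continuous f -> (forall x, derivable f x (delta_mx 0 i)) ->
  continuous (partial i f) -> (forall x, f (x + delta_mx 0 i) = f x) ->
  (\int[lebesgue_rV R n]_(x in cube y) (partial i f x)%:E = 0)%E.
Proof.
elim: n i y f => [[]//|n IH] i y f cf df cdf pf.
case: (unliftP ord0 i) => [j ij|i0].
  have [-> _] := cube_fubini y cdf.
  apply: integral0_eq => a _; pose g v := f (cons_rV (a, v)).
  have dg v : is_derive v (delta_mx 0 j) g (partial i f (cons_rV (a, v))).
    apply: is_derive_line0; under eq_fun do rewrite /g cons_rVD cons_rV_delta -ij.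
    by apply: is_derive_line; rewrite scale0r add0r; exact: derivableP.
  have E v : partial j g v = partial i f (cons_rV (a, v)).
    by rewrite /partial (@derive_val _ _ _ _ _ _ _ (dg v)).
  under eq_integral do rewrite -E.
  apply: IH.
  - by move=> v; apply: continuous_comp; [exact: continuous_consr|exact: cf].
  - by move=> v; case: (dg v).
  - rewrite (_ : partial j g = partial i f \o (fun v => cons_rV (a, v))); last first.
      by apply/funext.
    by move=> v; apply: continuous_comp; [exact: continuous_consr|exact: cdf].
  - move=> v; rewrite /g addrC -[X in X + v]scale1r cons_rVD cons_rV_delta -ij.
    by rewrite scale1r addrC pf.
have [_ ->] := cube_fubini y cdf.
apply: integral0_eq => v _; set a := y 0 ord0.
pose F a := f (a *: delta_mx 0 ord0 + cons_rV (0, v)).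
have dF (b : R) : is_derive b 1 F (partial i f (cons_rV (b, v))).
  rewrite cons_rV_delta0 i0; apply: is_derive_line; rewrite -i0.
  exact: derivableP.
have cF : continuous F.
  by move=> b; apply: differentiable_continuous; apply/derivable1_diffP; case: (dF b).
have aa : a < a + 1 by rewrite ltrDl.
have cl : continuous (fun b : R => b *: delta_mx 0 i + cons_rV (0, v) : 'rV[R]_n.+1).
  by move=> b; apply: cvgD; [apply: cvgZr_tmp; exact: cvg_id|exact: cvg_cst].
have cpf : continuous (fun b => partial i f (cons_rV (b, v))).
  under eq_fun do rewrite cons_rV_delta0 -i0.
  by move=> b; apply: (continuous_comp (cl b)); exact: cdf.
rewrite integral_itv_bndo_bndc; last first.
  by apply/measurable_EFinP; apply: measurable_funTS; exact: continuous_measurable_fun.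
rewrite (@continuous_FTC2 R _ F) //.
- rewrite /F scalerDl scale1r addrAC -i0 pf; exact: subee.
- exact: continuous_subspaceT.
- split.
  + by move=> b _; case: (dF b).
  + exact: cvg_at_right_filter (cF _).
  + exact: cvg_at_left_filter (cF _).
- by move=> b _; rewrite derive1E (@derive_val _ _ _ _ _ _ _ (dF b)).
Qed.

End cube.

Lemma continuous_sum {R : realType} {T : topologicalType} (I : Type) (s : seq I)
    (F : I -> T -> R) : (forall i, continuous (F i)) ->
  continuous (fun x => \sum_(i <- s) F i x).
Proof.
move=> cF x; elim: s => [|i s IH].
  by under eq_fun do rewrite big_nil; exact: cvg_cst.
by under eq_fun do rewrite big_cons; apply: cvgD; [exact: cF|exact: IH].
Qed.

Lemma continuous_pairp {S T U : topologicalType} (f : S -> T) (g : S -> U) p :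
  {for p, continuous f} -> {for p, continuous g} ->
  {for p, continuous (fun q => (f q, g q))}.
Proof. by move=> cf cg; exact: (cvg_pair cf cg). Qed.

Section pointwise_continuity.
Context {R : realType} {T : topologicalType}.
Implicit Types f g : T -> R.

Lemma continuousNp f : continuous f -> continuous (fun x => - f x).
Proof. by move=> cf x; apply: cvgN; exact: cf. Qed.

Lemma continuousDp f g : continuous f -> continuous g ->
  continuous (fun x => f x + g x).
Proof. by move=> cf cg x; apply: cvgD; [exact: cf|exact: cg]. Qed.

Lemma continuousBp f g : continuous f -> continuous g ->
  continuous (fun x => f x - g x).
Proof. by move=> cf cg x; apply: cvgB; [exact: cf|exact: cg]. Qed.

Lemma continuousMp f g : continuous f -> continuous g ->
  continuous (fun x => f x * g x).
Proof. by move=> cf cg x; apply: cvgM; [exact: cf|exact: cg]. Qed.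

Lemma continuousZp (c : R) f : continuous f -> continuous (fun x => c * f x).
Proof. by move=> cf; apply: continuousMp => // x; exact: cvg_cst. Qed.

Lemma continuous_sqrp f : continuous f -> continuous (fun x => f x ^+ 2).
Proof. by move=> cf; under eq_fun do rewrite expr2; exact: continuousMp. Qed.

End pointwise_continuity.

(** * Real integrals over a unit cube and their limits *)

Section cube_integral.
Context {R : realType} {n : nat} (y : 'rV[R]_n).
Implicit Types f g : 'rV[R]_n -> R.

Definition cint f : R := \int[lebesgue_rV R n]_(x in cube y) f x.

Lemma cintE f : continuous f ->
  ((cint f)%:E = \int[lebesgue_rV R n]_(x in cube y) (f x)%:E)%E.
Proof.
move=> cf; rewrite fineK //; apply: integrable_fin_num.
  exact: measurable_cube.
exact: continuous_cube_integrable.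
Qed.

Lemma cintD f g : continuous f -> continuous g ->
  cint (fun x => f x + g x) = cint f + cint g.
Proof.
move=> cf cg; apply: RintegralD; first exact: measurable_cube.
  exact: continuous_cube_integrable.
exact: continuous_cube_integrable.
Qed.

Lemma cintB f g : continuous f -> continuous g ->
  cint (fun x => f x - g x) = cint f - cint g.
Proof.
move=> cf cg; apply: RintegralB; first exact: measurable_cube.
  exact: continuous_cube_integrable.
exact: continuous_cube_integrable.
Qed.

Lemma cintZ (c : R) f : continuous f -> cint (fun x => c * f x) = c * cint f.
Proof.
move=> cf; apply: RintegralZl; first exact: measurable_cube.
exact: continuous_cube_integrable.
Qed.

Lemma cint_le f g : continuous f -> continuous g -> (forall x, f x <= g x) ->
  cint f <= cint g.
Proof.
move=> cf cg fg; apply: le_Rintegral => //; first exact: measurable_cube.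
  exact: continuous_cube_integrable.
exact: continuous_cube_integrable.
Qed.

Lemma cint_ge0 f : (forall x, 0 <= f x) -> 0 <= cint f.
Proof. by move=> f0; apply: Rintegral_ge0. Qed.

(** Divergence theorem on the torus, which has no boundary. Every integration by parts below is an
    instance of it. *)
Lemma cint_divergence (X : 'I_n -> 'rV[R]_n -> R) :
  (forall i, continuous (X i)) ->
  (forall i x, derivable (X i) x (delta_mx 0 i)) ->
  (forall i, continuous (partial i (X i))) ->
  (forall i x, X i (x + delta_mx 0 i) = X i x) ->
  cint (fun x => \sum_i partial i (X i) x) = 0.
Proof.
move=> cX dX cdX pX; elim: (index_enum 'I_n) => [|i s IH].
  under [cint _]eq_Rintegral do rewrite big_nil.
  by rewrite Rintegral_cst ?mul0r //; exact: measurable_cube.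
under [cint _]eq_Rintegral do rewrite big_cons.
rewrite [LHS]cintD ?IH ?addr0; [|exact: cdX|exact: continuous_sum].
by rewrite /cint /Rintegral (@cube_integral_partial _ _ i).
Qed.

Lemma cint_cvg_seq (f_ : nat -> 'rV[R]_n -> R) f (M : R) :
  (forall k, continuous (f_ k)) -> continuous f ->
  (forall k x, cube y x -> `|f_ k x| <= M) ->
  (forall x, cube y x -> f_ k x @[k --> \oo] --> f x) ->
  cint (f_ k) @[k --> \oo] --> cint f.
Proof.
move=> cf_ cf fM fl.
have M_int : (lebesgue_rV R n).-integrable (cube y) (EFin \o cst M).
  by apply: continuous_cube_integrable; exact: cst_continuous.
have [||||_ _] := @dominated_convergence _ _ R (lebesgue_rV R n) (cube y)
    (measurable_cube y) (fun k => EFin \o f_ k) (EFin \o f) (EFin \o cst M) _ _ _ M_int.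
- move=> k; apply/measurable_EFinP/measurable_funTS.
  by apply: continuous_measurable_rV; exact: cf_.
- by apply/measurable_EFinP/measurable_funTS; exact: continuous_measurable_rV.
- apply: aeW => x Cx; apply: cvg_EFin; last exact: fl.
  by near=> k.
- by apply: aeW => x k Cx /=; rewrite lee_fin; exact: fM.
move=> H; rewrite [cint f]/Rintegral; apply: fine_cvg.
by rewrite -cintE // in H *.
Unshelve. all: by end_near. Qed.


Section filter_limits.
Variables (G : R -> 'rV[R]_n -> R) (g : 'rV[R]_n -> R) (p delta M : R).
Hypotheses (delta0 : 0 < delta) (cg : continuous g).

Let aux (Q : pred R) (s : nat -> R) :
  (forall t, Q t -> `|t - p| < delta -> continuous (G t)) ->
  (forall t x, Q t -> `|t - p| < delta -> cube y x -> `|G t x| <= M) ->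
  (forall k, Q (s k)) -> s k @[k --> \oo] --> p ->
  (forall x, cube y x -> G (s k) x @[k --> \oo] --> g x) ->
  cint (G (s k)) @[k --> \oo] --> cint g.
Proof.
move=> cG GM Qs sp Gg; have [N N0 gN] := continuous_cube_bound y cg.
(* The hypotheses on [G] hold only near [p]; the finitely many terms outside are replaced by the
   limit, so that dominated convergence applies to the whole sequence. *)
pose G' k := if `|s k - p| < delta then G (s k) else g.
have near_s : \forall k \near \oo, `|s k - p| < delta.
  by have /cvgrPdist_lt/(_ _ delta0) := sp; apply: filterS => k; rewrite distrC.
have : cint (G' k) @[k --> \oo] --> cint g.
  apply: (@cint_cvg_seq _ _ (Num.max M N)) => //.
  - by move=> k; rewrite /G'; case: ifPn => // /cG; apply.
  - move=> k x Cx; rewrite /G'; case: ifPn => [sk|_].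
      by rewrite le_max GM.
    by rewrite le_max gN ?orbT //; exact: cube_ccube.
  - move=> x Cx; apply: cvg_trans (Gg x Cx); apply: near_eq_cvg.
    by apply: filterS near_s => k sk; rewrite /G' sk.
apply: cvg_trans; apply: near_eq_cvg.
by apply: filterS near_s => k sk; rewrite /G' sk.
Qed.

Lemma cint_cvg_dnbhs :
  (forall t, t != p -> `|t - p| < delta -> continuous (G t)) ->
  (forall t x, t != p -> `|t - p| < delta -> cube y x -> `|G t x| <= M) ->
  (forall x, cube y x -> G t x @[t --> p^'] --> g x) ->
  cint (G t) @[t --> p^'] --> cint g.
Proof.
move=> cG GM Gg; apply/cvgr_dnbhsP => s [sp s_p].
apply: (@aux (fun t => t != p)) => // x Cx.
by have /cvgr_dnbhsP := Gg x Cx; apply.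
Qed.

Lemma cint_cvg_at_right :
  (forall t, p < t -> `|t - p| < delta -> continuous (G t)) ->
  (forall t x, p < t -> `|t - p| < delta -> cube y x -> `|G t x| <= M) ->
  (forall x, cube y x -> G t x @[t --> p^'+] --> g x) ->
  cint (G t) @[t --> p^'+] --> cint g.
Proof.
move=> cG GM Gg; apply/cvg_at_rightP => s [sp s_p].
apply: (@aux (fun t => p < t)) => // x Cx.
by have /cvg_at_rightP := Gg x Cx; apply.
Qed.

End filter_limits.

End cube_integral.

(** * Maximum principles *)

Section periodicity.
Context {R : realType} {n : nat}.
Implicit Types (f : 'rV[R]_n -> R) (x : 'rV[R]_n).

Lemma periodicZ f i (z : int) x : Defs.periodic f ->
  f (z%:~R *: delta_mx 0 i + x) = f x.
Proof.
move=> pf.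
have pos (k : nat) v : f (k%:R *: delta_mx 0 i + v) = f v.
  elim: k v => [|k IH] v; first by rewrite scale0r add0r.
  by rewrite -natr1 scalerDl scale1r -addrA IH addrC pf.
case: z => k; first by rewrite -pmulrn pos.
rewrite NegzE mulrNz -pmulrn -[LHS](pos k.+1) addrA -scalerDl subrr.
by rewrite scale0r add0r.
Qed.

(** One [x'] serves all periodic functions at once: the two-point argument reduces two functions of
    the same point simultaneously. *)
Lemma periodic_ccube x : exists2 x' : 'rV[R]_n, ccube 0 x' &
  forall f, Defs.periodic f -> f x = f x'.
Proof.
exists (x - \sum_i (Num.floor (x 0 i))%:~R *: delta_mx 0 i).
  move=> i /=; rewrite in_itv /= !mxE add0r.
  rewrite summxE (bigD1 i) //= !mxE !eqxx mulr1 big1 ?addr0; last first.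
    by move=> j ji; rewrite !mxE eq_sym (negbTE ji) andbF mulr0.
  by rewrite subr_ge0 floor_le lerBlDl -intrD1 ltW // floorD1_gt.
move=> f pf; elim: (index_enum _) => [|i s IH]; first by rewrite big_nil subr0.
rewrite big_cons opprD addrCA -scaleNr -mulrNz periodicZ //.
Qed.

Lemma periodic_partial f i : Defs.periodic f -> Defs.periodic (partial i f).
Proof.
move=> pf j x; rewrite /partial /derive; congr (lim _); apply/funext => h.
suff -> : (fun h : R => h^-1 *: (f (h *: delta_mx 0 i + (x + delta_mx 0 j)) -
    f (x + delta_mx 0 j))) = (fun h => h^-1 *: (f (h *: delta_mx 0 i + x) - f x)).
  by [].
by apply/funext => k; rewrite addrA !pf.
Qed.

End periodicity.

Section one_dimension.
Context {R : realType}.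
Implicit Types (g : R -> R).

Lemma max_first_derivative g (g' : R -> R) : (forall s, g s <= g 0) ->
  (forall s : R, is_derive s 1 g (g' s)) -> g' 0 = 0.
Proof.
move=> gmax dg.
have D0 : is_derive (0 : R) 1 g 0.
  apply: (@derive1_at_max R g (-1) 1 0).
  - by lra.
  - by move=> t _; case: (dg t).
  - by rewrite in_itv /= ltrN10 ltr01.
  - by move=> t _; exact: gmax.
by rewrite -(@derive_val _ _ _ _ _ _ _ (dg 0)) (@derive_val _ _ _ _ _ _ _ D0).
Qed.

Lemma max_second_derivative g (g' : R -> R) (c : R) : (forall s, g s <= g 0) ->
  (forall s : R, is_derive s 1 g (g' s)) -> is_derive (0 : R) 1 g' c ->
  g' 0 = 0 /\ c <= 0.
Proof.
move=> gmax dg dg'.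
have g'0 := max_first_derivative gmax dg.
(* If [c > 0], then [g'] is positive just to the right of 0, and the mean value theorem on a short
   interval contradicts the maximum. *)
split=> //; rewrite leNgt; apply/negP => c0.
have [lim_ limE] := dg'.
have : h^-1 *: (g' (h *: (1 : R) + 0) - g' 0) @[h --> (0 : R)^'] --> c.
  by rewrite -limE.
move=> /cvg_dnbhs_at_right /cvgr_gt/(_ _ c0) near_pos.
have [d /= d0 dP] : \forall d \near (0 : R)^'+, 0 < g' d.
  near=> d; have d0 : 0 < d by [].
  have : 0 < d^-1 *: (g' (d *: (1 : R) + 0) - g' 0) by near: d.
  by rewrite scaler1 addr0 g'0 subr0 [_ *: _]mulrC pmulr_lgt0 // invr_gt0.
have d2 : 0 < d / 2 by rewrite divr_gt0.
have [s|s s_in E] := @MVT R g g' 0 (d / 2) d2 (fun s _ => dg s).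
  apply: continuous_subspaceT => t; apply: differentiable_continuous.
  by apply/derivable1_diffP; case: (dg t).
move: s_in; rewrite in_itv /= => /andP[s0 sd].
have gs : 0 < g' s.
  apply: dP => //=; rewrite sub0r normrN gtr0_norm // (lt_trans sd) //.
  by rewrite ltr_pdivrMr // ltr_pMr // ltr1n.
have := gmax (d / 2); rewrite -subr_le0 E subr0 leNgt.
by rewrite mulr_gt0.
Unshelve. all: by end_near. Qed.

(** One-sided, because a maximum over a time interval may sit at the final time. *)
Lemma max_left_derivative g (a b c : R) : a < b ->
  (forall s, a <= s <= b -> g s <= g b) -> is_derive b 1 g c -> 0 <= c.
Proof.
move=> ab gmax [lim_ limE].
have : h^-1 *: (g (h *: (1 : R) + b) - g b) @[h --> (0 : R)^'] --> c.
  by rewrite -limE.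
move=> /cvg_dnbhs_at_left H; apply: (cvgr_to_ge H); near=> h.
have h0 : h < 0 by [].
have hab : a - b < h by near: h; apply: nbhs_left_gt; rewrite subr_lt0.
rewrite scaler1; apply: mulr_le0; first by rewrite invr_le0 ltW.
rewrite subr_le0; apply: gmax.
by rewrite -lerBlDr ltW //= gerDr ltW.
Unshelve. all: by end_near. Qed.

End one_dimension.

(** * The inverse of the profile *)

Section artanh.
Context {R : realType}.
Implicit Types s z : R.

Definition artanh s : R := (ln (1 + s) - ln (1 - s)) / 2.

Lemma is_derive_artanh s : -1 < s < 1 ->
  is_derive s 1 artanh (1 - s ^+ 2)^-1.
Proof.
move=> /andP[s1 s2]; have p0 : 0 < 1 + s by lra.
have m0 : 0 < 1 - s by lra.
have dp : is_derive s 1 (fun s => ln (1 + s)) ((1 + s)^-1 * 1).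
  apply: (@is_derive1_comp _ (@ln R) (fun s => 1 + s)); first exact: is_derive1_ln.
  by apply: (is_derive_eq (is_deriveDp (is_derive_cst (1 : R) s (1 : R)) (is_derive_id s (1 : R)))); rewrite add0r.
have dm : is_derive s 1 (fun s => ln (1 - s)) ((1 - s)^-1 * -1).
  apply: (@is_derive1_comp _ (@ln R) (fun s => 1 - s)); first exact: is_derive1_ln.
  by apply: (is_derive_eq (is_deriveBp (is_derive_cst (1 : R) s (1 : R)) (is_derive_id s (1 : R)))); rewrite sub0r.
apply: (is_derive_eq (is_deriveMcp 2^-1 (is_deriveBp dp dm))).
by field; rewrite !gt_eqF //=; nra.
Qed.

Lemma is_derive_inv_oneBsqr s : -1 < s < 1 ->
  is_derive s 1 (fun s => (1 - s ^+ 2)^-1) (2 * s / (1 - s ^+ 2) ^+ 2).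
Proof.
move=> /andP[s1 s2]; have w0 : 1 - s ^+ 2 != 0 by rewrite gt_eqF //; nra.
have dw : is_derive s 1 (fun s => 1 - s ^+ 2) (0 - 2 * s * 1).
  exact: (is_deriveBp (is_derive_cst (1 : R) s (1 : R))
    (is_derive_sqrp (is_derive_id s (1 : R)))).
have [dw1 dwE] := dw.
apply: DeriveDef; first exact: derivableV.
rewrite deriveV // dwE /GRing.scale /=; field; exact: w0.
Qed.

Lemma continuous_artanh s : -1 < s < 1 -> {for s, continuous artanh}.
Proof.
move=> s1; apply: differentiable_continuous; apply/derivable1_diffP.
by case: (is_derive_artanh s1).
Qed.

Lemma le_artanh s z : -1 < s < 1 -> -1 < z < 1 ->
  artanh s <= artanh z -> s <= z.
Proof.
move=> /andP[s1 s2] /andP[z1 z2]; rewrite leNgt [s <= z]leNgt; apply: contra => zs.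
rewrite /artanh ltr_pM2r ?invr_gt0 // ltrB //.
  by rewrite ltr_ln ?posrE ?ltrD2l //; lra.
by rewrite ltr_ln ?posrE ?ltrD2l ?ltrN2 //; lra.
Qed.

Lemma artanh_le_lt1 (K : R) : exists2 k : R, k < 1 &
  forall s, -1 < s < 1 -> artanh s <= K -> s <= k.
Proof.
(* This is [tanh K]. *)
exists (1 - 2 / (expR (2 * K) + 1)).
  by rewrite gtrBl divr_gt0 // addr_gt0 // expR_gt0.
move=> s /andP[s1 s2]; rewrite /artanh ler_pdivrMr // lerBlDr => H.
have e0 := expR_gt0 (2 * K).
have p0 : 0 < 1 + s by lra.
have m0 : 0 < 1 - s by lra.
have : 1 + s <= expR (2 * K) * (1 - s).
  rewrite -(lnK p0) -[X in _ * X](lnK m0) -expRD ler_expR.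
  by rewrite [2 * K]mulrC.
rewrite lerBrDr -lerBrDl ler_pdivrMr ?addr_gt0 //; lra.
Qed.

Lemma tanh_lt1 z : -1 < tanh z < 1.
Proof.
have p := expR_gt0 z; have m := expR_gt0 (- z).
rewrite /tanh ltr_pdivlMr ?addr_gt0 // ltr_pdivrMr ?addr_gt0 //; lra.
Qed.

Lemma artanh_tanh z : artanh (tanh z) = z.
Proof.
have p := expR_gt0 z; have m := expR_gt0 (- z).
have d0 : 0 < expR z + expR (- z) by rewrite addr_gt0.
rewrite /artanh /tanh -ln_div ?posrE; last 2 first.
- by have /andP[] := tanh_lt1 z; rewrite /tanh; lra.
- by have /andP[] := tanh_lt1 z; rewrite /tanh; lra.
have -> : (1 + (expR z - expR (- z)) / (expR z + expR (- z))) /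
    (1 - (expR z - expR (- z)) / (expR z + expR (- z))) = expR (z + z).
  rewrite expRD expRN; move: (expR z) p => e e0.
  by field; rewrite !gt_eqF //=; nra.
by rewrite expRK; field.
Qed.

End artanh.

(** * Flows and their comparison principles *)

Section flows.
Context {R : realType} {n : nat}.
Implicit Types (u ut : R -> 'rV[R]_n -> R) (lam : R -> R) (x y z : 'rV[R]_n).

Lemma Ck1_partial (f : 'rV[R]_n -> R) i x : Ck 1 f ->
  is_derive x (delta_mx 0 i) f (partial i f x).
Proof. by move=> [_ /(_ i)[df _]]; exact: derivableP. Qed.

Lemma Ck1_line (f : 'rV[R]_n -> R) i x (s : R) : Ck 1 f ->
  is_derive s 1 (fun s => f (s *: delta_mx 0 i + x))
    (partial i f (s *: delta_mx 0 i + x)).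
Proof. by move=> f1; apply: is_derive_line; exact: Ck1_partial. Qed.

(* The equation of the paper with [W'(s) = - 2 s (1 - s^2)] and
   [sqrt (2 W(s)) = |1 - s^2|]; [lam] need not be the nonlocal multiplier. *)
Record flow (eps : R) u ut lam : Prop := Flow {
  flow_periodic : forall t, Defs.periodic (u t) ;
  flow_C2 : forall t, Ck 2 (u t) ;
  flow_continuous : continuous (fun p : R * 'rV[R]_n => u p.1 p.2) ;
  flow_grad_continuous : forall i,
    continuous (fun p : R * 'rV[R]_n => partial i (u p.1) p.2) ;
  flow_hess_continuous : forall i j,
    continuous (fun p : R * 'rV[R]_n => partial i (partial j (u p.1)) p.2) ;
  flow_dt : forall (t : R) x, 0 < t -> is_derive t 1 (u ^~ x) (ut t x) ;
  flow_dt_continuous : forall p : R * 'rV[R]_n, 0 < p.1 ->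
    {for p, continuous (fun p : R * 'rV[R]_n => ut p.1 p.2)} ;
  flow_equation : forall t x, 0 < t ->
    eps * ut t x = eps * lap (u t) x
      + 2 * u t x * (1 - u t x ^+ 2) / eps + lam t * `|1 - u t x ^+ 2|
}.

Lemma partialN (f : 'rV[R]_n -> R) i : Ck 1 f ->
  partial i (fun x => - f x) = (fun x => - partial i f x).
Proof.
move=> f1; apply/funext => x; rewrite /partial.
by rewrite (@derive_val _ _ _ _ _ _ _ (is_deriveNp (Ck1_partial i x f1))).
Qed.

(** [W] is even, so the equation is odd in the pair [(u, lam)]. An upper bound valid for every flow
    thus yields the lower bound too. *)
Lemma flowN eps u ut lam : flow eps u ut lam ->
  flow eps (fun t x => - u t x) (fun t x => - ut t x) (fun t => - lam t).
Proof.
move=> [pu u2 cu cgu chu dut cut eq].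
have u1 t : Ck 1 (u t) by exact: Ck2_Ck1.
have pE t i : partial i (fun x => - u t x) = (fun x => - partial i (u t) x).
  exact: partialN.
have hE t i j : partial j (partial i (fun x => - u t x)) =
    (fun x => - partial j (partial i (u t)) x).
  by rewrite pE partialN //; exact: Ck2_partial.
split.
- by move=> t i x; rewrite pu.
- move=> t; split; first by apply: continuousNp; have [] := u1 t.
  move=> i; have [_ /(_ i)[du [cdu ddu]]] := u2 t.
  split=> [x|]; first exact: derivableN.
  rewrite pE; split; first exact: continuousNp.
  move=> j; have [ddu1 ddu2] := ddu j.
  split=> [x|]; first exact: derivableN.
  by rewrite -pE hE; exact: continuousNp.
- exact: continuousNp.
- by move=> i; under eq_fun do rewrite pE; exact: continuousNp.
- by move=> i j; under eq_fun do rewrite hE; exact: continuousNp.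
- by move=> t x t0; apply: is_deriveNp; exact: dut.
- by move=> p p0; apply: cvgN; exact: cut.
- move=> t x t0; rewrite sqrrN mulrN eq //.
  rewrite /lap; under [in RHS]eq_bigr do rewrite hE.
  by rewrite sumrN; ring.
Qed.

Section comparison.
Variables (eps : R) (u ut : R -> 'rV[R]_n -> R) (lam : R -> R).
Hypotheses (eps0 : 0 < eps) (fl : flow eps u ut lam).

Let u1 t : Ck 1 (u t). Proof. exact/Ck2_Ck1/(flow_C2 fl). Qed.

(** At a maximum in space the Laplacian is nonpositive, and dividing the equation by [1 - u^2]
    bounds the growth rate of [eps * artanh u] by [2 / eps + lam]. The multiplier enters through a
    primitive [F] of a majorant. *)
Lemma flow_max_principle (a b M : R) (F F' : R -> R) : 0 < a -> a <= b ->
  (forall t x, a <= t <= b -> -1 < u t x < 1) ->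
  (forall t, a <= t <= b -> {for t, continuous F}) ->
  (forall t, a < t <= b -> is_derive t 1 F (F' t)) ->
  (forall t, a < t <= b -> lam t <= F' t) ->
  (forall x, eps * artanh (u a x) <= M) ->
  forall x, eps * artanh (u b x) <= M + (F b - F a) + 2 / eps * (b - a).
Proof.
move=> a0 ab ult1 cF dF lamF rM x.
apply/ler_addgt0Pr => e e0.
(* The extra slope [d] makes the inequality strict at a maximum after time [a]; over the interval it
   costs at most [e]. *)
pose d := e / (b - a + 1).
have d0 : 0 < d by rewrite divr_gt0 // ltr_wpDl // subr_ge0.
have de : d * (b - a) <= e.
  by rewrite /d mulrAC ler_pdivrMr ?ler_pM2l // ?lerDl // ltr_wpDl // subr_ge0.
pose Phi (p : R * 'rV[R]_n) := eps * artanh (u p.1 p.2) - F p.1 - (2 / eps + d) * p.1.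
pose K := `[a, b]%classic `*` (ccube 0 : set 'rV[R]_n).
have cK : compact K.
  by apply: compact_setX; [exact: segment_compact|exact: compact_ccube].
have cPhi : {within K, continuous Phi}.
  apply: continuous_in_subspaceT => p; rewrite inE => -[/=]; rewrite in_itv /= => pab _.
  have c1 : {for p, continuous (fst : R * 'rV[R]_n -> R)} by exact: cvg_fst.
  apply: cvgB; last by apply: cvgM; [exact: cvg_cst|exact: c1].
  apply: cvgB; last by apply: (continuous_comp c1); exact: cF.
  apply: cvgM; first exact: cvg_cst.
  apply: (@continuous_comp _ _ _ (fun p : R * 'rV[R]_n => u p.1 p.2) artanh).
    exact: flow_continuous fl p.
  by apply: continuous_artanh; exact: ult1.
have [x0 Cx0 _] := periodic_ccube (x : 'rV[R]_n).
have K0 : K !=set0.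
  by exists (a, x0); split => //=; rewrite in_itv /= lexx ab.
have [[ts xs]] := compact_EVT_max K0 cK cPhi.
rewrite inE => -[/=]; rewrite in_itv /= => /andP[ats tsb] Cxs Pmax0.
have Pmax t z : a <= t <= b -> Phi (t, z) <= Phi (ts, xs).
  move=> tab; have [z' Cz' /(_ _ (flow_periodic fl t)) zz'] := periodic_ccube z.
  by rewrite /Phi /= zz'; apply: (Pmax0 (t, z')); rewrite inE.
have := Pmax b x; rewrite ab lexx => /(_ isT).
have [tsa|tsa] := leP ts a.
  have -> : ts = a by apply/eqP; rewrite eq_le tsa ats.
  have := rM xs; rewrite /Phi /=; lra.
have ts0 : 0 < ts by apply: lt_trans tsa.
have tsab : a < ts <= b by rewrite tsa tsb.
have /andP[U1 U2] : -1 < u ts xs < 1 by apply: ult1; rewrite ats tsb.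
set U := u ts xs in U1 U2 *.
have W0 : 0 < 1 - U ^+ 2 by nra.
have dP : is_derive ts 1 (fun t => Phi (t, xs))
    (eps * ((1 - U ^+ 2)^-1 * ut ts xs) - F' ts - (2 / eps + d) * 1).
  have H1 : is_derive ts 1 (fun t => artanh (u t xs)) ((1 - U ^+ 2)^-1 * ut ts xs).
    apply: (@is_derive1_comp _ artanh (u ^~ xs)); last exact: flow_dt fl _ _ ts0.
    by apply: is_derive_artanh; rewrite -/U U1 U2.
  have H2 := is_deriveZp (2 / eps + d) (is_derive_id (ts : R) (1 : R)).
  exact: (is_deriveBp (is_deriveBp (is_deriveZp eps H1) (dF _ tsab)) H2).
have := @max_left_derivative _ _ a ts _ tsa _ dP.
have H1 : forall s, a <= s <= ts -> Phi (s, xs) <= Phi (ts, xs).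
  by move=> s /andP[as_ sts]; apply: Pmax; rewrite as_ (le_trans sts).
move=> /(_ H1) c0.
(* [artanh] is increasing, so [xs] also maximizes [u ts], and the second derivative test applies to
   [u] itself. *)
have lap0 : lap (u ts) xs <= 0.
  apply: sumr_le0 => i _.
  have g1 (s : R) : u ts (s *: delta_mx 0 i + xs) <= u ts (0 *: delta_mx 0 i + xs).
    rewrite scale0r add0r; apply: le_artanh.
    + by apply: ult1; rewrite ats tsb.
    + by rewrite -/U U1 U2.
    + have := Pmax ts (s *: delta_mx 0 i + xs); rewrite ats tsb /Phi /= => /(_ isT).
      by rewrite !lerD2r ler_pM2l.
  have g2 := Ck1_line i xs 0 (Ck2_partial i (flow_C2 fl ts)).
  have [_] := max_second_derivative g1 (fun s => Ck1_line i xs s (u1 ts)) g2.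
  by rewrite scale0r add0r.
have E := flow_equation fl xs ts0.
have L := lamF _ tsab.
rewrite -/U gtr0_norm // in E.
have : eps * ((1 - U ^+ 2)^-1 * ut ts xs) <= 2 / eps + lam ts.
  rewrite mulrCA ler_pdivrMl // E.
  have e1 : eps * lap (u ts) xs <= 0 by rewrite mulr_ge0_le0 // ltW.
  have e2 : U * ((1 - U ^+ 2) / eps) <= (1 - U ^+ 2) / eps.
    by rewrite ler_piMl ?(ltW U2) // divr_ge0 // ltW.
  lra.
lra.
Qed.


Lemma enormE (v : 'rV[R]_n) : enorm v ^+ 2 = \sum_i v 0 i ^+ 2.
Proof. by rewrite sqr_sqrtr // sumr_ge0 // => i _; exact: sqr_ge0. Qed.

Lemma enorm_ge0 (v : 'rV[R]_n) : 0 <= enorm v.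
Proof. exact: sqrtr_ge0. Qed.

Lemma enorm0 : enorm (0 : 'rV[R]_n) = 0.
Proof.
by apply/eqP; rewrite -sqrf_eq0 enormE big1 // => i _; rewrite mxE expr0n.
Qed.

Lemma le_coord_enorm (v : 'rV[R]_n) i : `|v 0 i| <= enorm v.
Proof.
rewrite -(@ler_pXn2r _ 2) ?nnegrE ?enorm_ge0 // enormE real_normK ?num_real //.
by rewrite (bigD1 i) //= lerDl sumr_ge0 // => j _; exact: sqr_ge0.
Qed.

Lemma continuous_enorm : continuous (@enorm R n).
Proof.
move=> v; apply: (@continuous_comp _ _ _ (fun v : 'rV[R]_n => \sum_i v 0 i ^+ 2) Num.sqrt).
  by apply: continuous_sum => i; apply: continuous_sqrp => w; exact: coord_continuous.
exact: sqrt_continuous.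
Qed.

Lemma enorm_line (z : 'rV[R]_n) i (s : R) :
  enorm (s *: delta_mx 0 i + z) ^+ 2 = s ^+ 2 + 2 * s * z 0 i + enorm z ^+ 2.
Proof.
rewrite !enormE (bigD1 i) //= [in RHS](bigD1 i) //= !mxE !eqxx mulr1.
rewrite (eq_bigr (fun j => z 0 j ^+ 2)) => [|j ji]; first ring.
by rewrite !mxE (negbTE ji) andbF mulr0 add0r.
Qed.

(* AM-GM: a quadratic upper bound of the norm along a line, touching at [s = 0]. *)
Lemma enorm_line_le (z : 'rV[R]_n) i (s : R) : 0 < enorm z ->
  enorm (s *: delta_mx 0 i + z) <=
  enorm z + z 0 i / enorm z * s + (2 * enorm z)^-1 * s ^+ 2.
Proof.
move=> z0; have := enorm_line z i s; set m := enorm (_ + _) => mE.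
rewrite -(ler_pM2r (mulr_gt0 (ltr0n R 2) z0)) /=.
have -> : (enorm z + z 0 i / enorm z * s + (2 * enorm z)^-1 * s ^+ 2) * (2 * enorm z)
    = m ^+ 2 + enorm z ^+ 2.
  by rewrite mE; field; rewrite gt_eqF.
by have := sqr_ge0 (m - enorm z); nra.
Qed.

(** At a positive maximum both gradients of [r] equal [zs / |zs|]. The reaction term then drops out
    of the equation of [r] at both points, [lam] cancels in the difference, and translating the two
    points together compares the Laplacians. So the difference cannot grow at the rate [d > 0] that
    maximality in time demands. *)
Lemma flow_lipschitz (b : R) : 0 < b ->
  (forall t x, 0 <= t <= b -> -1 < u t x < 1) ->
  (forall x y, eps * artanh (u 0 x) - eps * artanh (u 0 y) <= enorm (x - y)) ->
  forall x y, eps * artanh (u b x) - eps * artanh (u b y) <= enorm (x - y).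
Proof.
move=> b0 ult1 lip0 x0 y0; rewrite leNgt; apply/negP => H.
pose r t x := eps * artanh (u t x).
have rP t x : 0 <= t <= b -> forall v du, is_derive x v (u t) du ->
    is_derive x v (r t) (eps * ((1 - u t x ^+ 2)^-1 * du)).
  move=> tb v du Hd; apply: is_deriveZp; apply: is_derive_compR => //.
  by apply: is_derive_artanh; exact: ult1.
(* Half of the supposed excess, spread over [[0, b]]; the other half keeps [Phi] positive at time
   [b]. *)
pose d := (r b x0 - r b y0 - enorm (x0 - y0)) / (2 * b).
have d0 : 0 < d by rewrite divr_gt0 ?mulr_gt0 // subr_gt0.
have db : 0 < r b x0 - r b y0 - enorm (x0 - y0) - d * b.
  have -> : d * b = (r b x0 - r b y0 - enorm (x0 - y0)) / 2.
    by rewrite /d; field; rewrite gt_eqF.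
  by have := H; rewrite -/(r b x0) -/(r b y0); lra.
(* The pair of points is given by base point and displacement: [Phi] is periodic in the former but
   not in the latter, because of the norm. *)
pose Phi (p : R * 'rV[R]_n * 'rV[R]_n) :=
  r p.1.1 (p.1.2 + p.2) - r p.1.1 p.1.2 - enorm p.2 - d * p.1.1.
have cu := flow_continuous fl.
have cra (T : topologicalType) (f : T -> R) (g : T -> 'rV[R]_n) p :
    {for p, continuous f} -> {for p, continuous g} -> 0 <= f p <= b ->
    {for p, continuous (fun q => r (f q) (g q))}.
  move=> cf cg fb; apply: cvgM; first exact: cvg_cst.
  apply: (@continuous_comp _ _ _ (fun q => u (f q) (g q)) artanh).
    apply: (@continuous_comp _ _ _ (fun q => (f q, g q)) (fun p : R * 'rV[R]_n => u p.1 p.2)).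
      exact: (cvg_pair cf cg).
    exact: cu.
  by apply: continuous_artanh; exact: ult1.
have c01 : compact (`[0, b]%classic `*` (ccube 0 : set 'rV[R]_n)).
  by apply: compact_setX; [exact: segment_compact|exact: compact_ccube].
have [M0 M00 M0P] : exists2 M0 : R, 0 <= M0 & forall t x, 0 <= t <= b -> `|r t x| <= M0.
  have [|M0 M00 M0P] := @compact_continuous_bound _ R (fun p : R * 'rV[R]_n => r p.1 p.2) _ c01.
    apply: continuous_in_subspaceT => p; rewrite inE => -[/=]; rewrite in_itv /= => pb _.
    apply: (cra _ (fun p : R * 'rV[R]_n => p.1) (fun p : R * 'rV[R]_n => p.2)).
    - exact: cvg_fst.
    + exact: cvg_snd.
    + exact: pb.
  exists M0 => // t x tb; have [x' Cx' /(_ _ (flow_periodic fl t)) xx'] := periodic_ccube x.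
  by rewrite /r xx'; apply: (M0P (t, x')); split => //=; rewrite in_itv.
(* Where [Phi > 0], the displacement is shorter than the oscillation of [r]; this supplies
   compactness in the variable that is not periodic. *)
pose N := 2 * M0.
pose B := [set v : 'rV[R]_n | forall i, `[- N, N]%classic (v 0 i)].
have cB : compact B.
  by apply: (@rV_compact R n (fun=> `[- N, N]%classic)) => i; exact: segment_compact.
pose K := (`[0, b]%classic `*` (ccube 0 : set 'rV[R]_n)) `*` B.
have cK : compact K by exact: compact_setX.
have cPhi : {within K, continuous Phi}.
  apply: continuous_in_subspaceT => -[[t x] z]; rewrite inE => -[[/=]]; rewrite in_itv /= => tb _ _.
  have c1 : {for (t, x, z), continuous (fun p : R * 'rV[R]_n * 'rV[R]_n => p.1.1)}.
    by apply: (@continuous_comp _ _ _ fst fst); exact: cvg_fst.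
  have c2 : {for (t, x, z), continuous (fun p : R * 'rV[R]_n * 'rV[R]_n => p.1.2)}.
    by apply: (@continuous_comp _ _ _ fst snd); [exact: cvg_fst|exact: cvg_snd].
  have c3 : {for (t, x, z), continuous (fun p : R * 'rV[R]_n * 'rV[R]_n => p.2)}.
    exact: cvg_snd.
  apply: cvgB; last by apply: cvgM; [exact: cvg_cst|exact: c1].
  apply: cvgB; last by apply: (continuous_comp c3); exact: continuous_enorm.
  apply: cvgB; last exact: (cra _ _ _ (t, x, z) c1 c2 tb).
  have c4 : {for (t, x, z), continuous (fun p : R * 'rV[R]_n * 'rV[R]_n => p.1.2 + p.2)}.
    by apply: cvgD; [exact: c2|exact: c3].
  exact: (cra _ _ _ (t, x, z) c1 c4 tb).
have inK t x z : 0 <= t <= b -> 0 < Phi (t, x, z) ->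
    exists2 p, K p & Phi (t, x, z) = Phi p.
  move=> tb P0; have [x' Cx' xx'] := periodic_ccube x.
  exists (t, x', z).
    split; first by split => //=; rewrite in_itv.
    move=> i /=; rewrite in_itv /= -ler_norml; apply: (le_trans (le_coord_enorm z i)).
    have := P0; rewrite /Phi /=.
    have /andP[t0 _] := tb.
    have := M0P t (x + z) tb; have := M0P t x tb; rewrite !ler_norml.
    have : 0 <= d * t by rewrite mulr_ge0 // ltW.
    by rewrite /N; lra.
  have pz : Defs.periodic (fun x => u t (x + z)).
    by move=> i w; rewrite addrAC (flow_periodic fl t).
  by rewrite /Phi /= /r (xx' _ pz) (xx' _ (flow_periodic fl t)).
have bb : 0 <= b <= b by rewrite lexx ltW.
have P0 : 0 < Phi (b, y0, x0 - y0) by rewrite /Phi /= [y0 + _]addrC subrK.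
have [p0 Kp0 Ep0] := inK _ _ _ bb P0.
have K0 : K !=set0 by exists p0.
have [[[ts ys] zs] Kp Pmax0] := compact_EVT_max K0 cK cPhi.
have Pp : 0 < Phi (ts, ys, zs).
  by apply: (lt_le_trans P0); rewrite Ep0; apply: Pmax0; rewrite inE.
have Pmax t x z : 0 <= t <= b -> Phi (t, x, z) <= Phi (ts, ys, zs).
  move=> tb; have [P1|P1] := ltP 0 (Phi (t, x, z)); last by apply: le_trans P1 (ltW Pp).
  by have [p Kp1 ->] := inK _ _ _ tb P1; apply: Pmax0; rewrite inE.
have tsb : 0 <= ts <= b.
  by move: Kp; rewrite inE => -[[/=]]; rewrite in_itv.
have ts0 : 0 < ts.
  have /andP[t0 _] := tsb; rewrite lt_neqAle t0 andbT; apply/eqP => E.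
  have := Pp; rewrite /Phi /= -E mulr0 subr0 ltNge.
  by have := lip0 (ys + zs) ys; rewrite addrAC subrr add0r => /(fun h => le_trans h _); rewrite subr_le0 => ->.
(* At coinciding points [Phi] is nonpositive, so the maximum avoids the corner of the norm. *)
have zs0 : 0 < enorm zs.
  rewrite lt_neqAle enorm_ge0 andbT; apply/eqP => E.
  have z0 : zs = 0.
    apply/rowP => i; apply/eqP; rewrite mxE -normr_le0 E.
    exact: le_coord_enorm.
  have := Pp; rewrite /Phi /= z0 enorm0 addr0 subrr subr0 sub0r oppr_gt0.
  by rewrite ltNge mulr_ge0 // ltW.
set xs := ys + zs.
have U1 : -1 < u ts xs < 1 by exact: ult1.
have V1 : -1 < u ts ys < 1 by exact: ult1.
have WU : 0 < 1 - u ts xs ^+ 2 by have /andP[? ?] := U1; nra.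
have WV : 0 < 1 - u ts ys ^+ 2 by have /andP[? ?] := V1; nra.
pose rt t x := eps * ((1 - u t x ^+ 2)^-1 * ut t x).
pose r1 i x := eps * ((1 - u ts x ^+ 2)^-1 * partial i (u ts) x).
pose z1 i := zs 0 i / enorm zs.
have rtP x : is_derive ts 1 (r ^~ x) (rt ts x).
  apply: is_deriveZp.
  apply: (@is_derive1_comp _ artanh (u ^~ x)); last exact: flow_dt fl _ _ ts0.
  by apply: is_derive_artanh; exact: ult1.
have r1P i x : is_derive x (delta_mx 0 i) (r ts) (r1 i x).
  by apply: rP => //; exact: Ck1_partial.
pose r2 i x := eps * ((2 * u ts x / (1 - u ts x ^+ 2) ^+ 2 * partial i (u ts) x) * partial i (u ts) x
  + (1 - u ts x ^+ 2)^-1 * partial i (partial i (u ts)) x).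
have r2P i x : is_derive x (delta_mx 0 i) (r1 i) (r2 i x).
  apply: is_deriveZp; apply: is_deriveMp.
    apply: (is_derive_compR (g := fun s => (1 - s ^+ 2)^-1)); last exact: Ck1_partial.
    by apply: is_derive_inv_oneBsqr; exact: ult1.
  by apply: Ck1_partial; exact: Ck2_partial (flow_C2 fl ts).
have time : d <= rt ts xs - rt ts ys.
  have H1 := is_deriveBp (rtP xs) (rtP ys).
  have H2 : is_derive (ts : R) (1 : R) (fun _ : R => enorm zs) 0 by exact: is_derive_cst.
  have H3 := is_deriveZp d (is_derive_id (ts : R) (1 : R)).
  have H4 (s : R) : 0 <= s <= ts -> r s xs - r s ys - enorm zs - d * s <=
      r ts xs - r ts ys - enorm zs - d * ts.
    move=> /andP[s0 sts]; have /andP[_ tb] := tsb.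
    by apply: (Pmax s ys zs); rewrite s0 (le_trans sts).
  have := max_left_derivative ts0 H4 (is_deriveBp (is_deriveBp H1 H2) H3).
  by rewrite /=; lra.
have quadD i (s : R) : is_derive s 1
    (fun s => z1 i * s + (2 * enorm zs)^-1 * s ^+ 2)
    (z1 i * 1 + (2 * enorm zs)^-1 * (2 * s * 1)).
  have I := is_derive_id (s : R) (1 : R).
  exact: (is_deriveDp (is_deriveZp _ I) (is_deriveZp _ (is_derive_sqrp I))).
(* Only the first point moves. The norm is replaced by its quadratic majorant, which touches at
   [s = 0] and so preserves the maximum. *)
have gradx i : r1 i xs = z1 i.
  have g1 (s : R) : r ts (s *: delta_mx 0 i + xs)
      - (z1 i * s + (2 * enorm zs)^-1 * s ^+ 2) <=
      r ts (0 *: delta_mx 0 i + xs) - (z1 i * 0 + (2 * enorm zs)^-1 * 0 ^+ 2).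
    have := Pmax ts ys (s *: delta_mx 0 i + zs) tsb.
    rewrite /Phi /= addrCA -/xs scale0r add0r.
    by have := enorm_line_le i s zs0; rewrite -/(z1 i); lra.
  have g2 (s : R) := is_deriveBp (is_derive_line (r1P i (s *: delta_mx 0 i + xs)))
    (quadD i s).
  by have := max_first_derivative g1 g2; rewrite /= scale0r add0r; lra.
(* Only the second point moves, so the displacement changes by the opposite amount. *)
have grady i : r1 i ys = z1 i.
  have g1 (s : R) : z1 i * s - (2 * enorm zs)^-1 * s ^+ 2
      - r ts (s *: delta_mx 0 i + ys) <=
      z1 i * 0 - (2 * enorm zs)^-1 * 0 ^+ 2 - r ts (0 *: delta_mx 0 i + ys).
    have := Pmax ts (s *: delta_mx 0 i + ys) ((- s) *: delta_mx 0 i + zs) tsb.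
    rewrite /Phi /= addrACA scaleNr subrr add0r -/xs -scaleNr scale0r add0r.
    by have := enorm_line_le i (- s) zs0; rewrite -/(z1 i); lra.
  have g2 (s : R) := is_deriveBp (is_deriveBp (is_deriveZp (z1 i) (is_derive_id (s : R) (1 : R)))
    (is_deriveZp (2 * enorm zs)^-1 (is_derive_sqrp (is_derive_id (s : R) (1 : R)))))
    (is_derive_line (r1P i (s *: delta_mx 0 i + ys))).
  by have := max_first_derivative g1 g2; rewrite /= scale0r add0r; lra.
(* Both points move together: the displacement, hence the norm, stays fixed. *)
have second i : r2 i xs - r2 i ys <= 0.
  have g1 (s : R) : r ts (s *: delta_mx 0 i + xs) - r ts (s *: delta_mx 0 i + ys) <=
      r ts (0 *: delta_mx 0 i + xs) - r ts (0 *: delta_mx 0 i + ys).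
    have := Pmax ts (s *: delta_mx 0 i + ys) zs tsb.
    by rewrite /Phi /= !lerD2r !scale0r !add0r -/xs /xs addrA.
  have g2 (s : R) := is_deriveBp (is_derive_line (r1P i (s *: delta_mx 0 i + xs)))
    (is_derive_line (r1P i (s *: delta_mx 0 i + ys))).
  have g3 := is_deriveBp (is_derive_line (r2P i (0 *: delta_mx 0 i + xs)))
    (is_derive_line (r2P i (0 *: delta_mx 0 i + ys))).
  have [_] := max_second_derivative g1 g2 g3.
  by rewrite !scale0r !add0r.
(* For a unit gradient, the term [(2 u / eps) |grad r|^2] contained in the second derivatives is
   exactly the reaction term of the equation. *)
have key x : (forall i, r1 i x = z1 i) -> -1 < u ts x < 1 ->
    rt ts x = \sum_i r2 i x + lam ts.
  move=> r1x ux; have w0 : 0 < 1 - u ts x ^+ 2 by have /andP[? ?] := ux; nra.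
  have S1 : \sum_i r1 i x ^+ 2 = 1.
    under eq_bigr do rewrite r1x /z1 exprMn.
    by rewrite -mulr_suml -enormE -exprMn mulfV ?expr1n // gt_eqF.
  have r2E i : r2 i x = 2 * u ts x / eps * r1 i x ^+ 2
      + eps / (1 - u ts x ^+ 2) * partial i (partial i (u ts)) x.
    by rewrite /r2 /r1; field; rewrite !gt_eqF.
  under eq_bigr do rewrite r2E.
  rewrite big_split /= -!mulr_sumr S1 -/(lap (u ts) x).
  have E := flow_equation fl x ts0; rewrite gtr0_norm // in E.
  by rewrite /rt mulrCA E; field; rewrite !gt_eqF.
have kx := key _ gradx U1; have ky := key _ grady V1.
have S : \sum_i (r2 i xs - r2 i ys) <= 0 by apply: sumr_le0 => i _; exact: second.
rewrite sumrB in S; clear - kx ky S time d0.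
by clearbody rt r2 d xs; lra.
Qed.

End comparison.
End flows.
Arguments flow_continuous {R n eps u ut lam} _ _ _ _.
Arguments flow_grad_continuous {R n eps u ut lam} _ _ _ _ _.
Arguments flow_hess_continuous {R n eps u ut lam} _ _ _ _ _ _.
Arguments flow_dt_continuous {R n eps u ut lam} _ _ _ _ _.

(** * The strict bound on [|u|] at all times *)

Section primitive.
Context {R : realType}.
Local Notation mu := lebesgue_measure.

(** The primitive starts at [a > 0] because [f] is continuous only at positive times; its increments
    are still controlled by the integral from 0, as [f] is nonnegative. *)
Lemma primitive_bound (f : R -> R) (a b C : R) : 0 < a -> a < b ->
  (forall t, 0 < t <= b -> {for t, continuous f}) -> (forall t, 0 <= f t) ->
  (\int[mu]_(t in `[0%R, b]) (f t)%:E <= C%:E)%E ->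
  exists2 F : R -> R, (forall t, a < t < b -> is_derive t 1 F (f t)) &
    (forall s t, a < s -> s <= t -> t < b -> F t - F s <= C).
Proof.
move=> a0 ab cf f0 fC.
have mf : measurable_fun `[0, b]%classic f.
  rewrite -(@setU1itv _ _ _ _ false) ?bnd_simp; last by rewrite ltW // (lt_trans a0).
  apply/measurable_funU => //; split; first exact: measurable_fun_set1.
  apply: subspace_continuous_measurable_fun => //.
  by apply: continuous_in_subspaceT => t; rewrite inE /= in_itv /= => /cf.
have cab c : c <= b -> {within `[a, c], continuous f}.
  move=> cb; apply: continuous_in_subspaceT => t; rewrite inE /= in_itv /= => /andP[at_ tb].
  by apply: cf; rewrite (lt_le_trans a0) // (le_trans tb).
have iab c : c <= b -> mu.-integrable `[a, c] (EFin \o f).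
  by move=> cb; apply: continuous_compact_integrable; [exact: segment_compact|exact: cab].
exists (fun t => \int[mu]_(s in `[a, t]) f s).
  move=> t /andP[at_ tb].
  have [|F1 F2] := @continuous_FTC1_closed R f a t b tb (iab b (lexx b)) at_.
    by apply: cf; rewrite (lt_trans a0) // ltW.
  by apply: DeriveDef; [exact: F1|rewrite -derive1E; exact: F2].
move=> s t as_ st tb; rewrite lerBlDr; apply: (@le_trans _ _ C); last first.
  by rewrite lerDl; apply: Rintegral_ge0.
rewrite -lee_fin fineK; last by apply: integrable_fin_num => //; apply: iab; rewrite ltW.
apply: le_trans fC; apply: ge0_subset_integral => //.
- exact/measurable_EFinP.
- by move=> x _; rewrite lee_fin.
- by apply: subset_itv; rewrite bnd_simp ltW.
Qed.

End primitive.

Section strict_bound.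
Context {R : realType} {n : nat}.
Variables (eps : R) (u ut : R -> 'rV[R]_n -> R) (lam : R -> R).
Hypotheses (eps0 : 0 < eps) (fl : flow eps u ut lam).

(** By periodicity the maximum of [|u t0|] over a compact cube is below 1, and compactness makes the
    neighbourhood of [t0] uniform in space. [k] is the midpoint between that maximum and 1. *)
Lemma flow_tube (t0 : R) : (forall x, -1 < u t0 x < 1) ->
  exists2 k : R, 0 <= k < 1 & \forall t \near t0, forall x, `|u t x| <= k.
Proof.
move=> u1; have cc := @compact_ccube R n 0.
have cu0 : continuous (u t0) by have [] := flow_C2 fl t0.
have [M M0 MP] : exists2 M : R, 0 <= M < 1 & forall x, ccube 0 x -> `|u t0 x| <= M.
  have [C0|/nonemptyPn C0] := pselect ((ccube 0 : set 'rV[R]_n) !=set0); last first.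
    by exists 0; rewrite ?lexx ?ltr01 // => x; rewrite C0.
  have cnu : continuous (fun x : 'rV[R]_n => `|u t0 x|).
    by move=> x; exact: (cvg_norm (cu0 x)).
  have [|c _ cP] := @compact_EVT_max _ R (fun x => `|u t0 x|) _ C0 cc.
    exact: continuous_subspaceT.
  exists `|u t0 c|; first by rewrite normr_ge0 ltr_norml u1.
  by move=> x Cx; apply: cP; rewrite inE.
pose k := (M + 1) / 2.
have /andP[M00 M1] := M0.
have Mk : M < k by rewrite /k; lra.
exists k; first by rewrite /k; lra.
have /compact_near_coveringP H := cc.
have := H R (nbhs t0) (fun t x => `|u t x| <= k) _.
case.
  move=> x Cx.
  have c : {for (x, t0), continuous (fun p : 'rV[R]_n * R => `|u p.2 p.1|)}.
    apply: cvg_norm.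
    apply: (@continuous_comp _ _ _ (fun p : 'rV[R]_n * R => (p.2, p.1)) (fun p : R * 'rV[R]_n => u p.1 p.2)).
      by apply: continuous_pairp; [exact: cvg_snd|exact: cvg_fst].
    exact: flow_continuous fl _.
  have Mx : `|u (x, t0).2 (x, t0).1| < k by apply: le_lt_trans Mk; exact: MP.
  move: c => /cvgr_le/(_ _ Mx) [[A B] /= AB ABP].
  by exists (A, B) => //= -[a b] ab; exact: (ABP (a, b)).
move=> d d0 dP; exists d => // t td x.
have [x' Cx' /(_ _ (flow_periodic fl t)) ->] := periodic_ccube x.
exact: (dP t td).
Qed.

(** Where [|u| < 1] the equation can be solved for [lam], and every other term in it is continuous
    in time. *)
Lemma flow_lam_continuous (t : R) (x : 'rV[R]_n) : 0 < t -> -1 < u t x < 1 ->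
  {for t, continuous lam}.
Proof.
move=> t0 u1.
pose f s := (eps * ut s x - (eps * lap (u s) x + 2 * u s x * (1 - u s x ^+ 2) / eps)) / `|1 - u s x ^+ 2|.
have pair_c : continuous (fun s : R => (s, x)).
  by move=> s; apply: continuous_pairp; [exact: cvg_id|exact: cvg_cst].
have comp (g : R * 'rV[R]_n -> R) s : {for (s, x), continuous g} ->
    {for s, continuous (fun s => g (s, x))}.
  by move=> cg; exact: (continuous_comp (pair_c s) cg).
have cu : continuous (fun s => u s x).
  by move=> s; exact (comp (fun p => u p.1 p.2) s (flow_continuous fl (s, x))).
have w0 : 0 < 1 - u t x ^+ 2 by have /andP[? ?] := u1; nra.
have cw : continuous (fun s => 1 - u s x ^+ 2).
  by apply: continuousBp; [exact: cst_continuous|exact: continuous_sqrp].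
have clap : continuous (fun s => eps * lap (u s) x).
  apply: continuousZp; apply: continuous_sum => i s.
  exact (comp (fun p => partial i (partial i (u p.1)) p.2) s (flow_hess_continuous fl i i (s, x))).
have cuw : continuous (fun s => 2 * u s x * (1 - u s x ^+ 2) / eps).
  apply: continuousMp; last exact: cst_continuous.
  by apply: continuousMp; [exact: continuousZp|exact: cw].
have cf : {for t, continuous f}.
  apply: cvgM; last first.
    apply: cvgV; first by rewrite normr_eq0 gt_eqF.
    by apply: cvg_norm; exact: cw.
  apply: cvgB.
    apply: cvgM; first exact: cvg_cst.
    exact (comp (fun p => ut p.1 p.2) t (flow_dt_continuous fl (t, x) t0)).
  exact: (continuousDp clap cuw).
have nw : \forall s \near t, 0 < 1 - u s x ^+ 2.
  by move: (cw t) => /cvgr_gt/(_ _ w0).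
have E : \forall s \near t, f s = lam s.
  near=> s.
  have s0 : 0 < s by near: s; exact: lt_nbhsr.
  have ws : 0 < 1 - u s x ^+ 2 by near: s.
  rewrite /f (flow_equation fl x s0) addrAC subrr add0r mulfK //.
  by rewrite normr_eq0 gt_eqF.
have H : f s @[s --> t] --> f t by exact: cf.
rewrite (nbhs_singleton E) in H.
by apply: cvg_trans H; exact: near_eq_cvg.
Unshelve. all: by end_near. Qed.

End strict_bound.

Lemma le_artanh_mono {R : realType} (s z : R) : -1 < s -> s <= z -> z < 1 ->
  artanh s <= artanh z.
Proof.
move=> s1 sz z1; rewrite leNgt; apply/negP => H.
have zs : z <= s by apply: le_artanh; rewrite ?(ltW H) //; lra.
by move: H; rewrite (le_anti (introT andP (conj sz zs))) ltxx.
Qed.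

Section strict_bound_global.
Context {R : realType} {n : nat}.
Local Notation mu := lebesgue_measure.

(** The comparison principle bounds [eps * artanh u] by a constant [K] that does not depend on the
    time before [T]. So [u] stays below a fixed [k' < 1], which survives in the limit at [T]. *)
Lemma flow_lt1_step (eps : R) (u ut : R -> 'rV[R]_n -> R) (lam : R -> R)
    (c T : R) : 0 < eps -> flow eps u ut lam -> 0 < T -> 0 <= c ->
  (forall b, 0 < b < T -> (\int[mu]_(t in `[0%R, b]) (lam t ^+ 2)%:E <= c%:E)%E) ->
  (forall t x, 0 <= t < T -> -1 < u t x < 1) -> forall x, u T x < 1.
Proof.
move=> eps0 fl T0 c0 lamc ult1 x.
have [k /andP[k0 k1] tube] : exists2 k : R, 0 <= k < 1 &
    \forall t \near (0 : R), forall x, `|u t x| <= k.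
  by apply: flow_tube fl _ _ => z; apply: ult1; rewrite lexx.
have [a [a0 aT ak]] : exists a : R, [/\ 0 < a, a < T & forall z, `|u a z| <= k].
  have H : \forall a \near (0 : R)^'+, forall z, `|u a z| <= k by exact: cvg_within tube.
  near (0 : R)^'+ => a; exists a; split; first by [].
  - by near: a; exact: nbhs_right_lt.
  - by near: a.
pose M := eps * artanh k.
pose K := M + (T + c) / 2 + 2 / eps * T.
have rK b z : a <= b < T -> eps * artanh (u b z) <= K.
  move=> /andP[ab bT].
  have lamcont t : 0 < t < T -> {for t, continuous lam}.
    move=> /andP[t0 tT]; apply: (flow_lam_continuous fl (x := z)) => //.
    by apply: ult1; rewrite tT ltW.
  (* The primitive lives on an open interval containing [[a, b]], to be differentiable at both
     ends. *)
  pose b1 := (b + T) / 2; pose a1 := a / 2.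
  have a10 : 0 < a1 by rewrite /a1; lra.
  have a1b1 : a1 < b1 by rewrite /a1 /b1; lra.
  have b1T : b1 < T by rewrite /b1; lra.
  have f_cont t : 0 < t <= b1 -> {for t, continuous (fun t => lam t ^+ 2)}.
    move=> /andP[t0 tb]; apply: (@continuous_comp _ _ _ lam (fun s => s ^+ 2)).
      by apply: lamcont; rewrite t0 (le_lt_trans tb).
    exact: exprn_continuous.
  have b10 : 0 < b1 < T by rewrite b1T (lt_trans a10).
  have [F dF Fc] := primitive_bound a10 a1b1 f_cont (fun t => sqr_ge0 (lam t)) (lamc _ b10).
  (* A primitive of [(1 + lam ^ 2) / 2], which is at least [lam]: thus the square integral controls
     the forcing. *)
  pose G t := (t + F t) / 2.
  have dG t : a <= t <= b -> is_derive t 1 G ((1 + lam t ^+ 2) / 2).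
    move=> /andP[at_ tb]; apply: is_deriveMcp.
    have dFt : is_derive t 1 F (lam t ^+ 2) by apply: dF; rewrite /a1 /b1; lra.
    exact: (is_deriveDp (is_derive_id (t : R) (1 : R)) dFt).
  have H : eps * artanh (u b z) <= M + (G b - G a) + 2 / eps * (b - a).
    apply: (flow_max_principle (F' := fun t => (1 + lam t ^+ 2) / 2) eps0 fl a0 ab).
    - move=> t w /andP[at_ tb]; apply: ult1.
      by rewrite (le_trans (ltW a0)) // (le_lt_trans tb).
    - move=> t tab; apply: differentiable_continuous; apply/derivable1_diffP.
      by case: (dG t tab).
    - by move=> t /andP[at_ tb]; apply: dG; rewrite tb ltW.
    - by move=> t _; have := sqr_ge0 (lam t - 1); nra.
    - move=> w; rewrite ler_pM2l //; apply: le_artanh_mono => //.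
      + by have /andP[] : -1 < u a w < 1 by apply: ult1; rewrite aT ltW.
      + by apply: le_trans (ak w); exact: ler_norm.
  have e1 : G b - G a <= (T + c) / 2.
    have : F b - F a <= c by apply: Fc; rewrite /a1 /b1; lra.
    by rewrite /G; lra.
  have e2 : 2 / eps * (b - a) <= 2 / eps * T by rewrite ler_pM2l ?divr_gt0 //; lra.
  by rewrite /K; lra.
have [k' k'1 k'P] := artanh_le_lt1 (K / eps).
suff : u T x <= k' by move=> h; exact: le_lt_trans h k'1.
have cu : continuous (fun t => u t x).
  have pc : continuous (fun s : R => (s, x)).
    by move=> s; apply: continuous_pairp; [exact: cvg_id|exact: cvg_cst].
  by move=> s; exact (continuous_comp (pc s) (flow_continuous fl (s, x))).
have cuT : u t x @[t --> T^'-] --> u T x by apply: cvg_at_left_filter; exact: cu.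
apply: (cvgr_to_le cuT); near=> t.
have at_ : a <= t by near: t; exact: nbhs_left_ge.
have tT : t < T by [].
apply: k'P; first by apply: ult1; rewrite tT (le_trans (ltW a0)).
by rewrite ler_pdivlMr // mulrC; apply: rK; rewrite at_ tT.
Unshelve. all: by end_near. Qed.

(** Continuation: [T] is the infimum of the times at which the bound fails. The step for [u] and for
    [- u] gives the bound at [T], and [flow_tube] carries it beyond. *)
Lemma flow_lt1 (eps : R) (u ut : R -> 'rV[R]_n -> R) (lam : R -> R)
    (c : R -> R) : 0 < eps -> flow eps u ut lam -> {homo c : s t / s <= t} ->
  (forall b, 0 < b -> (\int[mu]_(t in `[0%R, b]) (lam t ^+ 2)%:E <= (c b)%:E)%E) ->
  (forall x, -1 < u 0 x < 1) -> forall t x, 0 <= t -> -1 < u t x < 1.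
Proof.
move=> eps0 fl c_homo lamc u01.
pose S := [set t : R | 0 <= t /\ exists x, ~~ (-1 < u t x < 1)].
have [[s0 Ss0]|S0] := pselect (S !=set0); last first.
  move=> t x t0; apply/negPn/negP => h; apply: S0; exists t; split => //.
  by exists x.
have S_lb : lbound S 0 by move=> t [].
have S_inf : has_inf S by split; [exists s0|exists 0].
pose T := inf S.
have before t x : 0 <= t < T -> -1 < u t x < 1.
  move=> /andP[t0 tT]; apply/negPn/negP => h.
  have : T <= t by apply: ge_inf; [exists 0|split => //; exists x].
  by rewrite leNgt tT.
have tube t : 0 <= t -> (forall s x, 0 <= s <= t -> -1 < u s x < 1) -> t < T.
  move=> t0 ut1.
  have [k /andP[k0 k1]] := flow_tube fl (fun x => ut1 t x (introT andP (conj t0 (lexx t)))).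
  move=> /nbhs_ballP[d /= d0 dP].
  apply: (@lt_le_trans _ _ (t + d / 2)); first by rewrite ltrDl divr_gt0.
  apply: lb_le_inf; first by exists s0.
  move=> s [s_ge [x]]; apply: contraNle => sd.
  have [st|ts] := leP s t; first by apply: ut1; rewrite s_ge st.
  rewrite -ltr_norml; apply: le_lt_trans k1; apply: dP; rewrite -ball_normE /=.
  by rewrite ltr0_norm ?subr_lt0 // opprB; lra.
have T0 : 0 < T.
  by apply: tube => // s x /andP[s1 s2]; rewrite (_ : s = 0) //; apply: le_anti; rewrite s2.
have cT0 : 0 <= c T.
  have := lamc T T0; apply: contraTT; rewrite -!ltNge => cT.
  apply: (@lt_le_trans _ _ 0%E); first by rewrite lte_fin.
  by apply: integral_ge0 => t _; rewrite lee_fin sqr_ge0.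
have bound (l : R -> R) : (forall t, l t ^+ 2 = lam t ^+ 2) -> forall b, 0 < b < T ->
    (\int[mu]_(t in `[0%R, b]) (l t ^+ 2)%:E <= (c T)%:E)%E.
  move=> lE b /andP[b0 bT]; under eq_integral do rewrite lE.
  by apply: le_trans (lamc b b0) _; rewrite lee_fin c_homo // ltW.
have uT x : -1 < u T x < 1.
  have up := flow_lt1_step eps0 fl T0 cT0 (bound lam (fun=> erefl)) before.
  have dn := flow_lt1_step eps0 (flowN fl) T0 cT0 (bound _ (fun t => sqrrN (lam t))).
  rewrite up andbT ltrNl; apply: dn => t z tT.
  by have /andP[h1 h2] := before t z tT; rewrite ltrN2 h2 ltrNl h1.
suff : T < T by rewrite ltxx.
apply: tube; first exact: ltW.
move=> s x /andP[s1]; rewrite le_eqVlt => /orP[/eqP -> //|sT].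
by apply: before; rewrite s1.
Qed.

End strict_bound_global.

(** * The gradient bound and uniform estimates in time *)

Section auxiliary_bounds.
Context {R : realType} {n : nat}.

(** The Lipschitz bound is tested in the direction [grad f x] itself, where [eps * artanh f] has
    derivative [eps |grad f|^2 / (1 - f^2)]; one factor [|grad f|] cancels. *)
Lemma lipschitz_grad (eps : R) (f : 'rV[R]_n -> R) (x : 'rV[R]_n) : 0 < eps ->
  Ck 1 f -> (forall x, -1 < f x < 1) ->
  (forall x y, eps * artanh (f x) - eps * artanh (f y) <= enorm (x - y)) ->
  eps ^+ 2 * \sum_i partial i f x ^+ 2 <= (1 - f x ^+ 2) ^+ 2.
Proof.
move=> eps0 f1 fb lip.
pose v := grad f x.
have vE : enorm v ^+ 2 = \sum_i partial i f x ^+ 2.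
  by rewrite enormE; apply: eq_bigr => i _; rewrite mxE.
have w0 : 0 < 1 - f x ^+ 2 by have /andP[? ?] := fb x; nra.
have D : is_derive x v (fun x => eps * artanh (f x))
    (eps * ((1 - f x ^+ 2)^-1 * enorm v ^+ 2)).
  apply: is_deriveZp; apply: is_derive_compR; first exact: is_derive_artanh.
  apply: is_derive_eq; first exact: Ck1_is_derive.
  by rewrite vE; apply: eq_bigr => i _; rewrite mxE expr2.
have le_v : eps * ((1 - f x ^+ 2)^-1 * enorm v ^+ 2) <= enorm v.
  have [lim_ limE] := D.
  have : h^-1 *: (eps * artanh (f (h *: v + x)) - eps * artanh (f x)) @[h --> (0 : R)^']
      --> eps * ((1 - f x ^+ 2)^-1 * enorm v ^+ 2) by rewrite -limE.
  move=> /cvg_dnbhs_at_right H; apply: (cvgr_to_le H); near=> h.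
  have h0 : 0 < h by [].
  rewrite /GRing.scale /= ler_pdivrMl //; apply: le_trans (lip _ _) _.
  rewrite addrK /enorm; under eq_bigr do rewrite mxE exprMn.
  by rewrite -mulr_sumr sqrtrM ?sqr_ge0 // sqrtr_sqr gtr0_norm.
rewrite -vE -exprMn; have v0 := enorm_ge0 v.
have [ve|v_gt0] := eqVneq (enorm v) 0; first by rewrite ve mulr0 expr0n sqr_ge0.
have {}v_gt0 : 0 < enorm v by rewrite lt_neqAle eq_sym v_gt0.
suff H : eps * enorm v <= 1 - f x ^+ 2.
  by rewrite ler_pXn2r ?nnegrE ?(ltW w0) // mulr_ge0 // ltW.
rewrite -(ler_pM2r v_gt0) -mulrA -expr2.
by move: le_v; rewrite mulrCA ler_pdivrMl.
Unshelve. all: by end_near. Qed.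

Lemma joint_continuous_bound (F : R * 'rV[R]_n -> R) (y : 'rV[R]_n) (t d : R) :
  (forall p, `|p.1 - t| <= d -> {for p, continuous F}) ->
  exists2 M, 0 <= M & forall s x, `|s - t| <= d -> ccube y x -> `|F (s, x)| <= M.
Proof.
move=> cF.
have tE s : (`[t - d, t + d]%classic s) = (`|s - t| <= d).
  by rewrite /= in_itv /= ler_distl.
have [||M M0 MP] := @compact_continuous_bound _ R F (`[t - d, t + d]%classic `*` ccube y).
- by apply: compact_setX; [exact: segment_compact|exact: compact_ccube].
- apply: continuous_in_subspaceT => p; rewrite inE => -[pt _]; apply: cF.
  by rewrite -tE.
by exists M => // s x st Cx; apply: MP; split => //; rewrite tE.
Qed.

Lemma mean_value_bound (f df : R -> R) (t h M : R) :
  (forall s, `|s - t| <= `|h| -> is_derive s 1 f (df s)) ->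
  (forall s, `|s - t| <= `|h| -> `|df s| <= M) ->
  `|f (t + h) - f t| <= M * `|h|.
Proof.
move=> dfP dfM.
have key a b : a <= b -> (forall s, a <= s <= b -> `|s - t| <= `|h|) ->
    `|f b - f a| <= M * (b - a).
  move=> ab H.
  have [||c] := @MVT_segment R f df a b ab.
  - by move=> s; rewrite in_itv /= => /andP[as_ sb]; apply: dfP; apply: H; rewrite !ltW.
  - apply: continuous_in_subspaceT => s; rewrite inE /= in_itv /= => /H/dfP[ds _].
    exact/differentiable_continuous/derivable1_diffP.
  rewrite in_itv /= => /H/dfM cM ->.
  by rewrite normrM ler_pM // ger0_norm ?subr_ge0.
have [h0|h0] := leP 0 h.
  rewrite (ger0_norm h0) (_ : M * h = M * (t + h - t)); last by rewrite addrAC subrr add0r.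
  apply: key; first by rewrite lerDl.
  move=> s /andP[s1 s2]; rewrite (ger0_norm h0) ger0_norm ?subr_ge0 //.
  by rewrite lerBlDl.
rewrite distrC (ltr0_norm h0) (_ : - h = t - (t + h)); last by rewrite opprD addNKr.
apply: key; first by rewrite gerDl ltW.
move=> s /andP[s1 s2]; rewrite (ltr0_norm h0) ler0_norm ?subr_le0 //.
by rewrite opprB lerBlDl -lerBlDr opprK.
Qed.

End auxiliary_bounds.

(** * Monotonicity of the weighted energy *)

(* The terms with second derivatives of [u] off the diagonal cancel by symmetry. *)
Lemma stress_algebra {R : realType} {n : nat} (eps k e a w : R)
    (d dd p : 'I_n -> R) (H : 'I_n -> 'I_n -> R) :
  (forall i j, H i j = H j i) ->
  let b := \sum_i - a * d i * p i in
  \sum_j ((eps * (\sum_i p i * H i j) - k * p j) * (- a * d j * w)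
    + e * (a ^+ 2 * d j * d j * w - a * (dd j * (j == j)%:R) * w)
    - (eps * (\sum_i ((a ^+ 2 * d i * d j * w - a * (dd i * (i == j)%:R) * w) * p i
                      + (- a * d i * w) * H i j)) * p j
       + eps * (\sum_i - a * d i * w * p i) * H j j)) =
  w * ((- k - eps * (\sum_j H j j) - eps * b) * b
       + e * (a ^+ 2 * (\sum_j d j ^+ 2) - a * \sum_j dd j)
       + eps * a * \sum_j dd j * p j ^+ 2).
Proof.
move=> Hs b; set D := \sum_i d i * p i.
have bE : b = - a * D by rewrite /D mulr_sumr; apply: eq_bigr => i _; rewrite mulrA.
have wD : \sum_i - a * d i * w * p i = - a * w * D.
  by rewrite /D mulr_sumr; apply: eq_bigr => i _; ring.
have inner j : \sum_i ((a ^+ 2 * d i * d j * w - a * (dd i * (i == j)%:R) * w) * p i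
      + (- a * d i * w) * H i j) =
    a ^+ 2 * w * d j * D - a * w * dd j * p j - a * w * \sum_i d i * H i j.
  rewrite big_split /=; congr (_ + _); last first.
    by rewrite -mulNr mulr_sumr; apply: eq_bigr => i _; ring.
  under eq_bigr do rewrite mulrBl.
  rewrite sumrB; congr (_ - _).
    by rewrite /D mulr_sumr; apply: eq_bigr => i _; ring.
  rewrite (bigD1 j) //= eqxx big1 ?addr0; first by rewrite mulr1; ring.
  by move=> i ij; rewrite (negbTE ij) !(mulr0, mul0r).
have swap : \sum_j d j * (\sum_i p i * H i j) = \sum_j p j * (\sum_i d i * H i j).
  under eq_bigr do rewrite mulr_sumr.
  rewrite exchange_big /=; apply: eq_bigr => i _; rewrite mulr_sumr.
  by apply: eq_bigr => j _; rewrite Hs; ring.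
rewrite bE wD.
transitivity (\sum_j (- eps * a * w * (d j * (\sum_i p i * H i j))
   + (k * a * w - eps * a ^+ 2 * w * D) * (d j * p j) + e * w * a ^+ 2 * d j ^+ 2
   - e * w * a * dd j + eps * a * w * (dd j * p j ^+ 2)
   + eps * a * w * (p j * (\sum_i d i * H i j)) + eps * a * w * D * H j j)).
  by apply: eq_bigr => j _; rewrite inner eqxx mulr1; ring.
rewrite !big_split /= sumrN -!mulr_sumr swap -/D; ring.
Qed.

Section weighted_energy.
Context {R : realType} {n : nat}.
Variables (eps : R) (u ut : R -> 'rV[R]_n -> R) (lam : R -> R).
Hypotheses (eps0 : 0 < eps) (fl : flow eps u ut lam).
Hypothesis u_lt1 : forall t x, 0 <= t -> -1 < u t x < 1.
Hypothesis grad_bound : forall t x, 0 < t ->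
  eps ^+ 2 * \sum_i partial i (u t) x ^+ 2 <= (1 - u t x ^+ 2) ^+ 2.

Variables (q dq ddq : R -> R).
Hypotheses (qP : forall s : R, is_derive s 1 q (dq s))
  (dqP : forall s : R, is_derive s 1 dq (ddq s)) (cddq : continuous ddq)
  (q_per : forall s, q (s + 1) = q s) (dq_per : forall s, dq (s + 1) = dq s)
  (ddq_le : forall s, ddq s <= 1 / 2).

Variables (c y : 'rV[R]_n) (ell dell aa daa : R -> R) (t1 : R).
Hypotheses (ellP : forall t : R, t < t1 -> is_derive t 1 ell (dell t))
  (cdell : forall t : R, t < t1 -> {for t, continuous dell})
  (aaP : forall t : R, t < t1 -> is_derive t 1 aa (daa t))
  (cdaa : forall t : R, t < t1 -> {for t, continuous daa})
  (aa_ge0 : forall t, t < t1 -> 0 <= aa t).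

Definition wphase (x : 'rV[R]_n) : R := \sum_i q (x 0 i - c 0 i).

(** For [w = weight] this reads [w_t + lap w + (aa / 2) w <= 0]. Equality holds for the phase
    [z^2 / 4] with [aa = 1 / (s - t)] and the prefactor [(s - t)] to the power [- (n - 1) / 2]. *)
Hypothesis weight_cond : forall t x, t < t1 ->
  dell t - daa t * wphase x + aa t ^+ 2 * (\sum_i dq (x 0 i - c 0 i) ^+ 2)
    - aa t * (\sum_i ddq (x 0 i - c 0 i)) + aa t / 2 <= 0.

Definition weight (t : R) (x : 'rV[R]_n) : R := expR (ell t - aa t * wphase x).

Definition edens (t : R) (x : 'rV[R]_n) : R :=
  eps * (\sum_i partial i (u t) x ^+ 2) / 2 + (1 - u t x ^+ 2) ^+ 2 / 2 / eps.

Definition wenergy (t : R) : R := cint y (fun x => weight t x * edens t x).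

Definition dweight (i : 'I_n) (t : R) (x : 'rV[R]_n) : R := - aa t * dq (x 0 i - c 0 i) * weight t x.

Let u1 t : Ck 1 (u t). Proof. exact/Ck2_Ck1/(flow_C2 fl). Qed.

Let cq : continuous q.
Proof. by move=> s; apply: differentiable_continuous; apply/derivable1_diffP; case: (qP s). Qed.

Let cdq : continuous dq.
Proof. by move=> s; apply: differentiable_continuous; apply/derivable1_diffP; case: (dqP s). Qed.

Let is_derive_coord (x : 'rV[R]_n) i j :
  is_derive x (delta_mx 0 i) (fun x : 'rV[R]_n => x 0 j - c 0 j) (j == i)%:R.
Proof.
apply: is_derive_line0; under eq_fun do rewrite !mxE eqxx /= -addrA.
have H := is_deriveDp (is_deriveMcp (j == i)%:R (is_derive_id (0 : R) (1 : R)))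
  (is_derive_cst (x 0 j - c 0 j) (0 : R) (1 : R)).
by apply: (is_derive_eq H); rewrite mul1r addr0.
Qed.

Let is_derive_comp_coord (f df : R -> R) (x : 'rV[R]_n) i j :
  (forall s : R, is_derive s 1 f (df s)) ->
  is_derive x (delta_mx 0 i) (fun x : 'rV[R]_n => f (x 0 j - c 0 j))
    (df (x 0 j - c 0 j) * (j == i)%:R).
Proof. by move=> fP; exact: (is_derive_compR (fP _) (is_derive_coord x i j)). Qed.

Let is_derive_wphase x i :
  is_derive x (delta_mx 0 i) wphase (dq (x 0 i - c 0 i)).
Proof.
apply: is_derive_eq.
  by apply: is_derive_sump => j; exact: is_derive_comp_coord.
rewrite (bigD1 i) //= eqxx mulr1 big1 ?addr0 // => j ji.
by rewrite (negbTE ji) mulr0.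
Qed.

Let is_derive_weight t x i :
  is_derive x (delta_mx 0 i) (weight t) (dweight i t x).
Proof.
have H := is_deriveBp (is_derive_cst (ell t) x (delta_mx 0 i)) (is_deriveZp (aa t) (is_derive_wphase x i)).
apply: (is_derive_eq (is_derive_compR (is_derive_expR _) H)).
by rewrite /dweight /weight /=; ring.
Qed.

Let is_derive_dweight t x i j :
  is_derive x (delta_mx 0 j) (dweight i t)
    (aa t ^+ 2 * dq (x 0 i - c 0 i) * dq (x 0 j - c 0 j) * weight t x
     - aa t * (ddq (x 0 i - c 0 i) * (i == j)%:R) * weight t x).
Proof.
have H := is_deriveMp (is_deriveZp (- aa t) (is_derive_comp_coord x j i dqP)) (is_derive_weight t x j).
by apply: (is_derive_eq H); rewrite /dweight; ring.
Qed.

Let ccoord (f : R -> R) i : continuous f ->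
  continuous (fun x : 'rV[R]_n => f (x 0 i - c 0 i)).
Proof.
move=> cf x; apply: (@continuous_comp _ _ _ (fun x : 'rV[R]_n => x 0 i - c 0 i) f); last exact: cf.
by apply: continuousBp; [move=> z; exact: coord_continuous|exact: cst_continuous].
Qed.

Let cwphase : continuous wphase.
Proof. by apply: continuous_sum => i; exact: ccoord. Qed.

Let cweight t : continuous (weight t).
Proof.
move=> x; apply: (@continuous_comp _ _ _ (fun x => ell t - aa t * wphase x) (@expR R)).
  by apply: continuousBp; [exact: cst_continuous|exact: continuousZp].
exact: continuous_expR.
Qed.

Let cdweight i t : continuous (dweight i t).
Proof. by apply: continuousMp; [apply: continuousZp; exact: ccoord|exact: cweight]. Qed.

Let cu t : continuous (u t). Proof. by have [] := u1 t. Qed.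
Let cpu t i : continuous (partial i (u t)).
Proof. by have [_ /(_ i)[_]] := u1 t. Qed.
Let cppu t i j : continuous (partial j (partial i (u t))).
Proof. by have [_ /(_ j)[_]] := Ck2_partial i (flow_C2 fl t). Qed.

Let cedens t : continuous (edens t).
Proof.
apply: continuousDp.
  apply: continuousMp; last exact: cst_continuous.
  by apply: continuousZp; apply: continuous_sum => i; apply: continuous_sqrp; exact: cpu.
apply: continuousMp; last exact: cst_continuous.
apply: continuousMp; last exact: cst_continuous.
by apply: continuous_sqrp; apply: continuousBp; [exact: cst_continuous|exact: continuous_sqrp].
Qed.

Let is_derive_u t x i : is_derive x (delta_mx 0 i) (u t) (partial i (u t) x).
Proof. exact: Ck1_partial. Qed.

Let is_derive_pu t x i j :
  is_derive x (delta_mx 0 j) (partial i (u t)) (partial j (partial i (u t)) x).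
Proof. by apply: Ck1_partial; exact: Ck2_partial (flow_C2 fl t). Qed.

Let is_derive_edens t x j :
  is_derive x (delta_mx 0 j) (edens t)
    (eps * (\sum_i partial i (u t) x * partial j (partial i (u t)) x)
     - 2 * u t x * (1 - u t x ^+ 2) * partial j (u t) x / eps).
Proof.
have H1 := is_deriveMcp 2^-1 (is_deriveZp eps (is_derive_sump (index_enum 'I_n)
  (fun i => is_derive_sqrp (is_derive_pu t x i j)))).
have H2 := is_derive_sqrp (is_deriveBp (is_derive_cst (1 : R) x (delta_mx 0 j))
  (is_derive_sqrp (is_derive_u t x j))).
apply: (is_derive_eq (is_deriveDp H1 (is_deriveMcp eps^-1 (is_deriveMcp 2^-1 H2)))).
under eq_bigr do rewrite -mulrA.
by rewrite -mulr_sumr /=; field; rewrite gt_eqF.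
Qed.


Let q_shift (f : R -> R) i k (x : 'rV[R]_n) : (forall s, f (s + 1) = f s) ->
  f ((x + delta_mx 0 i) 0 k - c 0 k) = f (x 0 k - c 0 k).
Proof.
move=> fper; rewrite !mxE eqxx /=; case: eqP => _; last by rewrite addr0.
by rewrite addrAC fper.
Qed.

Let weight_periodic t : Defs.periodic (weight t).
Proof.
move=> i x; rewrite /weight /wphase; congr (expR (_ - _ * _)).
by apply: eq_bigr => k _; exact: q_shift.
Qed.

Let edens_periodic t : Defs.periodic (edens t).
Proof.
move=> i x; rewrite /edens (flow_periodic fl t); under eq_bigr => k _ do
  rewrite (periodic_partial k (flow_periodic fl t)).
by [].
Qed.

Let dweight_periodic k t : Defs.periodic (dweight k t).
Proof. by move=> i x; rewrite /dweight weight_periodic q_shift. Qed.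

Let pu_periodic t k : Defs.periodic (partial k (u t)).
Proof. exact: periodic_partial (flow_periodic fl t). Qed.

Let cddweight t i j : continuous (fun x : 'rV[R]_n =>
  aa t ^+ 2 * dq (x 0 i - c 0 i) * dq (x 0 j - c 0 j) * weight t x
     - aa t * (ddq (x 0 i - c 0 i) * (i == j)%:R) * weight t x).
Proof.
apply: continuousBp; apply: continuousMp; try exact: cweight.
  by apply: continuousMp; [apply: continuousZp; exact: ccoord|exact: ccoord].
apply: continuousZp; apply: continuousMp; first exact: ccoord.
exact: cst_continuous.
Qed.

Let cdedens t j : continuous (fun x : 'rV[R]_n =>
  eps * (\sum_i partial i (u t) x * partial j (partial i (u t)) x)
     - 2 * u t x * (1 - u t x ^+ 2) * partial j (u t) x / eps).
Proof.
apply: continuousBp.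
  by apply: continuousZp; apply: continuous_sum => i; apply: continuousMp; [exact: cpu|exact: cppu].
apply: continuousMp; last exact: cst_continuous.
apply: continuousMp; last exact: cpu.
apply: continuousMp; first by apply: continuousZp; exact: cu.
by apply: continuousBp; [exact: cst_continuous|apply: continuous_sqrp; exact: cu].
Qed.

(* The divergence of [e grad w - eps (grad w . grad u) grad u], where [e] is
   the energy density and [w] the weight. *)
Definition stress (t : R) (x : 'rV[R]_n) : R := weight t x *
  ((- (2 * u t x * (1 - u t x ^+ 2) / eps) - eps * lap (u t) x
      - eps * (\sum_i - aa t * dq (x 0 i - c 0 i) * partial i (u t) x))
     * (\sum_i - aa t * dq (x 0 i - c 0 i) * partial i (u t) x)
   + edens t x * (aa t ^+ 2 * (\sum_i dq (x 0 i - c 0 i) ^+ 2)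
                  - aa t * \sum_i ddq (x 0 i - c 0 i))
   + eps * aa t * \sum_i ddq (x 0 i - c 0 i) * partial i (u t) x ^+ 2).

Lemma cint_stress t : cint y (stress t) = 0.
Proof.
pose X (j : 'I_n) (x : 'rV[R]_n) := edens t x * dweight j t x
  - eps * (\sum_i dweight i t x * partial i (u t) x) * partial j (u t) x.
have cS : continuous (fun x => \sum_i dweight i t x * partial i (u t) x).
  by apply: continuous_sum => i; apply: continuousMp; [exact: cdweight|exact: cpu].
have dX j x : is_derive x (delta_mx 0 j) (X j) _ :=
  is_deriveBp (is_deriveMp (is_derive_edens t x j) (is_derive_dweight t x j j))
   (is_deriveMp (is_deriveZp eps (is_derive_sump (index_enum 'I_n) (fun i =>
      is_deriveMp (is_derive_dweight t x i j) (is_derive_pu t x i j))))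
     (is_derive_pu t x j j)).
have pX j x := @derive_val _ _ _ _ _ _ _ (dX j x).
rewrite -[RHS](@cint_divergence R n y X).
- apply: eq_Rintegral => x _.
  under [RHS]eq_bigr do rewrite /partial pX.
  have Hs i j : partial j (partial i (u t)) x = partial i (partial j (u t)) x.
    exact: partialC (flow_C2 fl t).
  rewrite /stress -(stress_algebra eps (2 * u t x * (1 - u t x ^+ 2) / eps) (edens t x)
    (aa t) (weight t x) (fun i => dq (x 0 i - c 0 i)) (fun i => ddq (x 0 i - c 0 i))
    (fun i => partial i (u t) x) Hs).
  apply: eq_bigr => j _; rewrite /dweight; ring.
- move=> j; apply: continuousBp; first by apply: continuousMp; [exact: cedens|exact: cdweight].
  by apply: continuousMp; [exact: continuousZp|exact: cpu].
- by move=> j x; case: (dX j x).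
- move=> j; rewrite /partial (funext (pX j)).
  have H1 := continuousDp (continuousMp (@cdedens t j) (@cdweight j t))
    (continuousMp (@cedens t) (@cddweight t j j)).
  have H2 := continuous_sum (s := index_enum 'I_n) (fun i =>
     continuousDp (continuousMp (@cddweight t i j) (@cpu t i))
       (continuousMp (@cdweight i t) (@cppu t i j))).
  have H3 := continuousDp (continuousMp (continuousZp (c := eps) H2) (@cpu t j))
    (continuousMp (continuousZp (c := eps) cS) (@cppu t j j)).
  exact (continuousBp H1 H3).
- move=> j x; rewrite /X.
  rewrite edens_periodic dweight_periodic pu_periodic.
  by under eq_bigr => i _ do rewrite dweight_periodic pu_periodic.
Qed.


(* [W(a) - W(b) = (a - b) (a + b) (a^2 + b^2 - 2) / 2]. *)
Definition increment_density (t s : R) (x : 'rV[R]_n) : R :=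
  weight t x * ((u s x + u t x) * (u s x ^+ 2 + u t x ^+ 2 - 2) / 2 / eps)
  - eps / 2 * \sum_i (dweight i t x * (partial i (u s) x + partial i (u t) x)
     + weight t x * (partial i (partial i (u s)) x + partial i (partial i (u t)) x)).

(** Derivative in time of the weighted density up to a divergence: [increment_density t t] is the
    first variation [w W'(u) / eps - eps div (w grad u)]. *)
Definition denergy (t : R) (x : 'rV[R]_n) : R :=
  (dell t - daa t * wphase x) * weight t x * edens t x
  + ut t x * increment_density t t x.

Let weight_gt0 t x : 0 < weight t x. Proof. exact: expR_gt0. Qed.

Lemma edens_ge0 t x : 0 <= edens t x.
Proof.
apply: addr_ge0; first by rewrite divr_ge0 // mulr_ge0 ?(ltW eps0) // sumr_ge0 // => i _; exact: sqr_ge0.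
by rewrite !divr_ge0 ?sqr_ge0 // ltW.
Qed.

(** With [A = u_t] and [b = grad w . grad u / w], adding the stress completes [A] to [A + b]. The
    weight condition then yields [- (aa / 2) e]; the Hessian of the phase yields at most
    [(aa / 2) e], which it cancels; Young's inequality leaves [lam^2 / 2] times the energy density
    [e]. *)
Lemma denergy_stress_le t x : 0 < t -> t < t1 ->
  denergy t x + stress t x <= lam t ^+ 2 / 2 * (weight t x * edens t x).
Proof.
move=> t0 tt1.
have /andP[U1 U2] := u_lt1 x (ltW t0).
have v0 : 0 < 1 - u t x ^+ 2 by nra.
have E := flow_equation fl x t0; rewrite (gtr0_norm v0) in E.
have gb := grad_bound x t0; have a0 := aa_ge0 tt1.
have K := weight_cond x tt1; have w0 := weight_gt0 t x; have e0 := edens_ge0 t x.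
have D2 : \sum_i ddq (x 0 i - c 0 i) * partial i (u t) x ^+ 2 <=
    (\sum_i partial i (u t) x ^+ 2) / 2.
  rewrite mulr_suml; apply: ler_sum => i _.
  by rewrite mulrC ler_wpM2l ?sqr_ge0 // -[2^-1]mul1r.
have dwE : \sum_i dweight i t x * partial i (u t) x =
    weight t x * \sum_i - aa t * dq (x 0 i - c 0 i) * partial i (u t) x.
  by rewrite mulr_sumr; apply: eq_bigr => i _; rewrite /dweight; ring.
have incE : increment_density t t x = weight t x *
    (- (2 * u t x * (1 - u t x ^+ 2) / eps) - eps * lap (u t) x
      - eps * (\sum_i - aa t * dq (x 0 i - c 0 i) * partial i (u t) x)).
  rewrite /increment_density (eq_bigr (fun i => 2 * (dweight i t x * partial i (u t) x)
    + 2 * weight t x * partial i (partial i (u t)) x)); last by move=> i _; ring.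
  rewrite big_split /= -!mulr_sumr dwE -/(lap (u t) x).
  by field; rewrite gt_eqF.
rewrite /denergy incE /stress.
have eE : edens t x = eps * (\sum_i partial i (u t) x ^+ 2) / 2
  + (1 - u t x ^+ 2) ^+ 2 / 2 / eps by [].
have P0 : 0 <= \sum_i partial i (u t) x ^+ 2 by apply: sumr_ge0 => i _; exact: sqr_ge0.
move: gb K D2 E eE P0.
set b := \sum_i - aa t * dq _ * _; set P := \sum_i _ ^+ 2.
set S2 := \sum_i dq _ ^+ 2; set S1 := \sum_i ddq _; set D := \sum_i ddq _ * _.
move: w0 e0 a0 v0 U1 U2.
move: (weight t x) (edens t x) (u t x) (ut t x) (lap (u t) x) (dell t - daa t * wphase x).
move: (aa t) (lam t) P S2 S1 D b => a l P S2 S1 D b w e U A L ph.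
set v := 1 - U ^+ 2 => w0 e0 a0 v0 U1 U2 gb K D2 E eE P0.
have v2E : v ^+ 2 / 2 / eps = v ^+ 2 / (2 * eps) by field; rewrite gt_eqF.
have ev : v ^+ 2 / (2 * eps) <= e.
  by rewrite eE v2E lerDr divr_ge0 // mulr_ge0 // ltW.
(* The sign of the discrepancy: the gradient part is at most half of the energy density. *)
have eP : eps * P <= e.
  have : eps * P <= v ^+ 2 / eps by rewrite ler_pdivlMr // mulrC mulrA -expr2.
  have -> : v ^+ 2 / eps = 2 * (v ^+ 2 / 2 / eps) by field; rewrite gt_eqF.
  by rewrite eE; lra.
have f : - (2 * U * v / eps) - eps * L = l * v - eps * A.
  by rewrite E; ring.
rewrite f.
have -> : ph * w * e + A * (w * (l * v - eps * A - eps * b)) +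
   w * ((l * v - eps * A - eps * b) * b + e * (a ^+ 2 * S2 - a * S1) + eps * a * D) =
   w * (e * (ph + a ^+ 2 * S2 - a * S1) + a * (eps * D)
     + (l * v - eps * (A + b)) * (A + b)) by ring.
rewrite [X in _ <= X]mulrCA ler_pM2l //.
have s1 : e * (ph + a ^+ 2 * S2 - a * S1) <= - (a / 2 * e).
  have K' : ph + a ^+ 2 * S2 - a * S1 <= - (a / 2) by lra.
  by have := ler_wpM2l e0 K'; lra.
have s2 : a * (eps * D) <= a / 2 * e.
  rewrite -[a / 2 * e]mulrA ler_wpM2l //.
  have := ler_wpM2l (ltW eps0) D2; lra.
(* The parabola [l v y - eps y^2] in [y = A + b] is at most [(l v)^2 / (4 eps)]. *)
have s3 : (l * v - eps * (A + b)) * (A + b) <= l ^+ 2 / 2 * e.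
  apply: (@le_trans _ _ (l ^+ 2 / 2 * (v ^+ 2 / (2 * eps)))); last first.
    by rewrite ler_wpM2l // divr_ge0 // sqr_ge0.
  have -> : l ^+ 2 / 2 * (v ^+ 2 / (2 * eps)) = (l * v) ^+ 2 / (4 * eps).
    by field; rewrite gt_eqF.
  rewrite ler_pdivlMr ?mulr_gt0 //.
  by have := sqr_ge0 (l * v - 2 * eps * (A + b)); lra.
lra.
Qed.


(** Differentiating [|grad u|^2] in time would produce [grad u_t]. Instead
    [|grad u s|^2 - |grad u t|^2] is factored as difference times sum and integrated by parts while
    still a finite increment, which leaves the factor [u s - u t]. *)
Lemma wenergy_increment t s : wenergy s - wenergy t =
  cint y (fun x => (weight s x - weight t x) * edens s x
                   + (u s x - u t x) * increment_density t s x).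
Proof.
pose X (i : 'I_n) (x : 'rV[R]_n) := weight t x * (u s x - u t x)
  * (partial i (u s) x + partial i (u t) x).
have dX i x : is_derive x (delta_mx 0 i) (X i) _ :=
  is_deriveMp (is_deriveMp (is_derive_weight t x i)
     (is_deriveBp (is_derive_u s x i) (is_derive_u t x i)))
   (is_deriveDp (is_derive_pu s x i i) (is_derive_pu t x i i)).
have pX i x := @derive_val _ _ _ _ _ _ _ (dX i x).
have cdu : continuous (fun x => u s x - u t x) by exact: (continuousBp (@cu s) (@cu t)).
have cX i : continuous (X i).
  exact: (continuousMp (continuousMp (@cweight t) cdu) (continuousDp (@cpu s i) (@cpu t i))).
have cpX i : continuous (partial i (X i)).
  rewrite /partial (funext (pX i)).
  have H1 := continuousDp (continuousMp (@cdweight i t) cdu)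
    (continuousMp (@cweight t) (continuousBp (@cpu s i) (@cpu t i))).
  have H2 := continuousMp H1 (continuousDp (@cpu s i) (@cpu t i)).
  have H3 := continuousMp (continuousMp (@cweight t) cdu)
    (continuousDp (@cppu s i i) (@cppu t i i)).
  exact (continuousDp H2 H3).
have X0 : cint y (fun x => \sum_i partial i (X i) x) = 0.
  apply: cint_divergence.
  - exact: cX.
  - by move=> i x; case: (dX i x).
  - exact: cpX.
  - move=> i x; rewrite /X weight_periodic !(flow_periodic fl).
    by rewrite !(pu_periodic).
rewrite /wenergy -cintB; last 2 first.
- exact: continuousMp (@cweight s) (@cedens s).
- exact: continuousMp (@cweight t) (@cedens t).
have cSX : continuous (fun x => \sum_i partial i (X i) x) by exact: continuous_sum.
rewrite -[LHS]subr0 -(mulr0 (eps / 2)) -X0 -cintZ // -cintB; last 2 first.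
- exact: (continuousBp (continuousMp (@cweight s) (@cedens s)) (continuousMp (@cweight t) (@cedens t))).
- exact: continuousZp.
apply: eq_Rintegral => x _.
under eq_bigr do rewrite /partial pX.
rewrite /edens /increment_density.
have -> : \sum_i ((dweight i t x * (u s x - u t x)
        + weight t x * (partial i (u s) x - partial i (u t) x))
      * (partial i (u s) x + partial i (u t) x)
      + weight t x * (u s x - u t x) * (partial i (partial i (u s)) x + partial i (partial i (u t)) x)) =
    (u s x - u t x) * (\sum_i (dweight i t x * (partial i (u s) x + partial i (u t) x)
     + weight t x * (partial i (partial i (u s)) x + partial i (partial i (u t)) x)))
    + weight t x * (\sum_i partial i (u s) x ^+ 2 - \sum_i partial i (u t) x ^+ 2).
  rewrite -sumrB !mulr_sumr -big_split /=; apply: eq_bigr => i _.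
  move: (dweight i t x) (weight t x) (u s x) (u t x) (partial i (u s) x)
    (partial i (u t) x) (partial i (partial i (u s)) x) (partial i (partial i (u t)) x).
  by move=> *; ring.
by field; rewrite gt_eqF.
Qed.


Let pair_continuous (x : 'rV[R]_n) : continuous (fun s : R => (s, x)).
Proof. by move=> s; apply: continuous_pairp; [exact: cvg_id|exact: cvg_cst]. Qed.

Let joint_snd (f : 'rV[R]_n -> R) : continuous f ->
  continuous (fun p : R * 'rV[R]_n => f p.2).
Proof. by move=> cf p; apply: (@continuous_comp _ _ _ snd f); [exact: cvg_snd|exact: cf]. Qed.

Let joint_fst (f : R -> R) (p : R * 'rV[R]_n) : {for p.1, continuous f} ->
  {for p, continuous (fun p : R * 'rV[R]_n => f p.1)}.
Proof. by move=> cf; apply: (@continuous_comp _ _ _ fst f); [exact: cvg_fst|exact: cf]. Qed.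

Let joint_u : continuous (fun p : R * 'rV[R]_n => u p.1 p.2) := flow_continuous fl.
Let joint_pu i : continuous (fun p : R * 'rV[R]_n => partial i (u p.1) p.2) :=
  flow_grad_continuous fl i.
Let joint_ppu i j : continuous (fun p : R * 'rV[R]_n => partial i (partial j (u p.1)) p.2) :=
  flow_hess_continuous fl i j.

Let joint_edens : continuous (fun p : R * 'rV[R]_n => edens p.1 p.2).
Proof.
apply: continuousDp.
  apply: continuousMp; last exact: cst_continuous.
  by apply: continuousZp; apply: continuous_sum => i; apply: continuous_sqrp; exact: joint_pu.
apply: continuousMp; last exact: cst_continuous.
apply: continuousMp; last exact: cst_continuous.
by apply: continuous_sqrp; apply: continuousBp; [exact: cst_continuous|apply: continuous_sqrp; exact: joint_u].
Qed.

Let joint_increment t :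
  continuous (fun p : R * 'rV[R]_n => increment_density t p.1 p.2).
Proof.
have cut := joint_snd (@cu t).
apply: continuousBp.
  apply: continuousMp; first exact: joint_snd (@cweight t).
  apply: continuousMp; last exact: cst_continuous.
  apply: continuousMp; last exact: cst_continuous.
  apply: continuousMp; first exact: continuousDp joint_u cut.
  apply: continuousBp; last exact: cst_continuous.
  exact: continuousDp (continuous_sqrp joint_u) (continuous_sqrp cut).
apply: continuousZp; apply: continuous_sum => i; apply: continuousDp.
  exact: continuousMp (joint_snd (@cdweight i t)) (continuousDp (@joint_pu i) (joint_snd (@cpu t i))).
exact: continuousMp (joint_snd (@cweight t)) (continuousDp (@joint_ppu i i) (joint_snd (@cppu t i i))).
Qed.

Let cincrement t s : continuous (increment_density t s).
Proof.
move=> x; have cs : {for x, continuous (fun x : 'rV[R]_n => (s, x))}.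
  by apply: continuous_pairp; [exact: cst_continuous|exact: cvg_id].
exact (continuous_comp cs (@joint_increment t (s, x))).
Qed.

Let caa t : t < t1 -> {for t, continuous aa}.
Proof.
by move=> tt1; apply: differentiable_continuous; apply/derivable1_diffP; case: (aaP tt1).
Qed.

Let cell t : t < t1 -> {for t, continuous ell}.
Proof.
by move=> tt1; apply: differentiable_continuous; apply/derivable1_diffP; case: (ellP tt1).
Qed.

Let joint_weight (p : R * 'rV[R]_n) : p.1 < t1 ->
  {for p, continuous (fun p : R * 'rV[R]_n => weight p.1 p.2)}.
Proof.
move=> pt; apply: (@continuous_comp _ _ _ (fun p : R * 'rV[R]_n => ell p.1 - aa p.1 * wphase p.2) (@expR R)).
  apply: cvgB; first exact: (joint_fst (cell pt)).
  apply: cvgM; first exact: (joint_fst (caa pt)).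
  exact: (joint_snd cwphase).
exact: continuous_expR.
Qed.

Definition weight_dt (t : R) (x : 'rV[R]_n) : R :=
  (dell t - daa t * wphase x) * weight t x.

Let is_derive_weight_dt (t : R) x : t < t1 ->
  is_derive t 1 (weight ^~ x) (weight_dt t x).
Proof.
move=> tt1; have H := is_deriveBp (ellP tt1) (is_deriveMcp (wphase x) (aaP tt1)).
apply: (is_derive_eq (is_derive1_comp (f := @expR R) (is_derive_expR _) H)).
by rewrite mulrC.
Qed.

Let joint_weight_dt (p : R * 'rV[R]_n) : p.1 < t1 ->
  {for p, continuous (fun p : R * 'rV[R]_n => weight_dt p.1 p.2)}.
Proof.
move=> pt; apply: cvgM; last exact: joint_weight.
apply: cvgB; first exact: (joint_fst (cdell pt)).
apply: cvgM; first exact: (joint_fst (cdaa pt)).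
exact: (joint_snd cwphase).
Qed.

Let cut t : 0 < t -> continuous (ut t).
Proof.
move=> t0 x; have cs : {for x, continuous (fun x : 'rV[R]_n => (t, x))}.
  by apply: continuous_pairp; [exact: cst_continuous|exact: cvg_id].
exact (continuous_comp cs (flow_dt_continuous fl (t, x) t0)).
Qed.

Let cdenergy t : 0 < t -> continuous (denergy t).
Proof.
move=> t0; apply: continuousDp.
  apply: continuousMp (@cedens t); apply: continuousMp (@cweight t).
  by apply: continuousBp; [exact: cst_continuous|apply: continuousZp; exact: cwphase].
exact: continuousMp (cut t0) (@cincrement t t).
Qed.

(** The quotients of [wenergy_increment] pass to the limit under the integral; the mean value
    theorem in time and bounds on compact sets supply the dominating constant. *)
Lemma is_derive_wenergy (t : R) : 0 < t -> t < t1 ->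
  is_derive t 1 wenergy (cint y (denergy t)).
Proof.
move=> t0 tt1.
pose G h (x : 'rV[R]_n) := h^-1 * (weight (t + h) x - weight t x) * edens (t + h) x
  + h^-1 * (u (t + h) x - u t x) * increment_density t (t + h) x.
have cinc s : continuous (fun x => (weight s x - weight t x) * edens s x
    + (u s x - u t x) * increment_density t s x).
  exact (continuousDp (continuousMp (continuousBp (@cweight s) (@cweight t)) (@cedens s))
    (continuousMp (continuousBp (@cu s) (@cu t)) (@cincrement t s))).
suff L : cint y (G h) @[h --> (0 : R)^'] --> cint y (denergy t).
  have E : \forall h \near (0 : R)^', cint y (G h) = h^-1 *: (wenergy (h *: (1 : R) + t) - wenergy t).
    near=> h; rewrite scaler1 [h + t]addrC wenergy_increment -[RHS]/(_ * _) -cintZ; last first.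
      exact: cinc.
    apply: eq_Rintegral => x _; rewrite /G.
    move: (weight (t + h) x) (weight t x) (edens (t + h) x) (u (t + h) x) (u t x) (increment_density t (t + h) x) => w w' e v v' i.
    by ring.
  have L' : h^-1 *: (wenergy (h *: (1 : R) + t) - wenergy t) @[h --> (0 : R)^'] --> cint y (denergy t).
    by apply: cvg_trans L; exact: near_eq_cvg.
  by split; [apply/cvg_ex; exists (cint y (denergy t))|exact: cvg_lim].
(* Halving keeps the closed window of radius [d] inside the open interval from 0 to [t1], where the
   time derivatives are continuous. *)
pose d := Num.min t (t1 - t) / 2.
have d0 : 0 < d by rewrite divr_gt0 // lt_min t0 subr_gt0.
have dt : d < t by rewrite /d ltr_pdivrMr // gt_min ltr_pMr // ltr1n.
have dt1 : d < t1 - t by rewrite /d ltr_pdivrMr // gt_min orbC ltr_pMr ?ltr1n // subr_gt0.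
have near_t s : `|s - t| <= d -> 0 < s /\ s < t1.
  by rewrite ler_distl => /andP[h1 h2]; split; lra.
have [M1 M10 M1P] := joint_continuous_bound y (F := fun p => weight_dt p.1 p.2)
  (fun p pt => joint_weight_dt (near_t _ pt).2).
have [M2 M20 M2P] := joint_continuous_bound y (F := fun p => ut p.1 p.2)
  (fun p pt => flow_dt_continuous fl p (near_t _ pt).1).
have [N1 N10 N1P] := joint_continuous_bound y (F := fun p => edens p.1 p.2) (t := t) (d := d)
  (fun p _ => @joint_edens p).
have [N2 N20 N2P] := joint_continuous_bound y (F := fun p => increment_density t p.1 p.2) (t := t) (d := d)
  (fun p _ => @joint_increment t p).
have quot (f df : R -> R) h M : h != 0 -> `|h| < d ->
    (forall s, 0 < s < t1 -> is_derive s 1 f (df s)) ->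
    (forall s, `|s - t| <= d -> `|df s| <= M) -> `|h^-1 * (f (t + h) - f t)| <= M.
  move=> h0 hd dfP dfM; rewrite normrM normfV ler_pdivrMl ?normr_gt0 // mulrC.
  apply: (@mean_value_bound _ f df) => s sh.
    by apply: dfP; have [s1 s2] := near_t s (le_trans sh (ltW hd)); rewrite s1.
  by apply: dfM; apply: le_trans (ltW hd).
apply: (@cint_cvg_dnbhs _ _ y G (denergy t) 0 d (M1 * N1 + M2 * N2) d0).
- exact: cdenergy.
- move=> h _ _; rewrite /G.
  have H1 := continuousMp (continuousZp (c := h^-1) (continuousBp (@cweight (t + h)) (@cweight t))) (@cedens (t + h)).
  have H2 := continuousMp (continuousZp (c := h^-1) (continuousBp (@cu (t + h)) (@cu t))) (@cincrement t (t + h)).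
  exact (continuousDp H1 H2).
- move=> h x h0; rewrite subr0 => hd /cube_ccube Cx.
  have thd : `|t + h - t| <= d by rewrite addrAC subrr add0r ltW.
  apply: (le_trans (ler_normD _ _)); rewrite !normrM.
  apply: lerD; apply: ler_pM => //.
  + rewrite -normrM; apply: (quot (weight ^~ x) (weight_dt ^~ x)) => //.
      by move=> s /andP[_ st]; exact: is_derive_weight_dt.
    by move=> s st; exact: M1P.
  + exact: N1P.
  + rewrite -normrM; apply: (quot (u ^~ x) (ut ^~ x)) => //.
      by move=> s /andP[s0 _]; exact: flow_dt fl _ _ s0.
    by move=> s st; exact: M2P.
  + exact: N2P.
- move=> x _.
  have dlim (f : R -> R) df : is_derive t 1 f df -> h^-1 * (f (t + h) - f t) @[h --> (0 : R)^'] --> df.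
    move=> [fd fE].
    rewrite (_ : (fun h => _) = (fun h : R => h^-1 *: (f (h *: (1 : R) + t) - f t))).
      by rewrite -fE.
    by apply/funext => h; rewrite scaler1 (addrC h).
  have clim (f : R * 'rV[R]_n -> R) : continuous f -> f (t + h, x) @[h --> (0 : R)^'] --> f (t, x).
    move=> cf; have c1 : {for 0, continuous (fun h : R => (t + h, x))}.
      apply: continuous_pairp; last exact: cvg_cst.
      by apply: cvgD; [exact: cvg_cst|exact: cvg_id].
    have H : f (t + h, x) @[h --> (0 : R)] --> f (t + 0, x).
      exact (continuous_comp c1 (cf (t + 0, x))).
    have -> : f (t, x) = f (t + 0, x) by rewrite addr0.
    by apply: cvg_trans H; apply: cvg_app; exact: cvg_within.
  apply: cvgD; apply: cvgM.
  + exact: dlim (is_derive_weight_dt x tt1).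
  + exact: (clim _ (@joint_edens)).
  + exact: dlim (flow_dt fl x t0).
  + exact: (clim _ (@joint_increment t)).
Unshelve. all: by end_near. Qed.

Let cstress t : continuous (stress t).
Proof.
have cb : continuous (fun x : 'rV[R]_n => \sum_i - aa t * dq (x 0 i - c 0 i) * partial i (u t) x).
  apply: continuous_sum => i; apply: continuousMp (@cpu t i).
  by apply: continuousZp; exact: ccoord.
apply: continuousMp; first exact: cweight.
apply: continuousDp; last first.
  apply: continuousZp; apply: continuous_sum => i; apply: continuousMp; first exact: ccoord.
  exact: continuous_sqrp (@cpu t i).
apply: continuousDp.
  apply: (continuousMp _ cb); apply: continuousBp; last exact: continuousZp cb.
  apply: continuousBp.
    apply: continuousNp; apply: continuousMp; last exact: cst_continuous.
    apply: continuousMp; first exact: continuousZp (@cu t).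
    by apply: continuousBp; [exact: cst_continuous|exact: continuous_sqrp (@cu t)].
  by apply: continuousZp; apply: continuous_sum => i; exact: (@cppu t i i).
apply: (continuousMp (@cedens t)); apply: continuousBp; apply: continuousZp;
  apply: continuous_sum => i; last exact: ccoord.
by apply: continuous_sqrp; exact: ccoord.
Qed.

Let cenergy t : continuous (fun x => weight t x * edens t x).
Proof. exact: continuousMp (@cweight t) (@cedens t). Qed.

Lemma wenergy_ge0 t : 0 <= wenergy t.
Proof.
by apply: cint_ge0 => x; apply: mulr_ge0; [rewrite ltW|exact: edens_ge0].
Qed.

Lemma denergy_le t : 0 < t -> t < t1 ->
  cint y (denergy t) <= lam t ^+ 2 / 2 * wenergy t.
Proof.
move=> t0 tt1; rewrite -[leLHS]addr0 -(cint_stress t).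
rewrite -(cintD y (cdenergy t0) (@cstress t)) -(cintZ _ _ (@cenergy t)).
apply: cint_le; last by move=> x; exact: denergy_stress_le.
  exact: continuousDp (cdenergy t0) (@cstress t).
exact: continuousZp (@cenergy t).
Qed.

Lemma wenergy_at_right t0 : t0 < t1 -> wenergy t @[t --> t0^'+] --> wenergy t0.
Proof.
move=> tt1; pose d := (t1 - t0) / 2.
have d0 : 0 < d by rewrite divr_gt0 // subr_gt0.
have near_t s : `|s - t0| <= d -> s < t1.
  by rewrite ler_distl => /andP[_ st]; rewrite /d in st; lra.
have joint p : p.1 < t1 ->
    {for p, continuous (fun p : R * 'rV[R]_n => weight p.1 p.2 * edens p.1 p.2)}.
  by move=> pt; apply: cvgM; [exact: joint_weight|exact: joint_edens].
have [M M0 MP] := joint_continuous_bound y (fun p pt => joint p (near_t _ pt)).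
apply: (@cint_cvg_at_right _ _ y _ _ t0 d M d0).
- exact: cenergy.
- by move=> t _ _; exact: cenergy.
- by move=> t x _ td /cube_ccube Cx; apply: (MP t x) => //; exact: ltW.
- move=> x _; have H : weight t x * edens t x @[t --> t0] --> weight t0 x * edens t0 x.
    exact (continuous_comp (@pair_continuous x t0) (joint (t0, x) tt1)).
  by apply: cvg_trans H; apply: cvg_app; exact: cvg_within.
Qed.

(** Gronwall with the integrating factor [expR (- F / 2)], [F] a primitive of [lam ^ 2]. Both end
    times are reached by limits: [F] is known on an open interval only, and at [t0], which may be 0,
    there is no derivative in time. *)
Lemma wenergy_le (t0 b C : R) : 0 <= t0 -> t0 < b -> b < t1 ->
  (\int[lebesgue_measure]_(t in `[0%R, b]) (lam t ^+ 2)%:E <= C%:E)%E ->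
  wenergy b <= wenergy t0 * expR (C / 2).
Proof.
move=> t0_ge0 t0b bt1 lamC.
have clam t : 0 < t <= b -> {for t, continuous (fun t => lam t ^+ 2)}.
  move=> /andP[t_gt0 _]; have := flow_lam_continuous fl t_gt0 (u_lt1 0 (ltW t_gt0)).
  by move=> cl; apply: cvgM.
have step a s : t0 < a -> a <= s -> s < b -> wenergy s <= wenergy a * expR (C / 2).
  move=> t0a as_ sb; have a0 := le_lt_trans t0_ge0 t0a.
  have [|||F FP FC] := @primitive_bound _ _ (a / 2) b C _ _ clam _ lamC.
  - by rewrite divr_gt0.
  - by rewrite (lt_trans _ (le_lt_trans as_ sb)) // ltr_pdivrMr // ltr_pMr // ltr1n.
  - by move=> t; exact: sqr_ge0.
  have a2 : a / 2 < a by rewrite ltr_pdivrMr // ltr_pMr // ltr1n.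
  pose f t := wenergy t * expR (- F t / 2).
  have fP t : a <= t -> t <= s -> is_derive t 1 f
      (expR (- F t / 2) * (cint y (denergy t) - lam t ^+ 2 / 2 * wenergy t)).
    move=> at_ ts.
    have t_gt0 := lt_le_trans a0 at_; have tb := le_lt_trans ts sb.
    have dF : is_derive t 1 F (lam t ^+ 2) by apply: FP; rewrite (lt_le_trans a2).
    have H := is_deriveMp (is_derive_wenergy t_gt0 (lt_trans tb bt1))
      (is_derive1_comp (f := @expR R) (is_derive_expR _) (is_deriveMcp (2^-1) (is_deriveNp dF))).
    apply: (is_derive_eq H).
    rewrite /f /=; move: (expR _) (cint _ _) (wenergy t) (lam t) => e g w l; ring.
  have fnincr : f s <= f a.
    apply: (@ler0_derive1_nincr _ f a s) => //.
    + by move=> t; rewrite in_itv /= => /andP[at_ ts]; case: (fP t (ltW at_) (ltW ts)).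
    + move=> t; rewrite in_itv /= => /andP[at_ ts]; have fD := fP t (ltW at_) (ltW ts).
      rewrite derive1E derive_val mulr_ge0_le0 ?expR_ge0 // subr_le0.
      by apply: denergy_le; [exact: lt_trans at_|exact: lt_trans (lt_trans sb bt1)].
    + apply: continuous_in_subspaceT => t; rewrite inE /= in_itv /= => /andP[at_ ts].
      by apply: differentiable_continuous; apply/derivable1_diffP; case: (fP t at_ ts).
  have -> : wenergy s = f s * expR (F s / 2).
    by rewrite /f -mulrA -expRD mulNr addNr expR0 mulr1.
  apply: (@le_trans _ _ (f a * expR (F s / 2))); first by rewrite ler_wpM2r ?expR_ge0.
  rewrite /f -mulrA -expRD ler_wpM2l ?wenergy_ge0 // ler_expR.
  by have := FC _ _ a2 as_ sb; lra.
have step_b a : t0 < a -> a < b -> wenergy b <= wenergy a * expR (C / 2).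
  move=> t0a ab; have b0 := lt_trans (le_lt_trans t0_ge0 t0a) ab.
  have cb : {for b, continuous wenergy}.
    apply: differentiable_continuous; apply/derivable1_diffP.
    by case: (is_derive_wenergy b0 bt1).
  have H : wenergy s @[s --> b^'-] --> wenergy b.
    by apply: cvg_trans cb; apply: cvg_app; exact: cvg_within.
  apply: (cvgr_to_le H); near=> s.
  apply: (step a s t0a); first by near: s; exact: nbhs_left_ge.
  by near: s; exact: nbhs_left_lt.
have H : wenergy a * expR (C / 2) @[a --> t0^'+] --> wenergy t0 * expR (C / 2).
  by apply: cvgMl; apply: wenergy_at_right; exact: lt_trans bt1.
apply: (cvgr_to_ge H); near=> a.
apply: step_b; first by near: a; exact: nbhs_right_gt.
by near: a; exact: nbhs_right_lt.
Unshelve. all: by end_near. Qed.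

Lemma continuous_edens t : continuous (edens t).
Proof. exact: cedens. Qed.

Lemma continuous_weight t : continuous (weight t).
Proof. exact: cweight. Qed.

End weighted_energy.

(** * The periodic phase *)

Section trigonometric_phase.
Context {R : realType}.

Definition phase (s : R) : R := sin (pi * s) ^+ 2 / (4 * pi ^+ 2).
Definition dphase (s : R) : R := sin (pi * s) * cos (pi * s) / (2 * pi).
Definition ddphase (s : R) : R := 1 / 2 - sin (pi * s) ^+ 2.

Let pi0 : (pi : R) != 0. Proof. by rewrite gt_eqF // pi_gt0. Qed.

Let is_derive_sinpi (s : R) : is_derive s 1 (fun s : R => sin (pi * s)) (cos (pi * s) * pi).
Proof.
have H := is_derive1_comp (f := @sin R) (is_derive_sin (pi * s))
  (is_deriveZp pi (is_derive_id (s : R) (1 : R))).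
by apply: (is_derive_eq H); rewrite mulr1.
Qed.

Let is_derive_cospi (s : R) : is_derive s 1 (fun s : R => cos (pi * s)) (- sin (pi * s) * pi).
Proof.
have H := is_derive1_comp (f := @cos R) (is_derive_cos (pi * s))
  (is_deriveZp pi (is_derive_id (s : R) (1 : R))).
by apply: (is_derive_eq H); rewrite mulr1.
Qed.

Lemma is_derive_phase (s : R) : is_derive s 1 phase (dphase s).
Proof.
apply: (is_derive_eq (is_deriveMcp (4 * pi ^+ 2)^-1 (is_derive_sqrp (is_derive_sinpi s)))).
rewrite /dphase; move: (sin _) (cos _) => a b; move: (@pi R) pi0 => p p0; by field.
Qed.

Lemma is_derive_dphase (s : R) : is_derive s 1 dphase (ddphase s).
Proof.
apply: (is_derive_eq (is_deriveMcp (2 * pi)^-1 (is_deriveMp (is_derive_sinpi s) (is_derive_cospi s)))).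
rewrite /ddphase; have := cos2sin2 (pi * s); move: (sin _) (cos _) => a b ab.
rewrite (_ : _ + _ = pi * (b ^+ 2 - a ^+ 2)); last by ring.
by rewrite ab; move: (@pi R) pi0 => p p0; by field.
Qed.

Lemma continuous_ddphase : continuous ddphase.
Proof.
apply: continuousBp; first exact: cst_continuous.
apply: continuous_sqrp => s; apply: (@continuous_comp _ _ _ (fun s : R => pi * s) (@sin R)).
  exact: mulrl_continuous.
exact: continuous_sin.
Qed.

Let sinpi1 (s : R) : sin (pi * (s + 1)) = - sin (pi * s).
Proof. by rewrite mulrDr mulr1 sinD sinpi cospi mulrN1 mulr0 addr0. Qed.

Let cospi1 (s : R) : cos (pi * (s + 1)) = - cos (pi * s).
Proof. by rewrite mulrDr mulr1 cosD sinpi cospi mulrN1 mulr0 subr0. Qed.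

Lemma phase_periodic (s : R) : phase (s + 1) = phase s.
Proof. by rewrite /phase sinpi1 sqrrN. Qed.

Lemma dphase_periodic (s : R) : dphase (s + 1) = dphase s.
Proof. by rewrite /dphase sinpi1 cospi1 mulrNN. Qed.

Lemma ddphase_le (s : R) : ddphase s <= 1 / 2.
Proof. by rewrite /ddphase lerBlDr lerDl sqr_ge0. Qed.

Lemma phase_ge0 (s : R) : 0 <= phase s.
Proof. by rewrite divr_ge0 ?sqr_ge0 // mulr_ge0 // sqr_ge0. Qed.

(* The difference of the two sides is the square of [a sin^2 (pi s) / (2 pi) - pi]. *)
Lemma phase_square (a s : R) :
  a / 2 - a ^+ 2 * phase s + a ^+ 2 * dphase s ^+ 2 - a * ddphase s <= pi ^+ 2.
Proof.
have -> : dphase s ^+ 2 = sin (pi * s) ^+ 2 * (1 - sin (pi * s) ^+ 2) / (4 * pi ^+ 2).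
  rewrite /dphase -cos2sin2; move: (sin _) (cos _) => x z; move: (@pi R) pi0 => p p0; by field.
rewrite /phase /ddphase; move: (sin _ ^+ 2) => x; move: (@pi R) pi0 => p p0.
rewrite -subr_ge0 (_ : _ - _ = (a * x / (2 * p) - p) ^+ 2) ?sqr_ge0 //.
by field.
Qed.

Let sin_MVT (v : R) : 0 < v -> exists2 c, 0 < c < v & sin v = cos c * v.
Proof.
move=> v0; have [|c] := @MVT R (@sin R) (@cos R) 0 v v0 (fun x _ => is_derive_sin x).
  by apply: continuous_subspaceT; exact: continuous_sin.
by rewrite in_itv /= sin0 !subr0 => cv E; exists c.
Qed.

Lemma phase_le (s : R) : phase s <= s ^+ 2 / 4.
Proof.
have sinle (v : R) : 0 < v -> sin v ^+ 2 <= v ^+ 2.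
  move=> v0; have [c _ ->] := sin_MVT v0.
  by rewrite exprMn ler_piMl ?sqr_ge0 // cos2sin2 gerBl sqr_ge0.
have H : sin (pi * s) ^+ 2 <= (pi * s) ^+ 2.
  have [s0|s0|->] := ltgtP s 0; last by rewrite mulr0 sin0.
  - by rewrite -sqrrN -sinN -[leRHS]sqrrN; apply: sinle; rewrite oppr_gt0 pmulr_rlt0 ?pi_gt0.
  - by apply: sinle; rewrite mulr_gt0 ?pi_gt0.
rewrite /phase ler_pdivrMr ?mulr_gt0 ?exprn_gt0 ?pi_gt0 //.
by rewrite (_ : s ^+ 2 / 4 * _ = (pi * s) ^+ 2) //; move: (@pi R) pi0 => p p0; by field.
Qed.

(** With the double angle formulas and the mean value theorem at [v / 2]: [sin v = v cos c cos (v /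
    2) >= v cos (v / 2) ^ 2 = v (1 + cos v) / 2]. *)
Let sin_ge_half (v : R) : 0 < v -> v <= pi / 2 -> v / 2 <= sin v.
Proof.
move=> v0 vpi; have p0 := pi_gt0 R.
have [|c /andP[c0 cv] E] := @sin_MVT (v / 2); first by rewrite divr_gt0.
have cc : cos (v / 2) <= cos c.
  by rewrite ltW // ltr_cos ?in_itv //=; lra.
have cv2 : 0 <= cos v by apply: cos_ge0_pihalf; lra.
have h0 : 0 <= cos (v / 2) by apply: cos_ge0_pihalf; lra.
have v2 : (v / 2) *+ 2 = v by rewrite mulr2n; lra.
have S := sin_mulr2n (v / 2); have C := cos_mulr2n (v / 2).
rewrite v2 mulr2n E in S; rewrite v2 mulr2n in C.
have : cos (v / 2) ^+ 2 <= cos (v / 2) * cos c by rewrite expr2 ler_wpM2l.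
move: (sin v) (cos v) (cos (v / 2)) (cos c) S C cv2 => x z k l -> -> z0 kl.
by nra.
Qed.

(** Beyond half a period the phase decreases again. The 16, against 4 in [phase_le], comes from
    [sin_ge_half]. *)
Lemma phase_ge (s : R) : `|s| <= 1 / 2 -> s ^+ 2 / 16 <= phase s.
Proof.
have p0 := pi_gt0 R.
have H (v : R) : 0 < v -> v <= 1 / 2 -> v ^+ 2 / 16 <= phase v.
  move=> v0 v2; rewrite /phase ler_pdivlMr ?mulr_gt0 ?exprn_gt0 //.
  rewrite (_ : v ^+ 2 / 16 * _ = (pi * v / 2) ^+ 2); last by move: (@pi R) pi0 => p p1; by field.
  have h0 : 0 <= pi * v / 2 by rewrite divr_ge0 ?mulr_ge0 ?ltW.
  have h : pi * v / 2 <= sin (pi * v).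
    by apply: sin_ge_half; [rewrite mulr_gt0|rewrite ler_pM2l //; lra].
  by rewrite ler_pXn2r ?nnegrE // (le_trans h0).
have [s0|s0|->] := ltgtP s 0.
- rewrite ltr0_norm // => s2; have := H (- s); rewrite oppr_gt0 sqrrN => /(_ s0 s2).
  by rewrite /phase mulrN sinN sqrrN.
- by rewrite gtr0_norm //; exact: H.
- by rewrite expr0n /= mul0r => _; exact: phase_ge0.
Qed.

End trigonometric_phase.

(** * The periodic backward heat kernel *)

Section gaussian_weight.
Context {R : realType} {n : nat}.
Variables (eps : R) (u ut : R -> 'rV[R]_n -> R) (lam : R -> R).
Hypotheses (eps0 : 0 < eps) (fl : flow eps u ut lam).
Hypothesis u_lt1 : forall t x, 0 <= t -> -1 < u t x < 1.
Hypothesis grad_bound : forall t x, 0 < t ->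
  eps ^+ 2 * \sum_i partial i (u t) x ^+ 2 <= (1 - u t x ^+ 2) ^+ 2.

(** Logarithm of the prefactor. The power [(n - 1) / 2] is that of a kernel on hypersurfaces; the
    linear term, zero at [t0], pays the defect [pi ^ 2] of [phase_square] once per coordinate. *)
Definition heat_exponent (s t0 t : R) : R :=
  - ((n%:R - 1) / 2) * ln (s - t) - pi ^+ 2 * n%:R * (t - t0).

Definition inverse_time (s t : R) : R := (s - t)^-1.

Let is_derive_time (s t : R) : is_derive t 1 (fun t : R => s - t) (- 1).
Proof.
have H := is_deriveBp (is_derive_cst (s : R) t (1 : R)) (is_derive_id (t : R) (1 : R)).
by apply: (is_derive_eq H); rewrite sub0r.
Qed.

Let is_derive_heat_exponent (s t0 t : R) : t < s -> is_derive t 1 (heat_exponent s t0)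
  ((n%:R - 1) / 2 * inverse_time s t - pi ^+ 2 * n%:R).
Proof.
move=> ts; have st : 0 < s - t by rewrite subr_gt0.
have H1 := is_derive1_comp (f := @ln R) (g := fun t : R => s - t) (is_derive1_ln st) (is_derive_time s t).
have H2 := is_deriveBp (is_derive_id (t : R) (1 : R)) (is_derive_cst (t0 : R) t (1 : R)).
apply: (is_derive_eq (is_deriveBp (is_deriveZp (- ((n%:R - 1) / 2)) H1)
  (is_deriveZp (pi ^+ 2 * n%:R) H2))).
by rewrite subr0 mulr1 mulrN1 mulrNN.
Qed.

Let is_derive_inverse_time (s t : R) : t < s ->
  is_derive t 1 (inverse_time s) (inverse_time s t ^+ 2).
Proof.
move=> ts; have st : s - t != 0 by rewrite gt_eqF // subr_gt0.
have H := is_deriveV (f := fun t : R => s - t) st (is_derive_time s t).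
apply: (is_derive_eq H).
by rewrite -[LHS]/(_ * _) mulrN1 opprK exprVn.
Qed.

Let continuous_inverse_time (s t : R) : t < s -> {for t, continuous (inverse_time s)}.
Proof.
move=> ts; apply: differentiable_continuous; apply/derivable1_diffP.
by case: (is_derive_inverse_time ts).
Qed.

Lemma wenergy_heat_le (x y : 'rV[R]_n) (s t0 b C : R) : 0 <= t0 -> t0 < b -> b < s ->
  (\int[lebesgue_measure]_(t in `[0%R, b]) (lam t ^+ 2)%:E <= C%:E)%E ->
  wenergy eps u phase x y (heat_exponent s t0) (inverse_time s) b <=
  wenergy eps u phase x y (heat_exponent s t0) (inverse_time s) t0 * expR (C / 2).
Proof.
move=> t00 t0b bs lamC.
apply: (wenergy_le eps0 fl u_lt1 grad_bound is_derive_phase is_derive_dphase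
  continuous_ddphase phase_periodic dphase_periodic ddphase_le y
  (@is_derive_heat_exponent s t0) _ (@is_derive_inverse_time s) _ _ _ t00 t0b bs lamC).
- move=> t ts; apply: cvgB; last exact: cvg_cst.
  by apply: cvgM; [exact: cvg_cst|exact: continuous_inverse_time].
- by move=> t ts; apply: cvgM; exact: continuous_inverse_time.
- by move=> t ts; rewrite invr_ge0 subr_ge0 ltW.
(* The sum of [phase_square] provides [n a / 2]: the exponent takes [(n - 1) a / 2] of it, the
   weight condition the remaining [a / 2]. *)
- move=> t z ts; set a := inverse_time s t.
  have : \sum_(i < n) (a / 2 - a ^+ 2 * phase (z 0 i - x 0 i)
      + a ^+ 2 * dphase (z 0 i - x 0 i) ^+ 2 - a * ddphase (z 0 i - x 0 i))
      <= \sum_(i < n) pi ^+ 2 by apply: ler_sum => i _; exact: phase_square.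
  rewrite sumrB big_split sumrB /= !sumr_const !card_ord -!mulr_sumr -/(wphase phase x z) => H.
  have {H} : a / 2 * n%:R - a ^+ 2 * wphase phase x z
      + a ^+ 2 * \sum_i dphase (z 0 i - x 0 i) ^+ 2 - a * \sum_i ddphase (z 0 i - x 0 i)
      <= pi ^+ 2 * n%:R by rewrite (mulr_natr (a / 2)) (mulr_natr (pi ^+ 2)).
  move: (wphase _ _ _) (\sum_i dphase _ ^+ 2) (\sum_i ddphase _) => w v v'.
  by move: (n%:R) (pi ^+ 2) => k p; lra.
Qed.

Lemma wenergy_cst_le (y : 'rV[R]_n) (b C : R) : 0 < b ->
  (\int[lebesgue_measure]_(t in `[0%R, b]) (lam t ^+ 2)%:E <= C%:E)%E ->
  cint y (edens eps u b) <= cint y (edens eps u 0) * expR (C / 2).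
Proof.
move=> b0 lamC.
(* Zero exponents make the weight equal to 1. *)
have E t : cint y (edens eps u t) = wenergy eps u phase 0 y (fun=> 0) (fun=> 0) t.
  apply: eq_Rintegral => z _.
  by rewrite /weight mul0r subr0 expR0 mul1r.
rewrite !E; apply: (wenergy_le eps0 fl u_lt1 grad_bound is_derive_phase is_derive_dphase
  continuous_ddphase phase_periodic dphase_periodic ddphase_le y (t1 := b + 1)
  (dell := fun=> 0) (daa := fun=> 0) _ _ _ _ _ _ (lexx 0) b0 _ lamC).
- by move=> t _; exact: cvg_cst.
- by move=> t _; exact: cvg_cst.
- by [].
- by move=> t z _; rewrite expr0n /= !mul0r !subr0 !addr0.
- by rewrite ltrDl.
Qed.

End gaussian_weight.

(** * Ball growth *)

(** From [s / m <= expR (s / m)], raised to the power [m]. *)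
Lemma pow_expRN_le {R : realType} (m : nat) (s : R) : (0 < m)%N -> 0 <= s ->
  s ^+ m * expR (- s) <= m%:R ^+ m.
Proof.
move=> m0 s0; have mR : 0 < m%:R :> R by rewrite ltr0n.
rewrite expRN ler_pdivrMr ?expR_gt0 // -{2}(@divfK _ m%:R _ s) ?gt_eqF //.
rewrite expRM_natr -exprMn.
have h : s <= m%:R * expR (s / m%:R).
  by rewrite mulrC -ler_pdivrMr //; apply: le_trans (expR_ge1Dx _); rewrite lerDr.
by rewrite ler_pXn2r ?nnegrE ?mulr_ge0 ?expR_ge0.
Qed.

Lemma sum_half_pow_le {R : realType} (m : nat) : \sum_(k < m) (2^-1 : R) ^+ k <= 2.
Proof.
suff -> : \sum_(k < m) (2^-1 : R) ^+ k = 2 - 2 * 2^-1 ^+ m.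
  by rewrite gerBl mulr_ge0 // exprn_ge0.
elim: m => [|m IH]; first by rewrite big_ord0 expr0; lra.
by rewrite big_ord_recr /= IH exprS; lra.
Qed.

Section ball_growth.
Context {R : realType} {n : nat}.
Implicit Types (x y z c : 'rV[R]_n).

Lemma open_eball x (r : R) : open (eball x r).
Proof.
rewrite (_ : eball x r = (fun y => enorm (y - x)) @^-1` [set s | s < r]) //.
apply: open_comp; last exact: open_lt.
move=> z _; apply: (@continuous_comp _ _ _ (fun y : 'rV[R]_n => y - x) (@enorm R n)).
  apply: rV_continuous => i; under eq_fun do rewrite !mxE.
  by apply: continuousBp; [move=> y; exact: coord_continuous|exact: cst_continuous].
exact: continuous_enorm.
Qed.

Lemma measurable_eball x (r : R) : measurable (eball x r).
Proof. by apply: open_measurable_rV; exact: open_eball. Qed.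

Lemma wphase_le x z : wphase phase x z <= enorm (z - x) ^+ 2 / 4.
Proof.
rewrite enormE mulr_suml; apply: ler_sum => i _.
by rewrite !mxE; exact: phase_le.
Qed.

(** Lower corner of the unit cube with midpoint [x]; on that cube each coordinate is within half a
    period of [x], where [phase_ge] applies. *)
Let center x := x - const_mx (1 / 2).

Lemma cube_center_coord x z i : cube (center x) z -> `|z 0 i - x 0 i| <= 1 / 2.
Proof.
move=> /(_ i); rewrite !mxE => /andP[h1 h2]; rewrite ler_norml.
by apply/andP; split; lra.
Qed.

Lemma wphase_ge x z : cube (center x) z -> enorm (z - x) ^+ 2 / 16 <= wphase phase x z.
Proof.
move=> xz; rewrite enormE mulr_suml; apply: ler_sum => i _.
by rewrite !mxE; apply: phase_ge; exact: cube_center_coord.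
Qed.

Lemma eball_cube x r : r < 1 / 2 -> eball x r `<=` cube (center x).
Proof.
move=> r2 z zr i; have := le_coord_enorm (z - x) i.
move=> /le_lt_trans => /(_ _ zr); rewrite !mxE ltr_norml => /andP[h1 h2].
by apply/andP; split; lra.
Qed.

Variables (g : 'rV[R]_n -> R) (B : R).
Hypotheses (cg : continuous g) (g_ge0 : forall x, 0 <= g x).
Hypothesis g_growth : forall x (r : R), 0 < r <= 1 ->
  (\int[lebesgue_rV R n]_(z in eball x r) (g z)%:E <= (B * r ^+ n.-1)%:E)%E.

Let mg D : measurable_fun D g.
Proof. by apply: (measurable_funS measurableT) => //; exact: continuous_measurable_rV. Qed.

(** [f] is dominated by the sum of the [a i] on their balls; overlaps only enlarge the right-hand
    side. *)
Lemma cint_cover (I : finType) (a rho : I -> R) (c : I -> 'rV[R]_n)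
    (f : 'rV[R]_n -> R) y : continuous f -> (forall z, 0 <= f z) ->
  (forall i, 0 <= a i) -> (forall i, 0 < rho i <= 1) ->
  (forall z, cube y z -> exists2 i, eball (c i) (rho i) z & f z <= a i) ->
  cint y (fun z => f z * g z) <= B * \sum_i a i * rho i ^+ n.-1.
Proof.
move=> cf f0 a0 rho01 fa.
pose h i z : \bar R := (a i * g z)%:E.
have mh i D : measurable_fun D (h i).
  by apply/measurable_EFinP; apply: measurable_funM => //; exact: measurable_cst.
have h0 i z : (0 <= h i z)%E by rewrite lee_fin mulr_ge0.
have hb0 i z : (0 <= (h i \_ (eball (c i) (rho i))) z)%E.
  by rewrite /patch; case: ifPn.
have mhb i D : measurable D -> measurable_fun D (h i \_ (eball (c i) (rho i))).
  move=> mD; apply: (measurable_funS measurableT) => //.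
  by apply/(measurable_restrictT _ _).1 => //; exact: measurable_eball.
have mC := measurable_cube y.
rewrite -lee_fin cintE; last exact: continuousMp.
apply: (@le_trans _ _ (\int[lebesgue_rV R n]_(z in cube y)
    \sum_(i <- index_enum I) (h i \_ (eball (c i) (rho i))) z)%E).
  apply: ge0_le_integral => //.
  - by move=> z _; rewrite lee_fin mulr_ge0.
  - by apply/measurable_EFinP; apply: (measurable_funS measurableT) => //; apply: continuous_measurable_rV; exact: continuousMp.
  - by apply: emeasurable_sum => i; exact: mhb.
  move=> z /fa[i zi fi]; rewrite (bigD1_seq i) ?mem_index_enum ?index_enum_uniq //=.
  apply: (@le_trans _ _ ((h i \_ (eball (c i) (rho i))) z)).
    by rewrite patchE mem_set // lee_fin ler_wpM2r.
  by rewrite leeDl // sume_ge0.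
rewrite ge0_integral_sum //; last by move=> i; exact: mhb.
rewrite mulr_sumr -sumEFin; apply: lee_sum => i _.
apply: (@le_trans _ _ (\int[lebesgue_rV R n]_z (h i \_ (eball (c i) (rho i))) z)%E).
  by apply: ge0_subset_integral => //; exact: mhb.
rewrite -integral_mkcond.
have mb := measurable_eball (c i) (rho i).
under eq_integral do rewrite /h EFinM.
have mgE : measurable_fun (eball (c i) (rho i)) (fun z => (g z)%:E) by exact/measurable_EFinP.
have gE z : eball (c i) (rho i) z -> (0%:E <= (g z)%:E)%E by rewrite lee_fin.
have aE : (0%:E <= (a i)%:E)%E by rewrite lee_fin.
rewrite (ge0_integralZl (lebesgue_rV R n) mb mgE gE aE).
rewrite mulrCA EFinM; apply: lee_wpmul2l; first by rewrite lee_fin.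
exact: g_growth.
Qed.

Hypothesis n2 : (2 <= n)%N.

(** With mesh [1 / n], a point exceeds the grid point below it by at most [1 / n] in each
    coordinate, hence lies within [1 / sqrt n < 1] of it. *)
Definition grid y (k : {ffun 'I_n -> 'I_n.+1}) : 'rV[R]_n :=
  \row_i (y 0 i + (k i)%:R / n%:R).

Let n0 : 0 < n%:R :> R. Proof. by rewrite ltr0n (leq_trans _ n2). Qed.

Lemma grid_cover y z : cube y z -> exists k, eball (grid y k) 1 z.
Proof.
move=> yz; pose m i := Num.truncn (n%:R * (z 0 i - y 0 i)).
have mP i : (m i)%:R <= n%:R * (z 0 i - y 0 i) < (m i).+1%:R.
  by apply: truncn_itv; have /andP[h _] := yz i; rewrite mulr_ge0 ?subr_ge0 // ltW.
have mn i : (m i < n.+1)%N.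
  rewrite ltnS -(ler_nat R); have /andP[h _] := mP i; apply: (le_trans h).
  by have /andP[_ h'] := yz i; rewrite ger_pMr //; lra.
exists [ffun i => inord (m i)]; rewrite /eball /=.
rewrite -(@ltr_pXn2r _ 2) ?nnegrE ?enorm_ge0 // expr1n enormE.
have H i : (z - grid y [ffun i => inord (m i)]) 0 i ^+ 2 <= n%:R^-1 ^+ 2.
  rewrite !mxE ffunE inordK //; have /andP[l h] := mP i; rewrite -natr1 in h.
  have nw : n%:R * (z 0 i - (y 0 i + (m i)%:R / n%:R)) = n%:R * (z 0 i - y 0 i) - (m i)%:R.
    by field; rewrite gt_eqF.
  have w0 : 0 <= z 0 i - (y 0 i + (m i)%:R / n%:R) by rewrite -(pmulr_rge0 _ n0) nw subr_ge0.
  rewrite ler_pXn2r ?nnegrE ?invr_ge0 ?ler0n // -(ler_pM2l n0) nw divff ?gt_eqF //.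
  by lra.
apply: le_lt_trans (ler_sum _ (fun i _ => H i)) _.
rewrite sumr_const card_ord -(mulr_natr (n%:R^-1 ^+ 2)) expr2 divfK ?gt_eqF // invf_lt1 //.
by rewrite ltr1n.
Qed.

Lemma cint_growth y : cint y g <= B * #|{ffun 'I_n -> 'I_n.+1}|%:R.
Proof.
have -> : cint y g = cint y (fun z => 1 * g z).
  by apply: eq_Rintegral => z _; rewrite mul1r.
have := @cint_cover {ffun 'I_n -> 'I_n.+1} (fun=> 1) (fun=> 1) (grid y) (fun=> 1) y.
move=> H; apply: (le_trans (H _ _ _ _ _)) => //.
- exact: cst_continuous.
- by move=> i; rewrite ltr01 lexx.
- by move=> z /grid_cover[k]; exists k.
- by rewrite expr1n mulr1 sumr_const.
Qed.

(** Bounds [X ^+ n * expR (- (X / 64))], by [pow_expRN_le] at [X / 64]. The 64 is the 16 of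
    [phase_ge] times a squared factor 2, from the dyadic ratio or from the distance 1/2. *)
Definition growth_constant : R := (64 * n%:R) ^+ n.

Lemma growth_constant_ge1 : 1 <= growth_constant.
Proof.
apply: exprn_ege1; have : 2 <= n%:R :> R by rewrite ler_nat.
by lra.
Qed.

Let pow_exp_growth (X : R) : 0 <= X -> X ^+ n * expR (- (X / 64)) <= growth_constant.
Proof.
move=> X0; have X64 : 0 <= X / 64 by rewrite divr_ge0.
have := pow_expRN_le (leq_trans _ n2) X64 => /(_ isT) H.
rewrite /growth_constant exprMn -[X in X ^+ n * _](divfK (_ : 64 != 0 :> R)) //.
by rewrite exprMn mulrC mulrA mulrC ler_wpM2l ?exprn_ge0 // mulrC.
Qed.

Hypothesis B_ge0 : 0 <= B.

(* On the shell [2^(k-1) r <= |z - x| < 2^k r] the factor [exp (- 4^k / 64)] beats the ratio [2^(k n)],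
   which leaves a geometric series in [k]; beyond distance 1/2 the weight is bounded. *)
Lemma cint_heat_growth x (r : R) : 0 < r <= 1 ->
  cint (center x) (fun z => (r ^+ n.-1)^-1 * expR (- (wphase phase x z / r ^+ 2)) * g z)
    <= B * (growth_constant * (2 + #|{ffun 'I_n -> 'I_n.+1}|%:R)).
Proof.
move=> /andP[r0 r1]; set C := growth_constant; have C1 := growth_constant_ge1.
have C0 : 0 <= C := le_trans ler01 C1.
(* Enough dyadic balls to cover all points within 1/2 of [x]. *)
have [K Kr] : exists K, 1 < 2 ^+ K * r.
  exists (Num.bound r^-1); rewrite mulrC -ltr_pdivrMl // mulr1.
  exact: upper_nthrootP.
(* Dyadic balls around [x], and the unit balls of the grid for points at distance at least 1/2. *)
pose I := ('I_K.+1 + {ffun 'I_n -> 'I_n.+1})%type.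
pose a (i : I) : R := match i with
  | inl k => C * 2^-1 ^+ k * ((2 ^+ k * r) ^+ n.-1)^-1 | inr _ => C end.
(* Radii are capped at 1 to stay in the range of [g_growth]; the points served by dyadic balls are
   closer than 1/2 anyway. *)
pose rho (i : I) : R := match i with inl k => Num.min (2 ^+ k * r) 1 | inr _ => 1 end.
pose c (i : I) := match i with inl _ => x | inr k => grid (center x) k end.
have p0 k : 0 < 2 ^+ k * r by rewrite mulr_gt0 ?exprn_gt0.
have rn0 : 0 < r ^+ n.-1 by rewrite exprn_gt0.
have cw : continuous (fun z => (r ^+ n.-1)^-1 * expR (- (wphase phase x z / r ^+ 2))).
  apply: continuousZp => z.
  apply: (@continuous_comp _ _ _ (fun z => - (wphase phase x z / r ^+ 2)) (@expR R)); last exact: continuous_expR.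
  apply: continuousNp; apply: continuousMp; last exact: cst_continuous.
  apply: continuous_sum => i y.
  apply: (@continuous_comp _ _ _ (fun z : 'rV[R]_n => z 0 i - x 0 i) (@phase R)).
    by apply: continuousBp; [move=> w; exact: coord_continuous|exact: cst_continuous].
  by apply: differentiable_continuous; apply/derivable1_diffP; case: (is_derive_phase (y 0 i - x 0 i)).
have H := @cint_cover I a rho c _ (center x) cw.
apply: (le_trans (H _ _ _ _)).
- by move=> z; rewrite mulr_ge0 ?expR_ge0 // invr_ge0 ltW.
- by move=> [k|k] //=; rewrite !mulr_ge0 // ?exprn_ge0 ?invr_ge0 ?exprn_ge0 ?ltW.
- by move=> [k|k] /=; rewrite ?ltr01 ?lexx // lt_min p0 ltr01 ge_min lexx orbT.
- move=> z xz; set e := enorm (z - x); have e0 : 0 <= e := enorm_ge0 _.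
  have fle : (r ^+ n.-1)^-1 * expR (- (wphase phase x z / r ^+ 2)) <=
      (r ^+ n.-1)^-1 * expR (- (e ^+ 2 / 16 / r ^+ 2)).
    rewrite ler_wpM2l ?invr_ge0 ?(ltW rn0) // ler_expR lerN2.
    by rewrite ler_wpM2r ?invr_ge0 ?sqr_ge0 // wphase_ge.
  have [e2|e2] := ltP e (1 / 2); last first.
    have [k kz] := grid_cover xz; exists (inr k) => //=; apply: (le_trans fle).
    have ri : 1 <= r^-1 by rewrite invf_ge1.
    (* Here [X] is the inverse square of [r]: distance at least 1/2 makes the exponent at most
       [- X / 64], and the prefactor is at most [X ^+ n]. *)
    apply: le_trans (pow_exp_growth (exprn_ge0 2 (ltW (lt_le_trans ltr01 ri)))).
    apply: ler_pM; rewrite ?invr_ge0 ?expR_ge0 ?(ltW rn0) //.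
      by rewrite -exprVn -exprM ler_weXn2l // (leq_trans (leq_pred n)) // leq_pmull.
    rewrite ler_expR lerN2 exprVn [leLHS]mulrC ler_wpM2r ?invr_ge0 ?sqr_ge0 //.
    have : (1 / 2) ^+ 2 <= e ^+ 2 by rewrite ler_pXn2r ?nnegrE.
    by lra.
  have exK : exists k, e < 2 ^+ k * r by exists K; lra.
  case: (ex_minnP exK) => m em mmin.
  have mK : (m < K.+1)%N by rewrite ltnS mmin //; lra.
  exists (inl (Ordinal mK)) => /=.
    by rewrite /eball /= lt_min em /= (lt_trans e2) //; lra.
  apply: (le_trans fle).
  set E := expR _; pose P : R := 2 ^+ m; have P0 : 0 < P by rewrite exprn_gt0.
  (* The volume growth uses up [P ^+ n.-1]; the spare factor [P] becomes [2^-1 ^+ m], which is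
     summable. *)
  suff PE : P ^+ n * E <= C.
    have PnE : P ^+ n = P * P ^+ n.-1 by rewrite -exprS prednK ?(leq_trans _ n2).
    have -> : C * 2^-1 ^+ m * ((2 ^+ m * r) ^+ n.-1)^-1 = (r ^+ n.-1)^-1 * (C * (P ^+ n)^-1).
      rewrite exprVn exprMn -/P PnE !invfM.
      by move: (P^-1) ((P ^+ n.-1)^-1) ((r ^+ n.-1)^-1) => p q s; ring.
    by rewrite ler_wpM2l ?invr_ge0 ?(ltW rn0) // ler_pdivlMr ?exprn_gt0 // mulrC.
  (* In the innermost ball there is no lower bound on the distance, and the exponential is bounded
     by 1. *)
  case: m em mmin mK @P P0 => [|j] em mmin mK P P0.
    apply: le_trans C1; rewrite /P expr0 expr1n mul1r /E -[leRHS]expR0 ler_expR oppr_le0.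
    by rewrite !mulr_ge0 // ?sqr_ge0 // invr_ge0 sqr_ge0.
  have je : 2 ^+ j * r <= e.
    by rewrite leNgt; apply/negP => /mmin; rewrite ltnn.
  have P2 : 0 <= P ^+ 2 by exact: sqr_ge0.
  apply: le_trans (pow_exp_growth P2); apply: ler_pM; rewrite ?expR_ge0 ?exprn_ge0 ?(ltW P0) //.
    rewrite ler_pXn2r ?nnegrE ?(ltW P0) // ?(leq_trans _ n2) // ler_eXnr //.
    by rewrite exprn_ege1 // ler1n.
  rewrite /E ler_expR lerN2 ler_pdivlMr ?exprn_gt0 //.
  have : (2 ^+ j * r) ^+ 2 <= e ^+ 2 by rewrite ler_pXn2r ?nnegrE // ltW.
  have -> : P ^+ 2 / 64 * r ^+ 2 = (2 ^+ j * r) ^+ 2 / 16 by rewrite /P (exprS 2 j); move: ((2 : R) ^+ j) => p; field.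
  by rewrite ler_pM2r ?invr_gt0.
- rewrite ler_wpM2l // big_sumType /= mulrDr; apply: lerD; last first.
    under eq_bigr do rewrite expr1n mulr1.
    by rewrite sumr_const mulr_natr.
  apply: (@le_trans _ _ (\sum_(k < K.+1) C * 2^-1 ^+ k)).
    apply: ler_sum => k _; rewrite -mulrA ler_piMr ?mulr_ge0 ?exprn_ge0 //.
    rewrite ler_pdivrMl ?exprn_gt0 // mulr1 lerXn2r ?nnegrE ?(ltW (p0 k)) //.
      by rewrite le_min (ltW (p0 k)) ler01.
    by rewrite ge_min lexx.
  by rewrite -mulr_sumr ler_wpM2l // sum_half_pow_le.
Qed.

End ball_growth.

(** The unit ball lies in a bounded box. Finiteness lets its volume enter the final constant as a
    real number. *)
Lemma unit_ball_volume_fin {R : realType} (n : nat) : (unit_ball_volume R n < +oo)%E.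
Proof.
pose box m := [set v : 'rV[R]_m | forall i, v 0 i \in `]-1, 1[].
have mbox m : measurable (box m).
  rewrite (_ : box m = \bigcap_(i in [set: 'I_m])
    ((fun v : 'rV[R]_m => v 0 i) @^-1` `]-1, 1[)); last first.
    by apply/seteqP; split=> v h i; [move=> _; exact: h|exact: (h i I)].
  apply: fin_bigcap_measurable => // i _; rewrite -[X in measurable X]setTI.
  by apply: continuous_measurable_rV => // v; exact: coord_continuous.
suff box_fin : (lebesgue_rV R n (box n) < +oo)%E.
  apply: le_lt_trans box_fin; apply: le_measure; rewrite ?inE //; [exact: measurable_eball|exact: mbox|].
  move=> v v1 i; rewrite in_itv /= -ltr_norml.
  by apply: le_lt_trans v1; rewrite subr0; exact: le_coord_enorm.
elim: n => [|n IH].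
  rewrite [X in (X < _)%E](_ : _ = (\d_(0 : 'rV[R]_0) (box 0%N) : \bar R)) //.
  by rewrite diracE ltry.
rewrite [X in (X < _)%E](_ : _ =
  (lebesgue_measure \x lebesgue_rV R n)%E (@cons_rV R n @^-1` box n.+1)) //.
have -> : @cons_rV R n @^-1` box n.+1 = `]-1, 1[ `*` box n.
  apply/seteqP; split=> [[a v] h|[a v] [/= h1 h2] i].
    split=> [|i] /=; first by have := h ord0; rewrite mxE unlift_none.
    by have := h (lift ord0 i); rewrite mxE liftK.
  by rewrite mxE; case: unliftP => [j|] _ //=.
rewrite product_measure1E //; last exact: mbox.
have L1 : (lebesgue_measure (`](-1)%R, 1%R[%classic : set R) < +oo)%E.
  by rewrite lebesgue_measure_itv /=; case: ifPn => _; rewrite -?EFinB ltry.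
by rewrite lte_mul_pinfty ?ge0_fin_numE.
Qed.

(** In the exponent, [1 / 4] comes from the kernel on the ball of radius [r], and [pi ^ 2 n / 2]
    from half a unit of time. [2 ^+ n.-1] bounds the prefactor of the kernel half a unit of time
    earlier; the rest comes from [cint_heat_growth]. *)
Definition density_constant (R : realType) (n : nat) : R :=
  expR (1 / 4 + pi ^+ 2 * n%:R / 2) *
  (2 ^+ n.-1 * (growth_constant (n := n) * (2 + #|{ffun 'I_n -> 'I_n.+1}|%:R))).

(** * Density of balls at all times *)

Section density.
Context {R : realType} {n : nat}.
Hypothesis n2 : (2 <= n)%N.
Variables (eps : R) (u ut : R -> 'rV[R]_n -> R) (lam : R -> R).
Hypotheses (eps0 : 0 < eps) (fl : flow eps u ut lam).
Hypothesis u_lt1 : forall t x, 0 <= t -> -1 < u t x < 1.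
Hypothesis grad_bound : forall t x, 0 < t ->
  eps ^+ 2 * \sum_i partial i (u t) x ^+ 2 <= (1 - u t x ^+ 2) ^+ 2.
Variables c1 k B : R.
Hypotheses (c1_ge0 : 0 <= c1) (k0 : 0 <= k) (B_ge0 : 0 <= B).
Hypothesis lam_bound : forall b, 0 < b ->
  (\int[lebesgue_measure]_(t in `[0%R, b]) (lam t ^+ 2)%:E <= (c1 * (1 + b))%:E)%E.
Hypothesis initial_growth : forall x (r : R), 0 < r <= 1 ->
  (\int[lebesgue_rV R n]_(z in eball x r) (k * edens eps u 0 z)%:E <= (B * r ^+ n.-1)%:E)%E.

Let n1 : n.-1%:R = n%:R - 1 :> R.
Proof. by rewrite -[in RHS](prednK (leq_trans _ n2)) // -natr1 addrK. Qed.

Let N : R := 2 + #|{ffun 'I_n -> 'I_n.+1}|%:R.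

Let C1 : 1 <= growth_constant (n := n) :> R. Proof. exact: growth_constant_ge1. Qed.

Let growth_ge1 : N <= growth_constant (n := n) * N.
Proof. by rewrite ler_peMl // addr_ge0. Qed.

Let growth_ge0 : 0 <= growth_constant (n := n) * N.
Proof. by apply: le_trans growth_ge1; rewrite addr_ge0. Qed.

Let ce t : continuous (edens eps u t). Proof. exact (@continuous_edens _ _ _ _ _ _ fl t). Qed.

Let g_growth := @cint_heat_growth R n (fun z => k * edens eps u 0 z) B
  (continuousZp (c := k) (@ce 0)) (fun z => mulr_ge0 k0 (edens_ge0 u eps0 0 z))
  initial_growth n2 B_ge0.

Lemma weight_heat (x z : 'rV[R]_n) (s t0 t r : R) : 0 < r -> s - t = r ^+ 2 ->
  weight phase x (heat_exponent (n := n) s t0) (inverse_time s) t z =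
  (r ^+ n.-1)^-1 * expR (- (pi ^+ 2 * n%:R * (t - t0))) * expR (- (wphase phase x z / r ^+ 2)).
Proof.
move=> r0 st; rewrite /weight /heat_exponent /inverse_time st !expRD.
congr (_ * _ * expR (- _)); last by rewrite mulrC.
rewrite lnXn // mulr2n -n1.
rewrite (_ : _ * _ = - ln r * n.-1%:R); last by move: (ln r) (n.-1%:R) => a b; field.
by rewrite expRM_natr expRN lnK ?posrE // exprVn.
Qed.

Lemma mass_growth (y : 'rV[R]_n) (t : R) : 0 < t ->
  k * cint y (edens eps u t) <= B * N * expR (c1 * (1 + t) / 2).
Proof.
move=> t0; have H := wenergy_cst_le eps0 fl u_lt1 grad_bound y t0 (lam_bound t0).
apply: (le_trans (ler_wpM2l k0 H)).
rewrite mulrA -cintZ; last exact: ce.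
rewrite ler_wpM2r ?expR_ge0 //.
apply: (@le_trans _ _ (B * #|{ffun 'I_n -> 'I_n.+1}|%:R)).
  apply: cint_growth => //.
    exact: continuousZp (@ce 0).
  by move=> z; rewrite mulr_ge0 // edens_ge0.
by rewrite ler_wpM2l // lerDr.
Qed.

(** Up to time 1/2 the kernel at time 0 has scale [q <= 1], within reach of the dyadic estimate.
    Later its scale at [t0] is at least 1/2, so it is bounded and the unweighted energy suffices. *)
Lemma wenergy_initial_le (x : 'rV[R]_n) (t r t0 : R) : 0 < t -> 0 < r < 1 / 4 ->
  t0 = Num.max 0 (t - 1 / 2) ->
  k * wenergy eps u phase x (x - const_mx (1 / 2)) (heat_exponent (n := n) (t + r ^+ 2) t0)
    (inverse_time (t + r ^+ 2)) t0
  <= B * (2 ^+ n.-1 * (growth_constant (n := n) * N)) * expR (c1 * (1 + t) / 2).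
Proof.
move=> t_gt0 /andP[r0 r4] t0E; set y := x - _.
have GN := growth_ge0; have GN1 := growth_ge1.
have G1 : growth_constant (n := n) * N <= 2 ^+ n.-1 * (growth_constant (n := n) * N).
  by rewrite ler_peMl // exprn_ege1 // ler1n.
have rr : r ^+ 2 <= 1 / 16 by nra.
have rr0 : 0 < r ^+ 2 by rewrite exprn_gt0.
have [t2|t2] := leP t (1 / 2).
  have -> : t0 = 0 by rewrite t0E max_l // subr_le0.
  pose q := Num.sqrt (t + r ^+ 2).
  have q2 : q ^+ 2 = t + r ^+ 2 by rewrite sqr_sqrtr //; lra.
  have q0 : 0 < q by rewrite sqrtr_gt0; lra.
  have q1 : q <= 1 by rewrite -(@ler_pXn2r _ 2) ?nnegrE ?(ltW q0) // expr1n q2; lra.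
  rewrite -cintZ; last first.
    exact: (continuousMp (@continuous_weight _ _ _ _ is_derive_phase _ _ _ _) (@ce 0)).
  have q01 : 0 < q <= 1 by rewrite q0.
  have := g_growth x q01; rewrite -/y => H.
  have -> : cint y (fun z => k * (weight phase x (heat_exponent (n := n) (t + r ^+ 2) 0)
       (inverse_time (t + r ^+ 2)) 0 z * edens eps u 0 z)) =
     cint y (fun z => (q ^+ n.-1)^-1 * expR (- (wphase phase x z / q ^+ 2)) * (k * edens eps u 0 z)).
    apply: eq_Rintegral => z _; rewrite (weight_heat _ _ _ q0) ?subr0 ?q2 //.
    by rewrite mulr0 oppr0 expR0 mulr1 mulrCA.
  apply: (le_trans H); apply: (@le_trans _ _ (B * (2 ^+ n.-1 * (growth_constant (n := n) * N)))).
    by rewrite ler_wpM2l.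
  have G0 : 0 <= B * (2 ^+ n.-1 * (growth_constant (n := n) * N)).
    by rewrite mulr_ge0 // mulr_ge0 // exprn_ge0.
  rewrite ler_peMr //.
  by rewrite -[leLHS]expR0 ler_expR divr_ge0 // mulr_ge0 //; lra.
have t0t : t0 = t - 1 / 2 by rewrite t0E max_r // subr_ge0 ltW.
have t00 : 0 < t0 by rewrite t0t subr_gt0.
pose q := Num.sqrt (1 / 2 + r ^+ 2).
have q2 : q ^+ 2 = 1 / 2 + r ^+ 2 by rewrite sqr_sqrtr //; lra.
have q0 : 0 < q by rewrite sqrtr_gt0; lra.
have q1 : 1 / 2 <= q by rewrite -(@ler_pXn2r _ 2) ?nnegrE ?(ltW q0) // q2; lra.
have st : t + r ^+ 2 - t0 = q ^+ 2 by rewrite q2 t0t; lra.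
apply: (@le_trans _ _ (k * (2 ^+ n.-1 * cint y (edens eps u t0)))).
  rewrite ler_wpM2l // -cintZ; last exact: ce.
  apply: cint_le => [||z].
  - exact: (continuousMp (@continuous_weight _ _ _ _ is_derive_phase _ _ _ _) (@ce t0)).
  - exact: continuousZp (@ce t0).
  rewrite ler_wpM2r ?edens_ge0 // (weight_heat _ _ _ q0 st) subrr mulr0 oppr0 expR0 mulr1.
  rewrite -[leRHS]mulr1; apply: ler_pM; rewrite ?expR_ge0 ?invr_ge0 ?exprn_ge0 ?(ltW q0) //.
    rewrite -exprVn lerXn2r ?nnegrE ?invr_ge0 ?(ltW q0) //.
    by rewrite invf_ple ?posrE //; lra.
  rewrite -[leRHS]expR0 ler_expR oppr_le0 divr_ge0 ?sqr_ge0 //.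
  by apply: sumr_ge0 => i _; exact: phase_ge0.
rewrite mulrCA; apply: (le_trans (ler_wpM2l (exprn_ge0 _ (ler0n _ 2)) (mass_growth y t00))).
rewrite [leLHS]mulrA; apply: ler_pM; rewrite ?expR_ge0 //.
- by rewrite mulr_ge0 ?exprn_ge0 // mulr_ge0 // addr_ge0.
- by rewrite mulrCA ler_wpM2l // ler_wpM2l ?exprn_ge0.
by rewrite ler_expR ler_wpM2r // ler_wpM2l //; lra.
Qed.

(** The pole [t + r ^+ 2] gives the kernel scale [r] at time [t], hence a lower bound of order
    [(r ^+ n.-1)^-1] on the ball. The stretches before and after [t0] each cost at most
    [expR (c1 * (1 + t) / 2)], and the product is the stated exponential. *)
Lemma flow_density (x : 'rV[R]_n) (t r : R) : 0 <= t -> 0 < r < 1 / 4 ->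
  (\int[lebesgue_rV R n]_(z in eball x r) (k * edens eps u t z)%:E <=
    (density_constant R n * B * expR (c1 * (1 + t)) * r ^+ n.-1)%:E)%E.
Proof.
move=> t_ge0 r01; have /andP[r0 r4] := r01.
have N2 : 2 <= N by rewrite lerDl.
have rn0 : 0 < r ^+ n.-1 by rewrite exprn_gt0.
(* At time 0 there is no earlier time to start from, and the initial growth applies directly. *)
move: t_ge0; rewrite le_eqVlt => /orP[/eqP <-|t_gt0].
  apply: (le_trans (initial_growth x _)); first by apply/andP; split=> //; lra.
  rewrite lee_fin ler_wpM2r ?(ltW rn0) // mulrAC ler_peMl // mulr_ege1 //.
    rewrite mulr_ege1 //; first by rewrite -[leLHS]expR0 ler_expR addr_ge0 // divr_ge0 // mulr_ge0 ?sqr_ge0.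
    rewrite mulr_ege1 ?exprn_ege1 ?ler1n //.
    by apply: le_trans growth_ge1; rewrite /N -[leLHS]addr0; apply: lerD; rewrite ?ler1n.
  by rewrite -[leLHS]expR0 ler_expR mulr_ge0.
pose t0 := Num.max 0 (t - 1 / 2).
have t00 : 0 <= t0 by rewrite le_max lexx.
have t0t : t0 < t by rewrite gt_max t_gt0; lra.
have tt0 : t - t0 <= 1 / 2.
  by rewrite lerBlDr -lerBlDl le_max; apply/orP; right; lra.
have rr0 : 0 < r ^+ 2 by rewrite exprn_gt0.
set y := x - const_mx (1 / 2).
pose s := t + r ^+ 2; have ts : t < s by rewrite ltrDl.
have st : s - t = r ^+ 2 by rewrite /s addrC addKr.
have M := wenergy_heat_le eps0 fl u_lt1 grad_bound x y t00 t0t ts (lam_bound t_gt0).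
have I := wenergy_initial_le x t_gt0 r01 (erefl t0).
pose w := weight phase x (heat_exponent (n := n) s t0) (inverse_time s) t.
have cw : continuous w := @continuous_weight _ _ _ _ is_derive_phase _ _ _ _.
pose A : R := expR (1 / 4 + pi ^+ 2 * n%:R / 2).
have wA z : eball x r z -> 1 <= A * r ^+ n.-1 * w z.
  move=> zr; rewrite /w (weight_heat _ _ _ r0 st) -mulrA !mulrA mulfK ?gt_eqF //.
  rewrite /A -!expRD -[leLHS]expR0 ler_expR.
  have Q : wphase phase x z / r ^+ 2 <= 1 / 4.
    rewrite ler_pdivrMr // mulrC mulrA mulr1; apply: (le_trans (wphase_le x z)).
    by rewrite ler_pM2r // lerXn2r ?nnegrE ?enorm_ge0 ?(ltW r0) // ltW.
  have P : pi ^+ 2 * n%:R * (t - t0) <= pi ^+ 2 * n%:R / 2.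
    have p0 : 0 <= pi ^+ 2 * n%:R :> R by rewrite mulr_ge0 ?sqr_ge0.
    by have := ler_wpM2l p0 tt0; rewrite mulrA mulr1.
  by lra.
have ge0 t' z : 0 <= k * edens eps u t' z by rewrite mulr_ge0 // edens_ge0.
have mb := measurable_eball x r.
have cf : continuous (fun z => A * r ^+ n.-1 * k * (w z * edens eps u t z)).
  exact: continuousZp (continuousMp cw (@ce t)).
have f0 z : 0 <= A * r ^+ n.-1 * k * (w z * edens eps u t z).
  by rewrite !mulr_ge0 ?expR_ge0 ?(ltW rn0) ?edens_ge0.
have mE (f : 'rV[R]_n -> R) D : continuous f -> measurable_fun D (fun z => (f z)%:E).
  move=> c; apply/measurable_EFinP; apply: (measurable_funS measurableT) => //.
  exact: continuous_measurable_rV.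
apply: (@le_trans _ _ (\int[lebesgue_rV R n]_(z in eball x r)
    (A * r ^+ n.-1 * k * (w z * edens eps u t z))%:E)%E).
  apply: ge0_le_integral => //.
  - by move=> z _; rewrite lee_fin.
  - by apply: mE; exact: continuousZp (@ce t).
  - exact: mE.
  - move=> z zr; rewrite lee_fin -[leLHS]mul1r [leRHS](_ : _ = A * r ^+ n.-1 * w z * (k * edens eps u t z)).
      by rewrite ler_wpM2r // wA.
    by move: (w z) (edens _ _ _ _) => a e; ring.
apply: (@le_trans _ _ (\int[lebesgue_rV R n]_(z in cube y)
    (A * r ^+ n.-1 * k * (w z * edens eps u t z))%:E)%E).
  apply: ge0_subset_integral => //; first exact: measurable_cube.
    exact: mE.
    by move=> z _; rewrite lee_fin.
  by apply: eball_cube; lra.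
rewrite -cintE // cintZ; last exact: continuousMp cw (@ce t).
rewrite lee_fin -/(wenergy eps u phase x y (heat_exponent (n := n) s t0) (inverse_time s) t).
have An : 0 <= A * r ^+ n.-1 by rewrite mulr_ge0 ?expR_ge0 ?(ltW rn0).
rewrite -[leLHS]mulrA; apply: (le_trans (ler_wpM2l An (ler_wpM2l k0 M))).
have e0 : 0 <= expR (c1 * (1 + t) / 2) by exact: expR_ge0.
have := ler_wpM2l An (ler_wpM2r e0 I); rewrite -[X in _ * X <= _]mulrA => /le_trans; apply.
have -> : expR (c1 * (1 + t)) = expR (c1 * (1 + t) / 2) * expR (c1 * (1 + t) / 2).
  by rewrite -expRD; congr expR; field.
rewrite /density_constant -/A -/N.
rewrite le_eqVlt; apply/orP; left; apply/eqP.
by move: (A) (expR _) (2 ^+ _) growth_constant N (r ^+ _) => a e p q N' r'; ring.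
Qed.

End density.

(** * Classical solutions *)

Section flow_of_solution.
Context {R : realType} {n : nat}.

Lemma is_derive_W (s : R) : is_derive s 1 (@W R) (- (2 * s * (1 - s ^+ 2))).
Proof.
have H := is_deriveMcp 2^-1 (is_derive_sqrp (is_deriveBp (is_derive_cst (1 : R) s (1 : R))
  (is_derive_sqrp (is_derive_id (s : R) (1 : R))))).
by apply: (is_derive_eq H); rewrite /cst /=; field.
Qed.

Lemma derive1_W (s : R) : derive1 (@W R) s = - (2 * s * (1 - s ^+ 2)).
Proof. by rewrite derive1E; have H := is_derive_W s; exact: derive_val. Qed.

Lemma sqrt_2W (s : R) : Num.sqrt (2 * W s) = `|1 - s ^+ 2|.
Proof. by rewrite /W mulrC divfK // sqrtr_sqr. Qed.

Lemma continuous_clamp (F : R * 'rV[R]_n -> R) :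
  {within [set p : R * 'rV[R]_n | 0 <= p.1], continuous F} ->
  continuous (fun p : R * 'rV[R]_n => F (Num.max p.1 0, p.2)).
Proof.
move=> /subspace_continuousP cF p.
pose c (p : R * 'rV[R]_n) := (Num.max p.1 0, p.2).
have cc : {for p, continuous c}.
  apply: continuous_pairp; last exact: cvg_snd.
  apply: (@continuous_max _ _ (fun p : R * 'rV[R]_n => p.1) (fun=> 0)); last exact: cvg_cst.
  exact: cvg_fst.
have c0 q : [set p : R * 'rV[R]_n | 0 <= p.1] (c q) by rewrite /= le_max lexx orbT.
move=> U /(cF (c p) (c0 p)) /cc H.
change (nbhs p [set q | [set p : R * 'rV[R]_n | 0 <= p.1] (c q) -> U (F (c q))]) in H.
change (nbhs p [set q | U (F (c q))]).
by apply: filterS H => q; apply.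
Qed.

(* Freezing [phi] at negative times turns the one-sided continuity at [t = 0]
   into continuity, so that no limits within half spaces are needed later. *)
Lemma flow_of_solution (eps : R) (phi0 : 'rV[R]_n -> R) (phi : R -> 'rV[R]_n -> R) :
  solution eps phi0 phi ->
  flow eps (fun t => phi (Num.max t 0)) (fun t x => derive1 (phi ^~ x) t)
    (fun t => lambda_of eps (phi t)).
Proof.
move=> sol; have m0 (t : R) : 0 <= Num.max t 0 by rewrite le_max lexx orbT.
split.
- by move=> t; exact: (sol_periodic sol).
- by move=> t; exact: (sol_C2 sol).
- exact (continuous_clamp (sol_continuous sol)).
- by move=> i; exact (continuous_clamp (@sol_grad_continuous _ _ _ _ _ sol i)).
- by move=> i j; exact (continuous_clamp (@sol_hess_continuous _ _ _ _ _ sol i j)).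
- move=> t x t0; apply: (@near_eq_is_derive _ _ _ (phi ^~ x)).
    near=> s; rewrite max_l //; near: s.
    by apply: filterS (lt_nbhsr t0) => s /ltW.
  by apply: DeriveDef; [exact: (sol_derivable sol)|rewrite -derive1E].
- move=> p p0; have /subspace_continuousP := sol_dt_continuous sol => /(_ p p0) H.
  move=> U /H; rewrite /= => HU.
  have op : nbhs p [set q : R * 'rV[R]_n | 0 < q.1].
    have : {for p, continuous (fun q : R * 'rV[R]_n => q.1)} by exact: cvg_fst.
    by move=> /(_ _ (lt_nbhsr p0)).
  pose f (q : R * 'rV[R]_n) := derive1 (phi ^~ q.2) q.1.
  change (nbhs p [set q : R * 'rV[R]_n | 0 < q.1 -> U (f q)]) in HU.
  change (nbhs p [set q | U (f q)]).
  by apply: filterS2 HU op => q; apply.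
- move=> t x t0; rewrite (sol_equation sol x t0) derive1_W sqrt_2W.
  by rewrite max_l ?(ltW t0) // mulNr opprK.
Unshelve. all: by end_near. Qed.

(** Mean value theorem on the segment, then Cauchy-Schwarz in the form
    [|v| v_i p_i <= (v_i^2 + |v|^2 p_i^2) / 2], summed over [i]. *)
Lemma grad_le1_lipschitz (f : 'rV[R]_n -> R) : Ck 1 f ->
  (forall x, enorm (grad f x) <= 1) -> forall x y, f x - f y <= enorm (x - y).
Proof.
move=> f1 g1 x y; set v := x - y.
have [s _] := MVT_line y (v := v) 1 (fun z => @ex_derive _ _ _ _ _ _ _ (Ck1_is_derive z v f1)).
rewrite scale1r subrK mul1r => ->.
have -> := @derive_val _ _ _ _ _ _ _ (Ck1_is_derive ((s * 1) *: v + y) v f1).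
set z := _ *: v + y; have := enorm_ge0 v; rewrite le_eqVlt => /orP[/eqP v0|v0].
  rewrite -v0 big1 // => i _; apply/eqP; rewrite mulf_eq0 -normr_le0.
  by rewrite (le_trans (le_coord_enorm v i)) // -v0.
have G : \sum_i partial i f z ^+ 2 <= 1.
  have := g1 z; rewrite -(@ler_pXn2r _ 2) ?nnegrE ?enorm_ge0 // expr1n enormE.
  by under eq_bigr do rewrite mxE.
rewrite -(ler_pM2l v0) mulr_sumr.
apply: (@le_trans _ _ (\sum_i (v 0 i ^+ 2 + enorm v ^+ 2 * partial i f z ^+ 2) / 2)).
  apply: ler_sum => i _; have := sqr_ge0 (v 0 i - enorm v * partial i f z).
  by move: (v 0 i) (partial i f z) (enorm v) => a b c; nra.
rewrite -mulr_suml big_split /= -mulr_sumr -enormE ler_pdivrMr //.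
have := ler_wpM2l (sqr_ge0 (enorm v)) G; rewrite mulr1.
by move: (\sum_i _) (enorm v) => a b; nra.
Qed.

End flow_of_solution.

Theorem proposition3p8 (R : realType) (d : nat) (d_ge2 : (2 <= d)%N) :
  exists2 c6 : R, 0 < c6 &
    forall (D0 : R) (U0 : set 'rV[R]_d) (U : (set 'rV[R]_d)^nat)
      (eps : R^nat) (phi0 : nat -> 'rV[R]_d -> R)
      (phi : nat -> R -> 'rV[R]_d -> R) (omega D1 c1 eps1 : R),
    0 < D0 ->
    initial_set D0 U0 U ->
    (forall i, 0 < eps i < 1) ->
    nonincreasing_seq eps ->
    eps @ \oo --> 0 ->
    (forall i, initial_datum (eps i) (U i) (phi0 i)) ->
    (forall i, solution (eps i) (phi0 i) (phi i)) ->
    0 < omega -> 0 < D1 -> 0 < c1 -> 0 < eps1 ->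
    (forall i,
      `|\int[lebesgue_rV R d]_(x in Omega) kfun (phi0 i x)| <= 2 / 3 - omega) ->
    (forall i, (energy_measure (eps i) (phi0 i) Omega <= D1%:E)%E) ->
    (forall i x r, 0 < r <= 1 ->
      (energy_measure (eps i) (phi0 i) (eball x r) <=
         D1%:E * (unit_ball_volume R d.-1 * (r ^+ d.-1)%:E))%E) ->
    (forall i T, eps i < eps1 -> 0 < T ->
      (\int[lebesgue_measure]_(t in `[0%R, T])
          (`|lambda_of (eps i) (phi i t)| ^+ 2)%:E <=
         (c1 * (1 + T))%:E)%E) ->
    forall i (x : 'rV[R]_d) (t r : R),
      eps i < eps1 -> Omega x -> 0 <= t -> 0 < r < 1 / 4 ->
      (energy_measure (eps i) (phi i t) (eball x r) * ((r ^+ d.-1)^-1)%:E <=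
         (c6 * D1 * (1 + t) * expR (c1 * (1 + t)))%:E)%E.
Proof.
pose v : R := fine (unit_ball_volume R d.-1).
have vE : unit_ball_volume R d.-1 = v%:E by rewrite fineK // ge0_fin_numE // unit_ball_volume_fin.
have v0 : 0 <= v by exact: fine_ge0.
have K0 : 0 < density_constant R d.
  rewrite mulr_gt0 ?expR_gt0 // mulr_gt0 ?exprn_gt0 // mulr_gt0 ?ltr_pwDl //.
  by rewrite (lt_le_trans ltr01) // growth_constant_ge1.
(* Adding 1 to the volume [v] makes the constant visibly positive. *)
exists (density_constant R d * (v + 1)); first by rewrite mulr_gt0 // ltr_pwDr.
move=> D0 U0 U eps phi0 phi omega D1 c1 eps1 _ _ eps01 _ _ init sol _ D1_gt0 c1_gt0 _ _ _
  balls lam_bound i x t r eps_lt _ t_ge0 r01.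
have /andP[eps0 _] := eps01 i; have /andP[r0 r4] := r01.
have fl := flow_of_solution (sol i).
set u := (fun t => phi i (Num.max t 0)) in fl; set lam := (fun t => lambda_of (eps i) (phi i t)) in fl.
have lam2 b : 0 < b ->
    (\int[lebesgue_measure]_(t in `[0%R, b]) (lam t ^+ 2)%:E <= (c1 * (1 + b))%:E)%E.
  move=> /(lam_bound i b eps_lt); under eq_integral do rewrite real_normK ?num_real //.
  by [].
have [rbar [rbar3 _ [rbar_grad _] _ phi0E]] := init i.
have u0E z : u 0 z = tanh (rbar z / eps i) by rewrite /u maxxx (sol_initial (sol i)) phi0E.
have u0_lt1 z : -1 < u 0 z < 1 by rewrite u0E; exact: tanh_lt1.
have rbar1 : Ck 1 rbar.
  have [c3 c3'] := rbar3; split; first exact c3.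
  by move=> j; have [h1 [h2 _]] := c3' j; exact (conj h1 h2).
(* At time 0, [eps * artanh u] is [rbar], whose gradient has norm at most 1. *)
have lip z w : eps i * artanh (u 0 z) - eps i * artanh (u 0 w) <= enorm (z - w).
  rewrite !u0E !artanh_tanh !(mulrC (eps i)) !divfK ?gt_eqF //.
  exact: grad_le1_lipschitz.
have u_lt1 s z : 0 <= s -> -1 < u s z < 1.
  apply: (flow_lt1 (c := fun b => c1 * (1 + b)) eps0 fl) => // a b ab.
  by rewrite ler_wpM2l ?(ltW c1_gt0) // lerD2l.
have grad_bound s z : 0 < s ->
    eps i ^+ 2 * \sum_j partial j (u s) z ^+ 2 <= (1 - u s z ^+ 2) ^+ 2.
  move=> s0; apply: lipschitz_grad => //; first exact: Ck2_Ck1 (flow_C2 fl s).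
    by move=> w; apply: u_lt1; exact: ltW.
  by apply: (flow_lipschitz eps0 fl s0) => // s' w /andP[s'0 _]; exact: u_lt1.
pose k := (sigma R)^-1.
have k0 : 0 <= k by rewrite invr_ge0; apply: Rintegral_ge0 => s _; exact: sqrtr_ge0.
have energyE s w q : 0 <= s -> energy_measure (eps i) (phi i s) (eball w q) =
    (\int[lebesgue_rV R d]_(z in eball w q) (k * edens (eps i) u s z)%:E)%E.
  move=> s0; rewrite /energy_measure.
  have e0 z : eball w q z -> (0 <= (edens (eps i) u s z)%:E)%E.
    by rewrite lee_fin edens_ge0.
  have me : measurable_fun (eball w q) (fun z => (edens (eps i) u s z)%:E).
    apply/measurable_EFinP; apply: (measurable_funS measurableT) => //.
    apply: continuous_measurable_rV => z; exact: (continuous_edens fl).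
  have kE : (0%:E <= k%:E)%E by rewrite lee_fin.
  under [RHS]eq_integral do rewrite EFinM.
  rewrite (ge0_integralZl (lebesgue_rV R d) (measurable_eball w q) me e0 kE).
  congr (_ * _)%E; apply: eq_integral => z _; congr EFin.
  rewrite /edens enormE /u max_l //; congr (_ * _ / _ + _).
  by apply: eq_bigr => j _; rewrite mxE.
have growth z q : 0 < q <= 1 ->
    (\int[lebesgue_rV R d]_(w in eball z q) (k * edens (eps i) u 0 w)%:E
      <= (D1 * v * q ^+ d.-1)%:E)%E.
  move=> q01; rewrite -energyE //.
  have -> : phi i 0 = phi0 i by apply/funext => w; exact: (sol_initial (sol i)).
  by apply: (le_trans (balls i z q q01)); rewrite vE -!EFinM mulrA.
have D1v : 0 <= D1 * v by rewrite mulr_ge0 // ltW.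
have H := flow_density d_ge2 eps0 fl u_lt1 grad_bound (ltW c1_gt0) k0 D1v lam2 growth x t_ge0 r01.
have rd0 : 0 < r ^+ d.-1 by rewrite exprn_gt0.
rewrite energyE //; apply: (le_trans (lee_wpmul2r _ H)); first by rewrite lee_fin invr_ge0 ltW.
rewrite -EFinM lee_fin mulfK ?gt_eqF //; move: (expR _) (expR_ge0 (c1 * (1 + t))) => e e0.
rewrite ler_wpM2r // -[leLHS]mulr1; apply: ler_pM; rewrite ?lerDl //.
  by rewrite mulr_ge0 // ltW.
by rewrite -mulrA ler_wpM2l ?(ltW K0) // mulrC ler_wpM2r ?(ltW D1_gt0) // lerDl.
Qed.
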